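(* Let $\{\bar{\mathscr{M}}(t)\}_{t\ge0}$ be the multivariate generalized counting process time-changed by an independent multivariate gamma subordinator, with parameters $q$, $k_i$, $\lambda_{ij_i}$, $\lambda$, $\theta$, $a_i$ as in the context. Then the Lévy measure of $\{\bar{\mathscr{M}}(t)\}_{t\ge0}$ is given, for Borel sets $A_1,\dots,A_q\subseteq\mathbb{R}$, by $$\begin{aligned} \Pi_{\bar{\mathscr{M}}(t)}(A_1 \times A_2\times\dots\times A_q) &=\lambda\sum_{i=1}^{q}\sum_{n_i=1}^{\infty}\sum_{\Omega(k_i,n_i)}\Gamma(\eta_i)\,\mathbb{I}_{\{n_i\in A_i\}}\prod_{j_i=1}^{k_i}\Big(\frac{\lambda_{ij_i}}{a_i+\lambda_i}\Big)^{n_{ij_i}}\frac{1}{n_{ij_i}!}\\ &\quad+\lambda\sum_{\bar{n}\succ \bar{0}}\sum_{k=1}^{\infty}\frac{\theta^k}{k}\prod_{i=1}^{q}\Big(\frac{a_i}{a_i+\lambda_i}\Big)^{k} \sum_{\Omega(k_i,n_i)}(k)_{\eta_i}\,\mathbb{I}_{\{n_i\in A_i\}}\prod_{j_i=1}^{k_i}\Big(\frac{\lambda_{ij_i}}{a_i+\lambda_i}\Big)^{n_{ij_i}}\frac{1}{n_{ij_i}!}, \end{aligned}$$ where $\lambda_i=\lambda_{i1}+\lambda_{i2}+\dots+\lambda_{ik_i}$ and $\eta_i=n_{i1}+n_{i2}+\dots+n_{ik_i}$.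
   Context: Multivariate GCP: let $q\in\mathbb{N}$, $k_1,\dots,k_q\in\mathbb{N}$ and $\lambda_{ij_i}>0$ for $1\le i\le q$, $1\le j_i\le k_i$. $\bar M(t)=(M_1(t),\dots,M_q(t))$ has independent component processes, where $\{M_i(t)\}_{t\ge0}$ is a generalized counting process (GCP): a Lévy process performing independent jumps of sizes $j_i=1,\dots,k_i$ with rates $\lambda_{ij_i}$, so that $\mathbb{E}(u^{M_i(t)})=\exp\big(-t\sum_{j_i=1}^{k_i}\lambda_{ij_i}(1-u^{j_i})\big)$, $|u|\le1$. Multivariate gamma subordinator: let $\lambda>0$, $0<\theta<1$, $a_1,\dots,a_q>0$. $\{Z_i(t)\}_{t\ge0}$, $i=1,\dots,q$, are independent gamma Lévy processes with $Z_i(t)\sim\Gamma(\lambda t,a_i)$ (shape $\lambda t$, rate $a_i$), and $\{B^-(\lambda t)\}_{t\ge0}$ is a negative binomial Lévy process with $\Pr\{B^-(\lambda t)=n\}=(1-\theta)^{\lambda t}\binom{n+\lambda t-1}{n}\theta^n$, $n\ge0$, independent of the $Z_i$'s. $\bar G(t)=(G_1(t),\dots,G_q(t))$ with $G_i(t)=Z_i(t+\lambda^{-1}B^-(\lambda t))$, the components being conditionally independent given $\{B^-(\lambda t)\}_{t\ge0}$. Time-changed process: $\{\bar M(t)\}_{t\ge0}$ and $\{\bar G(t)\}_{t\ge0}$ are independent and $\bar{\mathscr{M}}(t)=(\mathscr{M}_1(t),\dots,\mathscr{M}_q(t))$ with $\mathscr{M}_i(t)=M_i(G_i(t))$. Notation: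 $\mathbb{I}$ is the indicator function; $\mathbb{N}_0=\{0,1,2,\dots\}$; $\Omega(k_i,n_i)=\{(n_{i1},\dots,n_{ik_i}):\sum_{j_i=1}^{k_i}j_in_{ij_i}=n_i,\ n_{ij_i}\in\mathbb{N}_0\}$, and a sum over $\Omega(k_i,n_i)$ is over these tuples (so $\eta_i$ depends on the tuple); $\bar n\succ\bar0$ means $\bar n=(n_1,\dots,n_q)\in\mathbb{N}_0^q$ with $\bar n\ne\bar0=(0,\dots,0)$; $(x)_0=1$ and $(x)_k=x(x+1)\cdots(x+k-1)$ for $k\ge1$.
   Formalization: In the first sum the indicator of n_i ∈ A_i is multiplied by the indicators of 0 ∈ A_l for all l ≠ i, since these jumps lie on coordinate axes; the printed formula fails for q ≥ 2, e.g. q = 2 and A_1 = A_2 = {1}. *)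

(* Defs.v *)
From HB Require Import structures.
From mathcomp Require Import all_boot all_order all_algebra.
From mathcomp Require Import all_classical all_reals all_analysis.
Import Order.TTheory GRing.Theory Num.Theory.
Import numFieldNormedType.Exports.

Set Implicit Arguments.
Unset Strict Implicit.
Unset Printing Implicit Defensive.

Local Open Scope classical_set_scope.
Local Open Scope ring_scope.

(* Processes have the form X : R -> T -> _ (time first); only times t >= 0
   are ever constrained or used. *)

Section Processes.
Context (R : realType) (d : measure_display) (T : measurableType d).
Variable P : probability T R.

Definition cadlag (f : R -> R) : Prop :=
  forall t : R, 0 <= t ->
    f s @[s --> t^'+] --> f t /\ (0 < t -> cvg (f s @[s --> t^'-])).

Definition independent_increments (X : R -> T -> R) : Prop :=
  forall (n : nat) (t : nat -> R) (A : nat -> set R),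
    0 <= t 0%N ->
    (forall k, (k < n)%N -> t k <= t k.+1) ->
    (forall k, (k < n)%N -> measurable (A k)) ->
    fine (P [set w | forall k, (k < n)%N -> A k (X (t k.+1) w - X (t k) w)]) =
    \prod_(k < n) fine (P [set w | A k (X (t k.+1) w - X (t k) w)]).

Definition stationary_increments (X : R -> T -> R) : Prop :=
  forall (s t : R) (A : set R), 0 <= s -> 0 <= t -> measurable A ->
    P [set w | A (X (s + t) w - X s w)] = P [set w | A (X t w)].

Definition stochastically_continuous (X : R -> T -> R) : Prop :=
  forall t e : R, 0 <= t -> 0 < e ->
    P [set w | e <= `|X s w - X t w|]
      @[s --> within `[0, +oo[ (nbhs t)] --> 0%E.

Definition levy_process (X : R -> T -> R) : Prop :=
  [/\ (forall t : R, 0 <= t -> measurable_fun setT (X t)),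
      {ae P, forall w, X 0 w = 0},
      independent_increments X /\ stationary_increments X,
      stochastically_continuous X
    & forall w, cadlag (X ^~ w)].

(* sigma-algebra generated by a family of processes, over all times t >= 0 *)
Definition process_sigma (I : Type) (X : I -> R -> T -> R) : set (set T) :=
  <<s [set E | exists (i : I) (t : R) (A : set R),
         [/\ 0 <= t, measurable A & E = X i t @^-1` A]] >>.

Definition sigma_independent (F G : set (set T)) : Prop :=
  forall E E' : set T, F E -> G E' -> P (E `&` E') = (P E * P E')%E.

(* Each process_sigma contains setT, so the product rule over the whole index
   set also covers every subfamily. *)
Definition independent_processes (I : finType) (X : I -> R -> T -> R) : Prop :=
  forall E : I -> set T,
    (forall i, process_sigma (fun _ : unit => X i) (E i)) ->
    fine (P [set w | forall i, E i w]) = \prod_(i : I) fine (P (E i)).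

Definition jump (q : nat) (X : R -> T -> 'rV[R]_q) (w : T) (t : R) : 'rV[R]_q :=
  X t w - lim (X s w @[s --> t^'-]).

Definition jump_times (q : nat) (X : R -> T -> 'rV[R]_q) (A : set 'rV[R]_q)
    (w : T) : set R :=
  [set t | [/\ 0 < t <= 1, jump X w t != 0 & A (jump X w t)]].

(* The jump intensity: the expected number, per unit of time, of nonzero jumps
   X_t - X_{t-} that belong to A. For a Levy process this is the measure of its
   Levy-Khintchine triplet. *)
Definition levy_measure (q : nat) (X : R -> T -> 'rV[R]_q)
    (A : set 'rV[R]_q) : \bar R :=
  (\int[P]_w counting (jump_times X A w))%E.

(* Generalized counting process with jumps of sizes 1, ..., k; the jump size
   j + 1 has rate lam j, as 'I_k = {0, ..., k - 1}. *)
Definition gcp (k : nat) (lam : 'I_k -> R) (M : R -> T -> nat) : Prop :=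
  levy_process (fun t w => (M t w)%:R) /\
  forall t u : R, 0 <= t -> `|u| <= 1 ->
    'E_P[fun w => (u ^+ M t w)%R]%E =
    (expR (- t * \sum_(j < k) lam j * (1 - u ^+ j.+1)))%:E.

Definition Gamma (s : R) : R :=
  \int[lebesgue_measure]_(x in `]0, +oo[) (x `^ (s - 1) * expR (- x)).

(* density of the gamma law with shape s and rate a, on x > 0 *)
Definition gamma_density (s a x : R) : R :=
  a `^ s / Gamma s * x `^ (s - 1) * expR (- a * x).

Definition gamma_process (lambda a : R) (Z : R -> T -> R) : Prop :=
  levy_process Z /\
  forall (t : R) (A : set R), 0 < t -> measurable A ->
    P (Z t @^-1` A) =
    (\int[lebesgue_measure]_(x in A `&` `]0%R, +oo[)
       (gamma_density (lambda * t) a x)%:E)%E.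

(* binomial coefficient with real upper argument: x (x-1) ... (x-n+1) / n! *)
Definition gbinom (x : R) (n : nat) : R :=
  (\prod_(l < n) (x - l%:R)) / n`!%:R.

(* The Levy process is t |-> B (lambda t), as in the subordination below. *)
Definition negative_binomial_process (lambda theta : R) (B : R -> T -> nat)
    : Prop :=
  levy_process (fun t w => (B (lambda * t) w)%:R) /\
  forall (t : R) (n : nat), 0 <= t ->
    P [set w | B (lambda * t) w = n] =
    ((1 - theta) `^ (lambda * t) * gbinom (n%:R + lambda * t - 1) n
      * theta ^+ n)%:E.

Definition gamma_subordinator (q : nat) (lambda : R) (Z : 'I_q -> R -> T -> R)
    (B : R -> T -> nat) : 'I_q -> R -> T -> R :=
  fun i t w => Z i (t + lambda^-1 * (B (lambda * t) w)%:R) w.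

Definition time_changed (q : nat) (M : 'I_q -> R -> T -> nat)
    (G : 'I_q -> R -> T -> R) : R -> T -> 'rV[R]_q :=
  fun t w => \row_(i < q) (M i (G i t w) w)%:R.

End Processes.

Definition box (R : realType) (q : nat) (A : 'I_q -> set R) : set 'rV[R]_q :=
  [set x | forall i, A i (x 0 i)].

(* rising factorial x (x+1) ... (x+n-1) *)
Definition pochhammer (R : realType) (x : R) (n : nat) : R :=
  \prod_(l < n) (x + l%:R).

(* Tuples (m_1, ..., m_k) of naturals with m_1 + 2 m_2 + ... + k m_k = n; the
   bound m_j <= n is automatic, which makes this a finite type. *)
Definition Omega (k n : nat) : {set {ffun 'I_k -> 'I_n.+1}} :=
  [set m : {ffun 'I_k -> 'I_n.+1} | (\sum_(j < k) j.+1 * m j == n)%N].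

Definition etan (k n : nat) (m : {ffun 'I_k -> 'I_n.+1}) : nat :=
  (\sum_(j < k) m j)%N.

(* Main.v *)
(* The negative binomial clock, the gamma processes and the counting processes are almost surely
   nondecreasing, so the time-changed process is almost surely a right-constant step path in
   N^q. On such a path, for n large, every dyadic cell of length 2^-n of ]0, 1] contains at most
   one jump, so the number of jumps equal to v <> 0 is the number of cells with increment v.
   The number of cells with a nonzero increment is nondecreasing in n and has bounded mean, so
   dominated convergence gives the mean number of jumps equal to v as the limit of
   2^n P(increment over a cell = v). Conditioning on the clock, the increment over a time h is
   v with probability sum_c P(B(lambda h) = c) prod_i g_i(lambda h + c, v_i), where g_i(s, n) is
   the probability that M_i(Gamma(s, a_i)) = n. Divided by h, the term c = 0 yields the first sum
   of the formula, since (x)_n / x tends to (n - 1)! = Gamma(n) as x tends to 0, and the terms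
   c >= 1 yield the second one. *)
Require Import Defs.
From HB Require Import structures.
From mathcomp Require Import all_boot all_order all_algebra.
From mathcomp Require Import all_classical all_reals all_analysis.
From mathcomp Require Import measurable_realfun.
From mathcomp Require Import ring lra.
Import Order.TTheory GRing.Theory Num.Theory.
Import numFieldNormedType.Exports.

Set Implicit Arguments.
Unset Strict Implicit.
Unset Printing Implicit Defensive.

Local Open Scope classical_set_scope.
Local Open Scope ring_scope.

(** * Gamma integrals *)

Section gamma_integral.
Context {R : realType}.
Notation mu := (@lebesgue_measure R).

(** Independence is given only as product rules between generated sigma-algebras, and
    [M i (G i t w) w] evaluates a process at a random time: its increment events have no evident
    measurability, and there is no product space on which to apply Fubini. Both points are settled
    at dyadic random times, which take finitely many values, followed by a limit. Measurability is
    thus obtained inside the almost sure event of regular paths, and increment events are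
    intersected with it throughout. A counting process is known through its generating function, so
    its point probabilities come from uniqueness of power series with bounded coefficients.
    Finiteness of the gamma integral is read off from the gamma law having mass one. By linearity of
    expectation the mean of a cell count involves only the law of one increment; its bound comes
    from the term c = 0 at v = 0, which is an exponential in h. *)

Definition gamma_int (s b : R) : \bar R :=
  (\int[mu]_(x in `]0%R, +oo[) (x `^ (s - 1) * expR (- b * x))%:E)%E.

Lemma measurable_powR_expR (s b : R) (D : set R) :
  measurable_fun D (fun x : R => x `^ s * expR (- b * x)).
Proof.
apply/measurable_funTS/measurable_funM => //.
by apply: measurableT_comp => //; exact: measurable_funM.
Qed.

Lemma gamma_int_ge0 s b : (0 <= gamma_int s b)%E.
Proof.
by apply: integral_ge0 => x _; rewrite lee_fin mulr_ge0 ?powR_ge0 ?expR_ge0.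
Qed.

Lemma mul_expRN_cvg0 (c : R) : 0 < c -> x * expR (- c * x) @[x --> +oo] --> 0.
Proof.
move=> c0; apply: (@squeeze_cvgr _ _ _ _ (fun=> 0) (fun x => 2 / c ^+ 2 / x)).
- near=> x; have x0 : 0 < x by near: x; exact: nbhs_pinfty_gt.
  rewrite mulr_ge0 ?expR_ge0 ?(ltW x0)//= mulNr expRN ler_pdivrMr ?expR_gt0//.
  (* The quadratic term of the exponential series beats the linear factor: 1 + (c x)^2 / 2 <= expR
     (c x). *)
  have := expR_ge1Dxn 1%N (mulr_ge0 (ltW c0) (ltW x0)).
  rewrite -[_ `!%:R]/(2 : R) => h.
  rewrite -(@ler_pM2l _ (c ^+ 2 * x / 2)); last by rewrite !mulr_gt0// exprn_gt0.
  have -> : c ^+ 2 * x / 2 * (2 / c ^+ 2 / x * expR (c * x)) = expR (c * x).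
    by field; rewrite !gt_eqF.
  apply: le_trans h; rewrite exprMn; lra.
- exact: cvg_cst.
- rewrite -(mulr0 (2 / c ^+ 2)); apply: cvgMr; apply/gtr0_cvgV0 => //; exact: nbhs_pinfty_gt.
Unshelve. all: end_near. Qed.

(** The function is the s-th power of x expR(- (b / s) x), so the linear case suffices. *)
Lemma powR_expRN_cvg0 (s b : R) : 0 < s -> 0 < b ->
  x `^ s * expR (- b * x) @[x --> +oo] --> 0.
Proof.
move=> s0 b0.
have c0 : 0 < b / s by rewrite divr_gt0.
suff h : (x * expR (- (b / s) * x)) `^ s @[x --> +oo] --> 0.
  apply: cvg_trans h; apply: near_eq_cvg; near=> x.
  have x0 : 0 < x by near: x; exact: nbhs_pinfty_gt.
  rewrite powRM ?expR_ge0 ?(ltW x0)// -expRM; congr (_ * expR _).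
  by field; rewrite gt_eqF.
apply: (cvg_comp _ _ _ (powR_cvg0 s0)).
move=> A [e /= e0 eA]; have := mul_expRN_cvg0 c0.
move/cvgrPdist_lt => /(_ _ e0) h; near=> x.
apply: eA => /=; first by near: x.
by rewrite mulr_gt0 ?expR_gt0//; near: x; exact: nbhs_pinfty_gt.
Unshelve. all: end_near. Qed.

(** Compact exhaustion of the open half-line. The upper end n + 2 keeps the interval nondegenerate
    at n = 0, as integration by parts requires. *)
Let I n : set R := `[(n.+1%:R)^-1, n.+2%:R].

Let bigcupI : \bigcup_n I n = `]0%R, +oo[%classic.
Proof.
apply/seteqP; split => x /=; rewrite in_itv/=.
  by move=> [n _]; rewrite /I/= !in_itv/= andbT => /andP[+ _]; apply: lt_le_trans; rewrite invr_gt0.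
rewrite andbT => x0; have x10 : 0 < x^-1 by rewrite invr_gt0.
pose n := maxn (Num.trunc x) (Num.trunc x^-1).
exists n => //; rewrite /I /= in_itv/=; apply/andP; split.
  rewrite -[leRHS]invrK lef_pV2 ?posrE// ltW//.
  rewrite (lt_le_trans (truncnS_gt _))// ler_nat ltnS leq_maxr//.
rewrite ltW// (lt_le_trans (truncnS_gt _))// ler_nat ltnS leqW// leq_maxl//.
Qed.

Let ndI : nondecreasing_seq I.
Proof.
move=> m n mn; apply/subsetPset => x; rewrite /I /= !in_itv/= => /andP[h1 h2].
rewrite (le_trans _ h1) ?(le_trans h2) ?ler_nat//.
by rewrite lef_pV2 ?posrE// ler_nat ltnS.
Qed.

Let int_I (s b : R) :
  (\int[mu]_(x in I n) (x `^ (s - 1) * expR (- b * x))%:E @[n --> \oo] --> gamma_int s b)%E.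
Proof.
rewrite /gamma_int -bigcupI; apply: ge0_nondecreasing_set_cvg_integral => //.
- by move=> n; exact: measurable_itv.
- by move=> n; apply/measurable_EFinP; exact: measurable_powR_expR.
- by move=> n x _; rewrite lee_fin mulr_ge0 ?powR_ge0 ?expR_ge0.
Qed.

Let cont_powR_expR (s b x : R) : 0 < x ->
   {for x, continuous (fun x => x `^ s * expR (- b * x))}.
Proof.
move=> x0; apply: cvgM; rewrite -/(continuous_at _ _).
  apply: differentiable_continuous; apply/derivable1_diffP/derivable_powR.
  by rewrite in_itv/= x0.
apply: continuous_comp; last exact: continuous_expR.
exact: mulrl_continuous.
Qed.


(** Each boundary term stands on the side where it is added, so that the limit can be taken termwise
    without subtracting extended reals. *)
Let int_by_parts (s b u v : R) : 0 < u < v -> 0 < b -> 0 < s ->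
  (b%:E * \int[mu]_(x in `[u, v]) (x `^ s * expR (- b * x))%:E + (v `^ s * expR (- b * v))%:E
  = s%:E * \int[mu]_(x in `[u, v]) (x `^ (s - 1) * expR (- b * x))%:E +
    (u `^ s * expR (- b * u))%:E)%E.
Proof.
move=> /andP[u0 uv] b0 s0.
have pos x : u <= x -> 0 < x by apply: lt_le_trans.
have cpow (r x : R) : 0 < x -> {for x, continuous (fun x : R => x `^ r)}.
  move=> x0; apply: differentiable_continuous; apply/derivable1_diffP/derivable_powR.
  by rewrite in_itv/= x0.
have cexp x : {for x, continuous (fun x : R => expR (- b * x))}.
  apply: continuous_comp; last exact: continuous_expR.
  exact: mulrl_continuous.
have dexp (x : R) : is_derive x 1 (fun x : R => - expR (- b * x)) (b * expR (- b * x)).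
  by apply: is_derive_eq; rewrite /GRing.scale/=; ring.
have mf r D : measurable_fun D (fun x : R => x `^ r * expR (- b * x)).
  exact: measurable_powR_expR.
have E1 : (\int[mu]_(x in `[u, v]) (x `^ s * (b * expR (- b * x)))%:E =
  b%:E * \int[mu]_(x in `[u, v]) (x `^ s * expR (- b * x))%:E)%E.
  rewrite -ge0_integralZl ?lee_fin ?(ltW b0)//.
  - by apply: eq_integral => x _; rewrite -EFinM; congr EFin; ring.
  - by apply/measurable_EFinP; exact: mf.
  - by move=> x _; rewrite lee_fin mulr_ge0 ?powR_ge0 ?expR_ge0.
rewrite -E1.
have := @integration_by_parts R (fun x : R => x `^ s) (fun x => - expR (- b * x))
  (fun x => s * x `^ (s - 1)) (fun x => b * expR (- b * x)) u v uv.
move=> H; rewrite {}H; last 6 first.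
- apply: continuous_in_subspaceT => x; rewrite inE/= in_itv/= => /andP[/pos x0 _].
  by apply: cvgM; [exact: cvg_cst|exact: cpow].
- split.
  + by move=> x; rewrite in_itv/= => /andP[ux _]; apply: derivable_powR; rewrite in_itv/= (pos _ (ltW ux)).
  + by apply: cvg_at_right_filter; exact: cpow.
  + by apply: cvg_at_left_filter; apply: cpow; exact: lt_trans uv.
- move=> x; rewrite in_itv/= => /andP[ux _]; rewrite powR_derive1// in_itv/= (pos _ (ltW ux))//.
- apply: continuous_in_subspaceT => x _.
  by apply: cvgM; [exact: cvg_cst|exact: cexp].
- split.
  + by move=> x _; exact: ex_derive.
  + by apply: cvg_at_right_filter; apply: cvgN; exact: cexp.
  + by apply: cvg_at_left_filter; apply: cvgN; exact: cexp.
- by move=> x _; rewrite derive1E; exact: derive_val.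
have -> : (\int[mu]_(x in `[u, v]) (s * x `^ (s - 1) * - expR (- b * x))%:E =
  - (s%:E * \int[mu]_(x in `[u, v]) (x `^ (s - 1) * expR (- b * x))%:E))%E.
  rewrite -ge0_integralZl ?lee_fin ?(ltW s0)//.
  - rewrite -integral_ge0N; last first.
      by move=> x _; rewrite mule_ge0// lee_fin ?(ltW s0)// mulr_ge0 ?powR_ge0 ?expR_ge0.
    by apply: eq_integral => x _; rewrite -EFinM -EFinN; congr EFin; ring.
  - by apply/measurable_EFinP; exact: mf.
  - by move=> x _; rewrite lee_fin mulr_ge0 ?powR_ge0 ?expR_ge0.
rewrite oppeK addeAC addeC; congr (_ + _)%E.
by rewrite -EFinD; congr EFin; ring.
Qed.

(** Limit of [int_by_parts] along the intervals [I n]: the boundary terms vanish at both ends. The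
    identity lives in the extended reals, so it can be stated before either integral is known to be
    finite. *)
Lemma gamma_int_rec (s b : R) : 0 < s -> 0 < b ->
  (b%:E * gamma_int (s + 1) b = s%:E * gamma_int s b)%E.
Proof.
move=> s0 b0.
set F := fun x => x `^ s * expR (- b * x).
have Fy : F n.+2%:R @[n --> \oo] --> 0.
  have h : (n.+2%:R : R) @[n --> \oo] --> +oo.
    apply/cvgryPge => A; near=> n.
    rewrite (@le_trans _ _ n%:R) ?ler_nat//; last by rewrite ltnW.
    by near: n; move/cvgryPge: (@cvgr_idn R); exact.
  exact: (cvg_comp _ _ h (powR_expRN_cvg0 s0 b0)).
have F0 : F n.+1%:R^-1 @[n --> \oo] --> 0.
  have h : (n.+1%:R^-1 : R) @[n --> \oo] --> 0^'+.
    move=> A [e /= e0 eA]; move/cvgrPdist_lt: (@cvg_harmonic R) => /(_ _ e0) h.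
    rewrite nbhs_simpl/=; near=> n; apply: eA => /=; last by rewrite invr_gt0 ltr0n.
    by near: n; exact: h.
  suff h' : F x @[x --> 0^'+] --> 0 by exact: (cvg_comp _ _ h h').
  rewrite -[X in _ --> X](mul0r (expR (- b * 0))); apply: cvgM; first exact: powR_cvg0.
  apply: cvg_at_right_filter; apply: continuous_comp; last exact: continuous_expR.
  exact: mulrl_continuous.
have L1 : (b%:E * \int[mu]_(x in I n) (x `^ (s + 1 - 1) * expR (- b * x))%:E + (F n.+2%:R)%:E @[n --> \oo]
     --> b%:E * gamma_int (s + 1) b + 0%:E)%E.
  apply: cvgeD; first by rewrite fin_num_adde_defl.
    by apply: cvgeZl => //; exact: int_I.
  by apply: cvg_EFin => //; near=> n.
have L2 : (s%:E * \int[mu]_(x in I n) (x `^ (s - 1) * expR (- b * x))%:E + (F n.+1%:R^-1)%:E @[n --> \oo]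
     --> s%:E * gamma_int s b + 0%:E)%E.
  apply: cvgeD; first by rewrite fin_num_adde_defl.
    by apply: cvgeZl => //; exact: int_I.
  by apply: cvg_EFin => //; near=> n.
rewrite -[LHS]adde0 -[RHS]adde0; move: L1.
under eq_cvg => n.
  rewrite addrK int_by_parts ?invr_gt0 ?ltr0n//=; last first.
    by rewrite (@le_lt_trans _ _ 1) ?ltr1n// invf_le1// ler1n.
  over.
by move=> L1; exact: (cvg_unique _ L1 L2).
Unshelve. all: end_near. Qed.

Lemma gamma_int_scale (s b : R) : 0 < s -> 0 < b ->
  gamma_int s b = ((b `^ s)^-1%:E * gamma_int s 1)%E.
Proof.
move=> s0 b0.
(* The substitution x -> b x is made at s + 1, where the integrand is continuous up to 0; at s it
   may blow up there. The recurrence then brings the result back to s. *)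
have step : gamma_int (s + 1) b = ((b `^ (s + 1))^-1%:E * gamma_int (s + 1) 1)%E.
  rewrite /gamma_int !addrK.
  rewrite !integral_itv_obnd_cbnd; last 2 first.
  - by apply/measurable_EFinP; exact: measurable_powR_expR.
  - by apply/measurable_EFinP; exact: measurable_powR_expR.
  pose G (x : R) := x `^ s * expR (- 1 * x).
  have cG x : 0 < x -> {for x, continuous G} by exact: cont_powR_expR.
  have DF : (fun x : R => b * x)^`()%classic = (fun=> b).
    apply/funext => x; rewrite derive1E.
    have : is_derive x 1 (fun x : R => b * x) b.
      by apply: is_derive_eq; rewrite /GRing.scale/= mulr1.
    by move=> /(@derive_val _ _ _ _ _ _ _).
  have := @increasing_ge0_integration_by_substitutiony R (fun x => b * x) G 0.
  rewrite DF mulr0 => H; rewrite {}H; last 8 first.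
  - by move=> x y _ _; rewrite ltr_pM2l.
  - by move=> x _; exact: cst_continuous.
  - exact: is_cvg_cst.
  - exact: is_cvg_cst.
  - split; first by move=> x _; exact: ex_derive.
    apply: cvg_at_right_filter.
    exact: mulrl_continuous.
  - by apply: gt0_cvgMry.
  - apply/continuous_within_itvcyP; split.
      by move=> x; rewrite in_itv/= andbT; exact: cG.
    rewrite {2}/G powR0 ?gt_eqF// mul0r -[X in _ --> X](mul0r (expR (- 1 * 0))); apply: cvgM; first exact: powR_cvg0.
    apply: cvg_at_right_filter; apply: continuous_comp; last exact: continuous_expR.
    exact: mulrl_continuous.
  - by move=> x _; rewrite mulr_ge0 ?powR_ge0 ?expR_ge0.
  rewrite -ge0_integralZl//=; last first.
  - by rewrite lee_fin invr_ge0 powR_ge0.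
  - by move=> x _; rewrite lee_fin !mulr_ge0 ?powR_ge0 ?expR_ge0 ?(ltW b0).
  - apply/measurable_EFinP/measurable_funM => //; apply: measurable_funM.
      apply: (@measurableT_comp _ _ _ _ _ _ (fun x : R => x `^ s)) => //.
    apply: measurableT_comp => //; apply: measurable_funM => //; exact: measurable_funM.
  apply: eq_integral => x; rewrite inE/= in_itv/= andbT => x0.
  rewrite -EFinM; congr EFin.
  have -> : ((G \o [eta *%R b]) * (fun=> b)) x = G (b * x) * b by [].
  rewrite /G powRM ?(ltW b0)// powRD ?(gt_eqF b0) ?implybT// powRr1 ?(ltW b0)// mulN1r mulNr.
  field; rewrite !gt_eqF ?powR_gt0//.
have := gamma_int_rec s0 b0; have := gamma_int_rec s0 (@ltr01 R).
rewrite mul1e step => -> h.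
have : (s^-1%:E * (b%:E * ((b `^ (s + 1))^-1%:E * (s%:E * gamma_int s 1))) =
  s^-1%:E * (s%:E * gamma_int s b))%E by rewrite h.
rewrite !muleA -!EFinM mulVf ?gt_eqF// mul1e => <-; congr (_%:E * _)%E.
have bs : 0 < b `^ s by rewrite powR_gt0.
have -> : b `^ (s + 1) = b `^ s * b.
  by rewrite powRD ?(gt_eqF b0) ?implybT// powRr1 ?(ltW b0).
by field; rewrite !gt_eqF.
Qed.

Lemma gamma_int_nat n : gamma_int n.+1%:R 1 = n`!%:R%:E.
Proof.
elim: n => [|n IHn]; last first.
  have := @gamma_int_rec n.+1%:R 1 (ltr0Sn _ _) ltr01.
  by rewrite mul1e IHn natr1 => ->; rewrite -EFinM factS natrM.
have := @integral_exponential_pdf R 1 ltr01; rewrite fact0 => <-.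
rewrite /gamma_int /exponential_pdf integral_itv_obnd_cbnd; last first.
  by apply/measurable_EFinP; exact: measurable_powR_expR.
rewrite integral_mkcond; apply: eq_integral => x _; rewrite !patchE.
by case: ifPn => // _; rewrite subrr powRr0.
Qed.

End gamma_integral.

(** * Step functions and dyadic increments *)

Section step_paths.
Context {R : realType} {V : normedModType R}.
Variable X : R -> V.

Let jmp t : V := X t - lim (X s @[s --> t^'-]).

Lemma lim_left_cst (c t : R) (v : V) : c < t ->
  (forall s, c < s < t -> X s = v) -> lim (X s @[s --> t^'-]) = v.
Proof.
move=> ct h; apply: cvg_lim => //; apply: cvg_near_cst; near=> s.
by apply: h; apply/andP; split; near: s; [exact: nbhs_left_gt|exact: nbhs_left_lt].
Unshelve. all: end_near. Qed.

(* [t] may lie outside [u, u'], in which case [X] is constant there. *)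
Definition single_step (u u' : R) := exists t, forall s s',
  u <= s <= u' -> u <= s' <= u' -> (s < t) = (s' < t) -> X s = X s'.

Hypothesis stepr : forall t, 0 <= t ->
  exists2 e, 0 < e & forall s, t <= s < t + e -> X s = X t.
Hypothesis stepl : forall t, 0 < t ->
  exists2 e, 0 < e & forall s s', 0 <= s -> 0 <= s' -> t - e < s < t -> t - e < s' < t -> X s = X s'.

(** Near each t the path is constant on either side of t, so a short interval starting close to t
    has its only step at t; compactness of [0, 1] gives a common length. *)
Lemma single_step_near : \forall n \near \oo, forall u u' : R,
  0 <= u <= 1 -> u <= u' <= u + 2^-1 ^+ n -> single_step u u'.
Proof.
have /compact_near_coveringP := @segment_compact R 0 1.
move=> /(_ nat \oo (fun n u => 0 <= u -> forall u', u <= u' <= u + 2^-1 ^+ n -> single_step u u')).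
have half0 : (2^-1 ^+ n : R) @[n --> \oo] --> 0.
  by apply: cvg_expr; rewrite gtr0_norm; lra.
(* One half of e bounds the distance from u to t and the other the length of the interval, so u'
   stays below t + e. *)
have nbhs_step t e : 0 < e ->
    (forall u u', 0 <= u -> t - e < u -> u' < t + e -> single_step u u') ->
    \forall u \near t & n \near \oo, 0 <= u -> forall u', u <= u' <= u + 2^-1 ^+ n -> single_step u u'.
  move=> e0 h; exists ((`](t - e / 2), (t + e / 2)[%classic : set R), [set n | 2^-1 ^+ n < e / 2]).
    split => /=; first by apply: near_in_itvoo; rewrite in_itv/=; lra.
    near=> n => /=; near: n.
    have e20 : 0 < e / 2 by lra.
    move/cvgrPdist_lt: half0 => /(_ _ e20); apply: filterS => n.
    by rewrite sub0r normrN gtr0_norm// exprn_gt0.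
  move=> [u n] /=; rewrite in_itv/= => -[ut ne] u0 u' uu'; apply: h => //; lra.
move=> /(_ _ _)[].
- move=> t; rewrite /= in_itv/= => /andP[t0 t1].
  have [e e0 er] := stepr t0.
  move: t0; rewrite le_eqVlt => /predU1P[t0|t0].
    apply: (nbhs_step _ e) => // u u' u0 _ u'e; exists t => s s' su s'u _.
    by rewrite [LHS]er ?[RHS]er//; lra.
  have [e' e'0 el] := stepl t0.
  apply: (nbhs_step _ (Num.min e e')); first by rewrite lt_min e0.
  move=> u u' u0; rewrite ltrBlDr -ltrBlDl lt_min => /andP[_ ue'].
  rewrite -ltrBlDl lt_min => /andP[u'e _].
  exists t => s s' su s'u; case: (ltP s t) => st; case: (ltP s' t) => s't // _.
    by apply: el; lra.
  by rewrite [LHS]er ?[RHS]er//; lra.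
- move=> n _ h; exists n => // m nm u u' /andP[u0 u1] uu'.
  by apply: h nm _ _ _ _ _ => //=; rewrite in_itv/= u0.
Unshelve. all: end_near. Qed.

Lemma jump_single_step u u' : u < u' -> single_step u u' ->
  exists t, (~~ (u < t <= u') -> X u' = X u) /\
    forall s, u < s <= u' -> jmp s = if s == t then X u' - X u else 0.
Proof.
move=> uu' [t h]; exists t; split.
  rewrite negb_and -leNgt -ltNge => /orP[tu|u't]; apply: h; rewrite ?lexx ?(ltW uu')//.
    by rewrite !ltNge tu (le_trans tu (ltW uu')).
  by rewrite u't (lt_trans uu').
move=> s /andP[us su'].
have [st|st|st] := ltgtP s t; rewrite /jmp.
- rewrite (@lim_left_cst u _ (X s)) ?subrr// => r /andP[ur rs].
  by apply: h; rewrite ?st ?(lt_trans rs)//; lra.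
- rewrite (@lim_left_cst (Num.max u t) _ (X s)) ?subrr//; first by rewrite gt_max us.
  move=> r; rewrite gt_max => /andP[/andP[ur tr] rs].
  by apply: h; rewrite ?(ltNge s) ?(ltNge r) ?(ltW st) ?(ltW tr)//; lra.
- subst t; rewrite (@lim_left_cst u _ (X u)) //.
    by congr (_ - _); apply: h; rewrite ?ltxx ?ltNge ?su'//; lra.
  by move=> r /andP[ur rs]; apply: h; rewrite ?us ?rs//; lra.
Qed.

(* A dyadic cell with a single step contains one jump, equal to the increment over the cell, or none. *)
Lemma jump_count (n : nat) (A : set V) : ~ A 0 ->
  (forall k, (k < 2 ^ n)%N -> single_step (k%:R / 2 ^+ n) (k.+1%:R / 2 ^+ n)) ->
  counting [set t | [/\ 0 < t <= 1, jmp t != 0 & A (jmp t)]] =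
  (\sum_(k < 2 ^ n) \1_A (X (k.+1%:R / 2 ^+ n) - X (k%:R / 2 ^+ n)))%:E :> \bar R.
Proof.
move=> A0 hs; pose p (k : nat) : R := k%:R / 2 ^+ n.
have n0 : 0 < 2 ^+ n :> R by rewrite exprn_gt0.
have p_lt k : p k < p k.+1 by rewrite /p ltr_pM2r ?invr_gt0// ltr_nat.
have p_le j k : (j <= k)%N -> p j <= p k by move=> jk; rewrite /p ler_pM2r ?invr_gt0// ler_nat.
(* Cells open on the left and closed on the right partition ]0, 1]. *)
pose F k := [set t | [/\ (k < 2 ^ n)%N, p k < t <= p k.+1, jmp t != 0 & A (jmp t)]].
have F_eq k : (k < 2 ^ n)%N -> exists t, F k =
    if `[< A (X (p k.+1) - X (p k)) >] then [set t] else set0.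
  move=> kn; have [t [ht hj]] := jump_single_step (p_lt k) (hs k kn).
  exists t; case: asboolP => hA; apply/seteqP; split => s //=.
  - by move=> [_ sk + _]; rewrite hj//; case: (eqVneq s t) => // _ /eqP.
  (* An increment in A is nonzero because A omits 0, which forces the step t into the cell. *)
  - move=> ->; have tk : p k < t <= p k.+1.
      by apply: contraT => /ht e; move: hA; rewrite e subrr => /A0.
    split => //; rewrite hj// eqxx//; apply/eqP => e; apply: A0; rewrite -e//.
  - by move=> [_ sk + +]; rewrite hj//; case: (eqVneq s t) => [_ _ /hA|_ /eqP].
have finF k : finite_set (F k).
  have [kn|kn] := ltnP k (2 ^ n); last first.
    by rewrite (_ : F k = set0)//; apply/seteqP; split => // t [+]; rewrite ltnNge kn.
  by have [t ->] := F_eq k kn; case: ifP.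
have trivF : trivIset setT F.
  apply/trivIsetP => i j _ _ ij; apply/seteqP; split => // t [[_ + _ _] [_ + _ _]].
  wlog ij' : i j ij / (i < j)%N => [th|].
    have := ij; rewrite neq_ltn => /orP[] ij'; first exact: th.
    by move=> h1 h2; apply: (th j i); rewrite // eq_sym.
  by move=> /andP[_ ti] /andP[+ _]; rewrite ltNge (le_trans ti)// p_le.
have -> : [set t | [/\ 0 < t <= 1, jmp t != 0 & A (jmp t)]] = \big[setU/set0]_(k < 2 ^ n) F k.
  rewrite -bigcup_mkord; apply/seteqP; split => t /=.
    move=> [/andP[t0 t1] jt At].
    have tp : t <= p (2 ^ n)%N by rewrite /p natrX divff ?gt_eqF.
    (* The least grid index whose point is at or above t is positive, and the cell ending there
       contains t. *)
    have [[|k] tk km] := ex_minnP (ex_intro (fun k => t <= p k) _ tp).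
      by move: tk; rewrite /p mul0r leNgt t0.
    exists k => /=; first exact: km.
    by split => //; [exact: km|rewrite tk andbT ltNge; apply/negP => /km; rewrite ltnn].
  move=> [k /= kn [_ /andP[kt tk] jt At]]; split => //.
  apply/andP; split.
    by rewrite (le_lt_trans _ kt)// divr_ge0// ltW.
  by rewrite (le_trans tk)// ler_pdivrMr// mul1r -natrX ler_nat.
rewrite /counting asboolT; last by rewrite -bigcup_mkord; exact: bigcup_finite.
rewrite -trivIset_sum_card// natr_sum; congr EFin; apply: eq_bigr => k _.
have [t ->] := F_eq k (ltn_ord k); rewrite indicE -/(p k) -/(p k.+1).
case: asboolP => hA; first by rewrite mem_set// fset_set1 finmap.cardfs1.
by rewrite memNset// fset_set0 finmap.cardfs0.
Qed.

End step_paths.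

(** * Independence and change of variables *)

Section integral_comp.
Context {d d' : measure_display} {T : measurableType d} {U : measurableType d'} {R : realType}.
Variables (mu : {measure set T -> \bar R}) (Y : T -> U) (W : T -> R).
Hypotheses (mY : measurable_fun setT Y) (mW : measurable_fun setT W) (W0 : forall x, 0 <= W x).

Import HBNNSimple.

Lemma integral_comp_nnsfun (h : {nnsfun U >-> R}) :
  (\int[mu]_x (h (Y x) * W x)%:E =
   \sum_(r \in range h) (r%:E * \int[mu]_x (\1_(h @^-1` [set r]) (Y x) * W x)%:E))%E.
Proof.
have m1 r : measurable_fun setT (fun x => \1_(h @^-1` [set r]) (Y x) * W x).
  apply: measurable_funM => //.
  by apply: (measurableT_comp _ mY); exact: measurable_indic.
transitivity (\int[mu]_x (\sum_(r \in range h) (r%:E * (\1_(h @^-1` [set r]) (Y x) * W x)%:E)))%E.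
  apply: eq_integral => x _.
  rewrite {1}(fimfunE h) !fsbig_finite//= mulr_suml -sumEFin.
  by apply: eq_bigr => r _; rewrite -EFinM mulrA.
rewrite ge0_integral_fsum//; last 2 first.
- move=> r; apply: measurable_funeM; exact/measurable_EFinP.
- move=> r x _; have [r0|r0] := leP 0 r.
    by rewrite mule_ge0// lee_fin mulr_ge0// indicE.
  rewrite preimage_nnfun0// indic0 mul0r mule0//.
apply: eq_fsbigr => r; rewrite inE => -[u _ <-].
rewrite ge0_integralZl//.
- exact/measurable_EFinP.
- by move=> x _; rewrite lee_fin mulr_ge0// indicE.
- by rewrite lee_fin.
Qed.

Lemma cvg_integral_comp (f : U -> R) (mf : measurable_fun setT (EFin \o f)) : (forall u, 0 <= f u) ->
  (\int[mu]_x (nnsfun_approx measurableT mf n (Y x) * W x)%:E @[n --> \oo] -->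
   \int[mu]_x (f (Y x) * W x)%:E)%E.
Proof.
move=> f0; pose g n x := (nnsfun_approx measurableT mf n (Y x) * W x)%:E.
have -> : (\int[mu]_x (f (Y x) * W x)%:E = \int[mu]_x (limn (g^~ x)))%E.
  apply: eq_integral => x _; apply/esym/cvg_lim => //; rewrite /g.
  under eq_fun do rewrite EFinM; rewrite EFinM.
  apply: cvgeZr => //.
  by apply: cvg_nnsfun_approx => // u _; rewrite lee_fin.
apply: cvg_monotone_convergence => //.
- move=> n; apply/measurable_EFinP/measurable_funM => //.
  exact: measurableT_comp.
- by move=> n x _; rewrite lee_fin mulr_ge0.
- move=> x _ m n mn; rewrite lee_fin ler_wpM2r//.
  exact/lefP/nd_nnsfun_approx.
Qed.

End integral_comp.

Section eq_integral_comp.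
Import HBNNSimple.

(** Simple functions and monotone convergence extend the equality from indicators. The weights stand
    for the remaining factors of an independent product, for a density, or for 1 when two laws are
    compared. *)
Lemma eq_integral_comp (d1 d2 d' : measure_display) (T1 : measurableType d1)
    (T2 : measurableType d2) (U : measurableType d') (R : realType)
    (mu1 : {measure set T1 -> \bar R}) (mu2 : {measure set T2 -> \bar R})
    (Y1 : T1 -> U) (Y2 : T2 -> U) (W1 : T1 -> R) (W2 : T2 -> R) (f : U -> R) :
  measurable_fun setT Y1 -> measurable_fun setT Y2 ->
  measurable_fun setT W1 -> measurable_fun setT W2 ->
  (forall x, 0 <= W1 x) -> (forall x, 0 <= W2 x) ->
  (forall A, measurable A ->
    (\int[mu1]_x (\1_A (Y1 x) * W1 x)%:E = \int[mu2]_x (\1_A (Y2 x) * W2 x)%:E)%E) ->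
  measurable_fun setT f -> (forall u, 0 <= f u) ->
  (\int[mu1]_x (f (Y1 x) * W1 x)%:E = \int[mu2]_x (f (Y2 x) * W2 x)%:E)%E.
Proof.
move=> mY1 mY2 mW1 mW2 W10 W20 h mf f0.
have mf' : measurable_fun setT (EFin \o f) by exact/measurable_EFinP.
have := @cvg_integral_comp _ _ _ _ _ mu2 Y2 W2 mY2 mW2 W20 f mf' f0.
have := @cvg_integral_comp _ _ _ _ _ mu1 Y1 W1 mY1 mW1 W10 f mf' f0.
under eq_cvg => n do rewrite integral_comp_nnsfun//.
under [X in _ -> X -> _]eq_cvg => n do rewrite integral_comp_nnsfun//.
move=> c1 c2; apply: (cvg_unique _ c1) => //; apply: cvg_trans c2.
apply: near_eq_cvg; near=> n; apply: eq_fsbigr => r _; rewrite -h//.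
Unshelve. all: end_near. Qed.

End eq_integral_comp.

(** * Sigma-algebras generated by processes *)

Section process_sigma.
Context (R : realType) (d : measure_display) (T : measurableType d).

Lemma process_sigma_sub (I : Type) (X : I -> R -> T -> R) :
  (forall i t, 0 <= t -> measurable_fun setT (X i t)) ->
  process_sigma X `<=` measurable.
Proof.
move=> mX; apply: smallest_sub; first exact: sigma_algebra_measurable.
by move=> _ [i [t [A [t0 mA ->]]]]; rewrite -[X in measurable X]setTI; exact: mX.
Qed.

Lemma sigma_algebra_process_sigma (I : Type) (X : I -> R -> T -> R) :
  sigma_algebra setT (process_sigma X).
Proof. exact: smallest_sigma_algebra. Qed.

Lemma process_sigma_increment (I : Type) (X : I -> R -> T -> R) i s t (A : set R) :
  0 <= s -> 0 <= t -> measurable A ->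
  process_sigma X [set w | A (X i t w - X i s w)].
Proof.
move=> s0 t0 mA.
pose G := [set E | exists i t (A : set R), [/\ 0 <= t, measurable A & E = X i t @^-1` A]].
have mX u : 0 <= u -> measurable_fun (setT : set (g_sigma_algebraType G)) (X i u).
  move=> u0 _ B mB; rewrite setTI; apply: sub_sigma_algebra.
  by exists i, u, B.
have := measurable_funB (mX t t0) (mX s s0).
by move=> /(_ measurableT _ mA); rewrite setTI.
Qed.

Lemma process_sigma_preimage (I : Type) (X : I -> R -> T -> R) i t (A : set R) :
  0 <= t -> measurable A -> process_sigma X (X i t @^-1` A).
Proof. by move=> t0 mA; apply: sub_sigma_algebra; exists i, t, A. Qed.

Lemma sigma_algebra_forall (S : set (set T)) (J : finType) (E : J -> set T) :
  sigma_algebra setT S -> (forall j, S (E j)) -> S [set w | forall j, E j w].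
Proof.
move=> sS.
rewrite -(@sigma_algebra_id _ setT S sS) => SE.
have mE j : (measurable : set (set (g_sigma_algebraType S))) (E j) by exact: SE.
rewrite (_ : [set _ | _] = \bigcap_j (E j)); last first.
  by apply/seteqP; split => w /=; [move=> + i _; exact|move=> + i; exact].
by apply: (@fin_bigcap_measurable _ (g_sigma_algebraType S)) => //; exact: finite_finset.
Qed.

Lemma process_sigma_unit (I : Type) (X : I -> R -> T -> R) i :
  process_sigma (fun _ : unit => X i) `<=` process_sigma X.
Proof.
apply: smallest_sub; first exact: smallest_sigma_algebra.
by move=> _ [_ [t [A [t0 mA ->]]]]; exact: process_sigma_preimage.
Qed.

End process_sigma.

(** * Expectations of products of independent factors *)

Section product_formula.
Context (R : realType) (d : measure_display) (T : measurableType d) (P : probability T R).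
Implicit Types (E : set T).

Let integral_01_fin (f : T -> R) : measurable_fun setT f -> (forall x, 0 <= f x <= 1) ->
  (\int[P]_x (f x)%:E)%E \is a fin_num.
Proof.
move=> mf f01; rewrite ge0_fin_numE; last by apply: integral_ge0 => x _; rewrite lee_fin; case/andP: (f01 x).
apply: (@le_lt_trans _ _ (\int[P]_x 1)%E); last first.
  by rewrite integral_cst//= probability_setT mule1 ltry.
apply: ge0_le_integral => //.
- by move=> x _; rewrite lee_fin; case/andP: (f01 x).
- exact/measurable_EFinP.
- by move=> x _; rewrite lee_fin; case/andP: (f01 x).
Qed.

(* The factors are switched one at a time from indicators to general functions. *)
Lemma integral_prod_indep (q : nat) (Y : 'I_q -> T -> R) (f : 'I_q -> R -> R) E :
  measurable E -> (forall i, measurable_fun setT (Y i)) ->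
  (forall A : 'I_q -> set R, (forall i, measurable (A i)) ->
    P (E `&` [set w | forall i, A i (Y i w)]) =
    (fine (P E) * \prod_(i < q) fine (P (Y i @^-1` A i)))%:E) ->
  (forall i, measurable_fun setT (f i)) -> (forall i x, 0 <= f i x <= 1) ->
  (\int[P]_x (\1_E x * \prod_(i < q) f i (Y i x))%:E)%E =
  (fine (P E) * \prod_(i < q) fine (\int[P]_x (f i (Y i x))%:E)%E)%:E.
Proof.
move=> mE mY hA.
have mfY (g : R -> R) i : measurable_fun setT g -> measurable_fun setT (fun x => g (Y i x)).
  by move=> mg; exact: (measurableT_comp mg (mY i)).
(* Induction on j: the factors of index at least j are still indicators, those below j are
   arbitrary. *)
suff H j : (j <= q)%N -> forall g : 'I_q -> R -> R,
    (forall i, measurable_fun setT (g i)) -> (forall i x, 0 <= g i x <= 1) ->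
    (forall i : 'I_q, (j <= i)%N -> exists2 A, measurable A & g i = \1_A) ->
    (\int[P]_x (\1_E x * \prod_(i < q) g i (Y i x))%:E)%E =
    (fine (P E) * \prod_(i < q) fine (\int[P]_x (g i (Y i x))%:E)%E)%:E.
  move=> mf f01; apply: (H q) => // i; rewrite leqNgt ltn_ord//.
elim: j => [_|j IHj jq] g mg g01 gA.
  have {}gA i : {A | measurable A & g i = \1_A}.
    by apply: cid2; exact: gA.
  pose A i := s2val (gA i).
  have mA i : measurable (A i) := s2valP (gA i).
  have gE i : g i = \1_(A i) := s2valP' (gA i).
  have mYA i : measurable (Y i @^-1` A i) by rewrite -[X in measurable X]setTI; exact: mY.
  transitivity (\int[P]_x (\1_(E `&` [set w | forall i, A i (Y i w)]) x)%:E)%E.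
    apply: eq_integral => x _; congr EFin; rewrite indicI/=; congr (_ * _).
    rewrite [RHS]indicE; have [h|h] := pselect (forall i, A i (Y i x)).
      by rewrite mem_set// big1// => i _; rewrite gE indicE mem_set//; exact: h.
    rewrite memNset//; move/existsNP: h => [i Ai].
    by rewrite (bigD1 i)//= gE indicE memNset// mul0r.
  have mall : measurable [set w | forall i, A i (Y i w)].
    rewrite (_ : [set _ | _] = \bigcap_i (Y i @^-1` A i)); last first.
      by apply/seteqP; split => w /=; [move=> + i _; exact|move=> + i; exact].
    by apply: fin_bigcap_measurable => //; exact: finite_finset.
  rewrite integral_indic ?setIT//; last exact: measurableI.
  apply: etrans (hA _ mA) _; congr (_ * _)%:E; apply: eq_bigr => i _; rewrite gE.
  by rewrite (integral_indic P measurableT (mYA i)) setIT.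
pose k := Ordinal jq.
(* [upd h] puts h in place of factor k, [W] gathers the other factors and [c] is their expected
   contribution; the induction hypothesis says that the weights [W] and [c] agree on indicators of
   [Y k]. *)
pose upd h i := if i == k then h else g i.
pose W x := \1_E x * \prod_(i < q | i != k) g i (Y i x).
pose c := fine (P E) * \prod_(i < q | i != k) fine (\int[P]_x (g i (Y i x))%:E)%E.
have prodE x h : \1_E x * \prod_(i < q) upd h i (Y i x) = h (Y k x) * W x.
  rewrite (bigD1 k)//= /upd eqxx mulrCA; congr (_ * (_ * _)).
  by apply: eq_bigr => i /negbTE ->.
have c0 : 0 <= c.
  apply: mulr_ge0; first exact: fine_ge0.
  apply: prodr_ge0 => i _; apply: fine_ge0; apply: integral_ge0 => x _.
  by rewrite lee_fin; case/andP: (g01 i (Y i x)).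
have cE h : fine (P E) * \prod_(i < q) fine (\int[P]_x (upd h i (Y i x))%:E)%E =
            c * fine (\int[P]_x (h (Y k x))%:E)%E.
  rewrite (bigD1 k)//= /upd eqxx mulrCA mulrC; congr (_ * _ * _).
  by apply: eq_bigr => i /negbTE ->.
have updk : upd (g k) = g.
  by apply/funext => i; rewrite /upd; case: eqP => // ->.
have mW : measurable_fun setT W.
  rewrite (_ : W = fun x => \1_E x * \prod_(i < q) if i != k then g i (Y i x) else 1); last first.
    by apply/funext => x; rewrite /W big_mkcond.
  apply: measurable_funM => //; apply: measurable_prod => i _.
  by case: (i != k); [exact: mfY|exact: measurable_cst].
have W0 x : 0 <= W x.
  by apply: mulr_ge0 => //; apply: prodr_ge0 => i _; case/andP: (g01 i (Y i x)).
have := @eq_integral_comp _ _ _ T T R R P P (Y k) (Y k) W (cst c) (g k) (mY k) (mY k) mW _ W0.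
move=> /(_ _ _ _ _ _)/=H.
transitivity (\int[P]_x (g k (Y k x) * W x)%:E)%E.
  by apply: eq_integral => x _; rewrite -prodE updk.
rewrite {}H//; last 2 first.
- move=> B mB.
  have := IHj (ltnW jq) (upd \1_B).
  rewrite cE.
  under eq_integral do rewrite prodE.
  move=> ->.
  + under [RHS]eq_integral do rewrite mulrC EFinM.
    rewrite ge0_integralZl// ?lee_fin//; last first.
      by apply/measurable_EFinP/mfY.
    rewrite EFinM fineK//; apply: integral_01_fin => //; first exact: mfY.
    by move=> x; rewrite indicE; case: (_ \in _); rewrite ?ler01 ?lexx.
  + by move=> i; rewrite /upd; case: ifP => // _; exact: measurable_indic.
  + by move=> i x; rewrite /upd; case: ifP => // _; rewrite indicE; case: (_ \in _); rewrite ?ler01 ?lexx.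
  + move=> i ji; rewrite /upd; case: (eqVneq i k) => [_|ik]; first by exists B.
    by apply: gA; rewrite ltn_neqAle ji andbT eq_sym; apply: contra ik => /eqP ij; apply/eqP/val_inj.
- by move=> u; case/andP: (g01 k u).
under eq_integral do rewrite mulrC EFinM.
rewrite ge0_integralZl// ?lee_fin//; last 2 first.
- by apply/measurable_EFinP/mfY.
- by move=> x _; rewrite lee_fin; case/andP: (g01 k (Y k x)).
have := cE (g k); rewrite updk => ->.
by rewrite [RHS]EFinM fineK//; apply: integral_01_fin => //; exact: mfY.
Qed.

End product_formula.

(** * Bounded convergence, almost sure events and finite mixtures *)

Section bounded_convergence.
Context (R : realType) (d : measure_display) (T : measurableType d) (P : probability T R).

Lemma bounded_convergence (f_ : nat -> T -> R) (f : T -> R) :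
  (forall n, measurable_fun setT (f_ n)) -> (forall n x, 0 <= f_ n x <= 1) ->
  (forall x, f_ ^~ x @ \oo --> f x) ->
  (\int[P]_x (f_ n x)%:E @[n --> \oo] --> \int[P]_x (f x)%:E)%E.
Proof.
move=> mf_ f01 cf.
have mf : measurable_fun setT f.
  by apply: (measurable_fun_cvg mf_) => x _; exact: cf.
have [] := @dominated_convergence _ T R P setT measurableT (fun n x => (f_ n x)%:E)
  (fun x => (f x)%:E) (cst 1%E).
- by move=> n; exact/measurable_EFinP.
- exact/measurable_EFinP.
- by apply: aeW => x _; apply/fine_cvgP; split; [exact: nearW|exact: cf].
- exact: finite_measure_integrable_cst.
- by apply: aeW => x n _; rewrite lee_fin ger0_norm; case/andP: (f01 n x).
- by [].
Qed.

Lemma integral_indicT (A : set T) : measurable A -> (\int[P]_x (\1_A x)%:E)%E = P A.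
Proof. by move=> mA; rewrite integral_indic// setIT. Qed.

Lemma eq_indic (A B : set T) w : (A w <-> B w) -> \1_A w = \1_B w :> R.
Proof.
move=> [AB BA]; rewrite !indicE; have [Aw|Aw] := pselect (A w).
  by rewrite !mem_set//; exact: AB.
by rewrite !memNset// => /BA.
Qed.

Lemma fine_probability_le1 (A : set T) : measurable A -> 0 <= fine (P A) <= 1.
Proof.
move=> mA; rewrite fine_ge0//= -lee_fin fineK ?fin_num_measure//.
exact: probability_le1.
Qed.

Lemma measurable_fun_finite (J : finType) (K : T -> J) (g : J -> R) :
  (forall k, measurable (K @^-1` [set k])) -> measurable_fun setT (fun w => g (K w)).
Proof.
move=> mK; rewrite (_ : (fun _ => _) = fun w => \sum_k g k * \1_(K @^-1` [set k]) w).
  by apply: measurable_sum => k; apply: measurable_funM => //; exact: measurable_indic.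
apply/funext => w; rewrite (bigD1 (K w))//= big1 => [|k kK].
  by rewrite addr0 indicE mem_set// mulr1.
by rewrite indicE memNset ?mulr0// => /= Kk; move: kK; rewrite Kk eqxx.
Qed.

Lemma integral_full (O : set T) (g : T -> R) : measurable O -> P O = 1%E ->
  measurable_fun setT g ->
  (\int[P]_x (\1_O x * g x)%:E = \int[P]_x (g x)%:E)%E.
Proof.
move=> mO PO mg; apply: ae_eq_integral => //.
- by apply/measurable_EFinP/measurable_funM => //; exact: measurable_indic.
- exact/measurable_EFinP.
exists (~` O); split; first exact: measurableC.
  by apply: etrans (probability_setC P mO) _; rewrite PO subee.
by move=> x /= h Ox; apply: h => _; rewrite indicE mem_set// mul1r.
Qed.

Lemma probability_full (O E : set T) : measurable O -> P O = 1%E -> measurable E ->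
  P (O `&` E) = P E.
Proof.
move=> mO PO mE.
rewrite -!integral_indicT ?indicI//; last exact: measurableI.
by apply: integral_full => //; exact: measurable_indic.
Qed.

Lemma measurable_finite_mixture (J : finType) (K : T -> J) (F : J -> set T) :
  (forall k, measurable (K @^-1` [set k])) -> (forall k, measurable (F k)) ->
  measurable [set w | F (K w) w].
Proof.
move=> mK mF.
rewrite (_ : [set _ | _] = \bigcup_(k in setT) (K @^-1` [set k] `&` F k)).
  by apply: fin_bigcup_measurable => // k _; exact: measurableI.
by apply/seteqP; split => [w Fw|w [k _ [/= <-]]]; first by exists (K w).
Qed.

(** The event is split according to the value of [K]; on each piece independence factors the
    probability, and the sum is the mean of [P (F k)] at the random index. *)
Lemma probability_finite_mixture (J : finType) (K : T -> J) (F : J -> set T) :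
  (forall k, measurable (K @^-1` [set k])) -> (forall k, measurable (F k)) ->
  (forall k, P (K @^-1` [set k] `&` F k) = P (K @^-1` [set k]) * P (F k))%E ->
  P [set w | F (K w) w] = (\int[P]_w (fine (P (F (K w))))%:E)%E.
Proof.
move=> mK mF hKF.
have mKF k : measurable (K @^-1` [set k] `&` F k) by exact: measurableI.
have mU := measurable_finite_mixture mK mF.
transitivity (\int[P]_w (\sum_(k : J) (\1_(K @^-1` [set k] `&` F k) w)%:E))%E.
  rewrite -integral_indicT//; apply: eq_integral => w _.
  rewrite (bigD1 (K w))//= big1 => [|k kK]; last first.
    by rewrite indicE memNset// => -[/= Kk _]; move: kK; rewrite Kk eqxx.
  rewrite adde0 indicI/= [X in (X * _)%R]indicE mem_set// mul1r.
  by rewrite !indicE; congr (_%:R%:E); apply/idP/idP; rewrite !inE.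
rewrite ge0_integral_sum//; last first.
- by move=> k; apply/measurable_EFinP; exact: measurable_indic.
transitivity (\int[P]_w (\sum_(k : J) (fine (P (F k)))%:E * (\1_(K @^-1` [set k]) w)%:E))%E; last first.
  apply: eq_integral => w _.
  rewrite (bigD1 (K w))//= big1 => [|k kK]; last first.
    rewrite indicE memNset ?mule0// => /= Kk; move: kK; rewrite Kk eqxx//.
  by rewrite adde0 indicE mem_set// mule1.
rewrite ge0_integral_sum//; last 2 first.
- move=> k; apply: measurable_funeM; apply/measurable_EFinP; exact: measurable_indic.
- by move=> k w _; rewrite mule_ge0// lee_fin// fine_ge0.
apply: eq_bigr => k _.
rewrite integral_indicT// ge0_integralZl//; last 2 first.
- by apply/measurable_EFinP; exact: measurable_indic.
- by rewrite lee_fin fine_ge0.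
rewrite integral_indicT// fineK ?fin_num_measure//.
by apply: etrans (hKF k) _; rewrite muleC.
Qed.

End bounded_convergence.

(** * Dyadic approximation of times from the right *)

Section dyadic_grid.
Context {R : realType}.
Implicit Types (n : nat) (x y : R).

(** The cap at [n * 2 ^ n] makes the index finitely valued. The successor in [grid_pt] puts
    [grid n x] strictly to the right of x once n >= x, so that right constancy of paths applies to
    the approximation. *)
Definition grid_ix n x : 'I_(n * 2 ^ n).+1 :=
  inord (minn (Num.trunc (x * 2 ^+ n)) (n * 2 ^ n)).

Definition grid_pt n (k : nat) : R := k.+1%:R / 2 ^+ n.

Definition grid n x : R := grid_pt n (grid_ix n x).

Lemma grid_ixE n x : grid_ix n x = minn (Num.trunc (x * 2 ^+ n)) (n * 2 ^ n) :> nat.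
Proof. by rewrite inordK// ltnS geq_minr. Qed.

Lemma grid_ix_le n x y : x <= y -> (grid_ix n x <= grid_ix n y)%N.
Proof.
move=> xy; rewrite !grid_ixE; rewrite leq_min geq_minr andbT geq_min le_truncn//.
by rewrite ler_pM2r// exprn_gt0.
Qed.

Lemma grid_pt_gt0 n k : 0 < grid_pt n k.
Proof. by rewrite /grid_pt divr_gt0// exprn_gt0. Qed.

Lemma grid_pt_le n j k : (j <= k)%N -> grid_pt n j <= grid_pt n k.
Proof. by move=> jk; rewrite /grid_pt ler_pM2r ?invr_gt0 ?exprn_gt0// ler_nat. Qed.

Lemma grid_bounds n x : 0 <= x <= n%:R -> x < grid n x <= x + 2^-1 ^+ n.
Proof.
move=> /andP[x0 xn]; have p0 : 0 < 2 ^+ n :> R by rewrite exprn_gt0.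
have xp0 : 0 <= x * 2 ^+ n by rewrite mulr_ge0// ltW.
have /andP[h1 h2] := truncn_itv xp0.
have E : grid_ix n x = Num.trunc (x * 2 ^+ n) :> nat.
  rewrite grid_ixE; apply/minn_idPl; rewrite -(ler_nat R) (le_trans h1)//.
  by rewrite natrM natrX ler_pM2r.
rewrite /grid /grid_pt E ltr_pdivlMr// h2/= ler_pdivrMr// mulrDl exprVn mulVf ?gt_eqF//.
by rewrite -natr1 lerD2r.
Qed.

(** The index is monotone in x, so its upper level sets are intervals. *)
Lemma grid_ix_measurable n k : measurable [set x | grid_ix n x = k].
Proof.
have mle (j : nat) : measurable [set x | (j <= grid_ix n x)%N].
  apply: is_interval_measurable => x y /= jx jy z /andP[xz zy].
  exact: leq_trans (grid_ix_le n xz).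
rewrite (_ : [set _ | _] = [set x | (k <= grid_ix n x)%N] `\` [set x | (k.+1 <= grid_ix n x)%N]).
  exact: measurableD.
apply/seteqP; split => x /=; first by move=> ->; rewrite ltnn.
by move=> [h1 /negP]; rewrite -leqNgt => h2; apply/val_inj/eqP; rewrite /= eqn_leq h1 h2.
Qed.

Lemma grid_cvg_right x : 0 <= x -> grid n x @[n --> \oo] --> x^'+.
Proof.
move=> x0.
have half0 : (2^-1 ^+ n : R) @[n --> \oo] --> 0.
  by apply: cvg_expr; rewrite gtr0_norm; lra.
move=> A [e /= e0 eA]; move/cvgrPdist_lt: half0 => /(_ _ e0) h.
rewrite nbhs_simpl/=; near=> n.
have /andP[h1 h2] : x < grid n x <= x + 2^-1 ^+ n.
  apply: grid_bounds; rewrite x0/=; near: n.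
  exact: nbhs_infty_ger.
apply: eA => //=; rewrite distrC gtr0_norm ?subr_gt0// ltrBlDl (le_lt_trans h2)//.
rewrite ltrD2l.
have : `|0 - 2^-1 ^+ n| < e by near: n; exact: h.
by rewrite sub0r normrN gtr0_norm// exprn_gt0.
Unshelve. all: end_near. Qed.

End dyadic_grid.

(** * Evaluating a process at independent random times *)

(* [U] and [V] are approximated from above by finitely valued dyadic times, on which
   independence reduces the claim to deterministic times; right constancy of the paths
   and continuity of [p] then give the limit. *)
Section time_mixing.
Context (R : realType) (d : measure_display) (T : measurableType d) (P : probability T R).
Context (q : nat) (N : 'I_q -> R -> T -> R) (U V : 'I_q -> T -> R) (S : set (set T)) (O : set T).
Hypothesis mN : forall i t, 0 <= t -> measurable_fun setT (N i t).
Hypotheses (sS : sigma_algebra setT S) (Sm : S `<=` measurable).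
Hypothesis SU : forall i A, measurable A -> S (U i @^-1` A).
Hypothesis SV : forall i A, measurable A -> S (V i @^-1` A).
Hypothesis indep : sigma_independent P (process_sigma N) S.
Hypotheses (mO : measurable O) (PO : P O = 1%E).
Hypothesis UV : forall w, O w -> forall i, 0 <= U i w <= V i w.
Hypothesis Nr : forall w, O w -> forall i t, 0 <= t -> \forall s \near t^'+, N i s w = N i t w.
Variables (p : 'I_q -> R -> R) (y : 'I_q -> R).
Hypothesis cp : forall i, continuous (p i).
Hypothesis p01 : forall i x, 0 <= x -> 0 <= p i x <= 1.
Hypothesis pE : forall s t : 'I_q -> R, (forall i, 0 <= s i <= t i) ->
  P [set w | forall i, N i (t i) w - N i (s i) w = y i] = (\prod_(i < q) p i (t i - s i))%:E.

Let E := [set w | forall i, N i (V i w) w - N i (U i w) w = y i].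

Let K n w : {ffun 'I_q -> 'I_(n * 2 ^ n).+1 * 'I_(n * 2 ^ n).+1} :=
  [ffun i => (grid_ix n (U i w), grid_ix n (V i w))].

Let F n (k : {ffun 'I_q -> 'I_(n * 2 ^ n).+1 * 'I_(n * 2 ^ n).+1}) :=
  [set w | forall i, N i (grid_pt n (k i).2) w - N i (grid_pt n (k i).1) w = y i].

Let SK n k : S (K n @^-1` [set k]).
Proof.
pose D (j : 'I_q * bool) := if j.2 then U j.1 @^-1` [set x | grid_ix n x = (k j.1).1]
  else V j.1 @^-1` [set x | grid_ix n x = (k j.1).2].
rewrite (_ : _ @^-1` _ = [set w | forall j, D j w]).
  apply: sigma_algebra_forall => // -[i []]; rewrite /D/=; [apply: SU|apply: SV];
    exact: grid_ix_measurable.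
apply/seteqP; split => w /=.
  by move=> Kk [i b]; rewrite /D -Kk; case: b; rewrite /= ffunE.
move=> h; apply/ffunP => i; rewrite ffunE.
by have /= -> := h (i, true); have /= -> := h (i, false); case: (k i).
Qed.

Let NF n k : process_sigma N (@F n k).
Proof.
apply: sigma_algebra_forall; first exact: sigma_algebra_process_sigma.
move=> i; apply: (@process_sigma_increment _ _ _ _ N i _ _ [set y i]) => //;
  exact/ltW/grid_pt_gt0.
Qed.

Let mF n k : measurable (@F n k).
Proof. by apply: (process_sigma_sub mN); exact: NF. Qed.

Let mK n k : measurable (K n @^-1` [set k]).
Proof. by apply: Sm; exact: SK. Qed.

Let mFK n : measurable [set w | F (K n w) w].
Proof.
by apply: measurable_finite_mixture; [exact: mK|exact: mF].
Qed.

(** The index [K n] is finitely valued with level sets in [S], while each [F n k] belongs to the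
    sigma-algebra of [N], so the finite mixture formula applies. *)
Let mixture n : (\int[P]_w (\1_O w * \1_[set w | F (K n w) w] w)%:E =
  \int[P]_w (\1_O w * fine (P (F (K n w))))%:E)%E.
Proof.
rewrite !integral_full//; last first.
  by apply: (@measurable_fun_finite _ _ _ _ (K n) (fun k => fine (P (@F n k)))); exact: mK.
rewrite integral_indicT; last exact: mFK.
apply: (@probability_finite_mixture _ _ _ P _ (K n) (@F n)); [exact: mK|exact: mF|move=> k].
by rewrite setIC (indep (NF k) (SK k)) muleC.
Qed.

Let cvg_indic w : \1_O w * \1_[set w | F (K n w) w] w @[n --> \oo] --> (\1_(O `&` E) w : R).
Proof.
rewrite indicI/=; have [Ow|Ow] := pselect (O w); last first.
  by rewrite indicE memNset// mul0r; under eq_cvg do rewrite mul0r; exact: cvg_cst.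
apply: cvgM; first exact: cvg_cst.
apply: cvg_near_cst.
have h i : \forall n \near \oo, N i (grid n (U i w)) w = N i (U i w) w /\
    N i (grid n (V i w)) w = N i (V i w) w.
  have /andP[U0 UVi] := UV Ow i.
  have V0 := le_trans U0 UVi.
  have hU : \forall n \near \oo, N i (grid n (U i w)) w = N i (U i w) w.
    exact: (grid_cvg_right U0 (Nr Ow i U0)).
  have hV : \forall n \near \oo, N i (grid n (V i w)) w = N i (V i w) w.
    exact: (grid_cvg_right V0 (Nr Ow i V0)).
  by apply: filterS2 hU hV.
apply: filterS (filter_forall _ h) => n hn.
apply: eq_indic; split => + i => /(_ i); rewrite /F/= !ffunE/=.
  by have [-> ->] := hn i.
by have [<- <-] := hn i.
Qed.

Let cvg_prob w : \1_O w * fine (P (F (K n w))) @[n --> \oo] -->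
  \1_O w * \prod_(i < q) p i `|V i w - U i w|.
Proof.
have [Ow|Ow] := pselect (O w); last first.
  by rewrite indicE memNset// mul0r; under eq_cvg do rewrite mul0r; exact: cvg_cst.
apply: cvgM; first exact: cvg_cst.
have h n : fine (P (F (K n w))) = \prod_(i < q) p i (grid n (V i w) - grid n (U i w)).
  rewrite pE//=; first by apply: eq_bigr => i _; rewrite !ffunE.
  move=> i; rewrite !ffunE/= (ltW (grid_pt_gt0 _ _))//= grid_pt_le// grid_ix_le//.
  by have /andP[] := UV Ow i.
under eq_cvg do rewrite h.
apply: cvg_big => [|i _]; first exact: mul_continuous.
have /andP[U0 UVi] := UV Ow i; have V0 := le_trans U0 UVi.
rewrite ger0_norm ?subr_ge0//.
apply: continuous_cvg; first exact: cp.
have gc x : 0 <= x -> grid n x @[n --> \oo] --> x.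
  by move=> x0; apply: cvg_trans (grid_cvg_right x0) _; exact: cvg_within.
by apply: cvgB; exact: gc.
Qed.

(** [E] evaluates [N] at random times; on [O] its indicator is the pointwise limit of those of the
    events at dyadic times, which are measurable. *)
Lemma time_mixing_measurable : measurable (O `&` E).
Proof.
apply/(measurable_indicP R).
apply: (@measurable_fun_cvg _ _ _ _ (fun n w => \1_O w * \1_[set w | F (K n w) w] w)) => [n|w _].
  by apply: measurable_funM; apply: measurable_indic => //; exact: mFK.
exact: cvg_indic.
Qed.

(** The absolute value changes nothing on [O]; elsewhere it keeps the argument of [p i] nonnegative,
    where the values lie in [0, 1]. *)
Lemma time_mixing :
  P (O `&` E) = (\int[P]_w (\prod_(i < q) p i `|V i w - U i w|)%:E)%E.
Proof.
have mUV i : measurable_fun setT (fun w => p i `|V i w - U i w|).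
  apply: measurableT_comp; first exact: continuous_measurable_fun.
  apply: measurableT_comp => //; apply: measurable_funB => _ A mA; rewrite setTI; apply: Sm.
    exact: SV.
  exact: SU.
rewrite -integral_indicT; last exact: time_mixing_measurable.
rewrite -[RHS](integral_full mO PO); last by apply: measurable_prod => i _; exact: mUV.
have c1 : (\int[P]_w (\1_O w * \1_[set w | F (K n w) w] w)%:E @[n --> \oo]
    --> \int[P]_w (\1_(O `&` E) w)%:E)%E.
  apply: bounded_convergence; last exact: cvg_indic.
  - by move=> n; apply: measurable_funM; apply: measurable_indic => //; exact: mFK.
  - by move=> n w; rewrite !indicE; do 2 case: (_ \in _); rewrite ?mulr0 ?mulr1 ?ler01 ?lexx.
have c2 : (\int[P]_w (\1_O w * fine (P (F (K n w))))%:E @[n --> \oo]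
    --> \int[P]_w (\1_O w * \prod_(i < q) p i `|V i w - U i w|)%:E)%E.
  apply: bounded_convergence; last exact: cvg_prob.
  - move=> n; apply: measurable_funM; first exact: measurable_indic.
    apply: (@measurable_fun_finite _ _ _ _ (K n) (fun k => fine (P (@F n k)))); exact: mK.
  - move=> n w; have /andP[f0 f1] := fine_probability_le1 P (mF (K n w)).
    by rewrite indicE; case: (_ \in _); rewrite ?mul0r ?mul1r ?f0 ?f1 ?lexx ?ler01.
apply: (cvg_unique _ c1) => //; move: c2; under eq_cvg do rewrite -mixture.
by [].
Qed.

End time_mixing.

(** * Law of a generalized counting process *)

Section power_series_uniqueness.
Context {R : realType}.

(** If the coefficients below n vanish, the term of degree n must be balanced by the tail, which is
    of order u^(n+1); letting u tend to 0 forces [d n = 0]. *)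
Lemma power_series_eq0 (d : nat -> R) (C : R) : (forall n, `|d n| <= C) ->
  (forall u, 0 < u < 1 -> \sum_(0 <= n < N) d n * u ^+ n @[N --> \oo] --> 0) ->
  forall n, d n = 0.
Proof.
move=> dC d0; have C0 : 0 <= C by exact: le_trans (dC 0%N).
elim/ltn_ind => n IH.
(* For u <= 1/2 the geometric factor 1 / (1 - u) is at most 2. *)
have h u : 0 < u <= 2^-1 -> `|d n| <= 2 * C * u.
  move=> /andP[u0 u2]; have u1 : 0 < u < 1 by lra.
  have tail N : `|\sum_(n.+1 <= m < N) d m * u ^+ m| <= C * u ^+ n.+1 * 2.
    apply: le_trans (ler_norm_sum _ _ _) _.
    have geo : \sum_(n.+1 <= m < N) u ^+ m <= u ^+ n.+1 * 2.
      have : (1 - u) * \sum_(n.+1 <= m < N) u ^+ m <= u ^+ n.+1.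
        have [Nn|nN] := leqP N n.+1; first by rewrite big_geq// mulr0 exprn_ge0// ltW.
        rewrite mulrBl mul1r mulr_sumr -sumrB.
        under eq_bigr do rewrite -exprS.
        rewrite (telescope_sumr_eq (fun m => - u ^+ m)) //; last by move=> m _; rewrite opprK addrC.
          by rewrite opprK addrC lerBlDr lerDl exprn_ge0// ltW.
        exact: ltnW.
      have s0 : 0 <= \sum_(n.+1 <= m < N) u ^+ m by apply: sumr_ge0 => m _; rewrite exprn_ge0// ltW.
      nra.
    rewrite -mulrA; apply: (@le_trans _ _ (C * \sum_(n.+1 <= m < N) u ^+ m)).
      rewrite mulr_sumr; apply: ler_sum => m _.
      by rewrite normrM [X in _ * X]ger0_norm ?exprn_ge0 ?(ltW u0)// ler_wpM2r// exprn_ge0// ltW.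
    by rewrite ler_wpM2l.
  have L : `|d n * u ^+ n| <= C * u ^+ n.+1 * 2.
    have cv : `|\sum_(0 <= m < N) d m * u ^+ m - d n * u ^+ n| @[N --> \oo] --> `|0 - d n * u ^+ n|.
      by apply: cvg_norm; apply: cvgB; [exact: d0|exact: cvg_cst].
    rewrite -normrN -sub0r.
    apply: (@cvgr_to_le _ \oo _ _ _ _ _ cv); near=> N.
    have nN : (n < N)%N by near: N; exact: nbhs_infty_gt.
    rewrite (@big_cat_nat _ _ _ n.+1)//= big_nat_recr//= big_nat_cond big1; last first.
      by move=> m; rewrite andbT => /andP[_ mn]; rewrite IH// mul0r.
    by rewrite add0r addrAC subrr add0r.
  move: L; rewrite normrM [X in _ * X]ger0_norm ?exprn_ge0 ?(ltW u0)// exprS.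
  rewrite (_ : C * _ * 2 = (2 * C * u) * u ^+ n); last by ring.
  by rewrite ler_pM2r// exprn_gt0.
apply/eqP; rewrite -normr_le0; apply/ler_addgt0Pr => e e0; rewrite add0r.
(* Chosen so that 2 C u <= e; the added 1 avoids a zero denominator when C = 0. *)
pose u := Num.min 2^-1 (e / (2 * C + 1)).
have C1 : 0 < 2 * C + 1 by lra.
have u0 : 0 < u by rewrite lt_min divr_gt0// andbT; lra.
have u2 : u <= 2^-1 by rewrite ge_min lexx.
have ue : u <= e / (2 * C + 1) by rewrite ge_min lexx orbT.
apply: le_trans (h u _) _; first by rewrite u0.
by move: ue; rewrite ler_pdivlMr// => ue; nra.
Unshelve. all: end_near. Qed.

Lemma power_series_unique (p c : nat -> R) (C : R) (L : R -> R) :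
  (forall n, `|p n| <= C) -> (forall n, `|c n| <= C) ->
  (forall u, 0 < u < 1 -> \sum_(0 <= n < N) p n * u ^+ n @[N --> \oo] --> L u) ->
  (forall u, 0 < u < 1 -> \sum_(0 <= n < N) c n * u ^+ n @[N --> \oo] --> L u) ->
  p =1 c.
Proof.
move=> pC cC pL cL n; apply/eqP; rewrite -subr_eq0; apply/eqP.
apply: (@power_series_eq0 (fun n => p n - c n) (C + C)) => [m|u u01].
  by apply: le_trans (ler_normB _ _) _; apply: lerD.
rewrite (_ : (fun _ => _) = fun N => \sum_(0 <= n < N) p n * u ^+ n - \sum_(0 <= n < N) c n * u ^+ n).
  by rewrite -[X in _ --> X](subrr (L u)); apply: cvgB; [exact: pL|exact: cL].
by apply/funext => N; rewrite -sumrB; apply: eq_bigr => m _; rewrite mulrBl.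
Qed.

End power_series_uniqueness.

Section gcp_pmf.
Context {R : realType} (k : nat).
Implicit Types (lam x : 'I_k -> R).

(** Compound Poisson weights: [m j] counts the jumps of size j + 1 and is Poisson with mean
    [lam j * t], independently over j. *)
Definition gcp_pmf lam (t : R) n : R := expR (- (\sum_(j < k) lam j) * t) *
  \sum_(m in Omega k n) \prod_(j < k) ((lam j * t) ^+ m j / (m j)`!%:R).

Let wt N (f : {ffun 'I_k -> 'I_N.+1}) := (\sum_(j < k) j.+1 * f j)%N.

(** The type of the tuples in [Omega k n] depends on n; a common bound N lets the sums for all n <=
    N be added over one finite type. *)
Lemma sum_Omega_widen (b : 'I_k -> nat -> R) n N : (n <= N)%N ->
  \sum_(m in Omega k n) \prod_(j < k) b j (m j) =
  \sum_(f : {ffun 'I_k -> 'I_N.+1} | wt f == n) \prod_(j < k) b j (f j).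
Proof.
move=> nN.
pose h (f : {ffun 'I_k -> 'I_n.+1}) : {ffun 'I_k -> 'I_N.+1} := [ffun j => inord (f j)].
pose h' (f : {ffun 'I_k -> 'I_N.+1}) : {ffun 'I_k -> 'I_n.+1} := [ffun j => inord (f j)].
have hE f j : h f j = f j :> nat.
  by rewrite ffunE inordK// ltnS (leq_trans _ nN)// -ltnS.
have h'E f j : wt f == n -> h' f j = f j :> nat.
  move=> /eqP wf; rewrite ffunE inordK// ltnS -wf /wt (bigD1 j)//= mulSn -addnA.
  exact: leq_addr.
rewrite [RHS](reindex_onto h h'); last first.
  by move=> f wf; apply/ffunP => j; apply/val_inj; rewrite /= hE h'E.
apply: eq_big => [f|f _]; last by apply: eq_bigr => j _; rewrite hE.
rewrite inE /wt; under [in RHS]eq_bigr do rewrite hE.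
case: eqP => //= wf; apply/esym/eqP/ffunP => j; apply/val_inj.
by rewrite /= h'E ?hE// /wt; under eq_bigr do rewrite hE; rewrite wf.
Qed.

(** The exponential of the sum is a product of exponential series; expanding the product of their
    truncations yields a sum over tuples, which is grouped by weight. *)
Lemma Omega_series x (u : R) : (forall j, 0 <= x j) -> 0 < u < 1 ->
  \sum_(0 <= n < N) (\sum_(m in Omega k n) \prod_(j < k) (x j ^+ m j / (m j)`!%:R)) * u ^+ n
    @[N --> \oo] --> expR (\sum_(j < k) x j * u ^+ j.+1).
Proof.
move=> x0 /andP[u0 u1].
pose e (y : R) N := \sum_(m < N.+1) y ^+ m / m`!%:R.
have eE y N : e y N = series (exp_coeff y) N.+1.
  by rewrite /e /series/= big_mkord.
have ecvg y : e y N @[N --> \oo] --> expR y.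
  rewrite (_ : e y = fun N => series (exp_coeff y) N.+1); last exact/funext/eE.
  by rewrite (cvg_shiftS (series (exp_coeff y))); exact: is_cvg_series_exp_coeff.
have e_le y N : 0 <= y -> e y N <= expR y.
  move=> y0; rewrite eE; apply: nondecreasing_cvgn_le; last exact: is_cvg_series_exp_coeff.
  apply/nondecreasing_seqP => m; rewrite /series/= big_nat_recr//= lerDl.
  by rewrite /exp_coeff/= divr_ge0// exprn_ge0.
pose S N := \prod_(j < k) e (x j * u ^+ j.+1) N.
have SL : S N @[N --> \oo] --> expR (\sum_(j < k) x j * u ^+ j.+1).
  rewrite expR_sum; apply: cvg_big => [|j _]; [exact: mul_continuous|exact: ecvg].
pose t N (f : {ffun 'I_k -> 'I_N.+1}) : R := \prod_(j < k) (x j ^+ f j / (f j)`!%:R).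
have t0 N (f : {ffun 'I_k -> 'I_N.+1}) : 0 <= t N f.
  by apply: prodr_ge0 => j _; rewrite divr_ge0// exprn_ge0.
have SE N : S N = \sum_(f : {ffun 'I_k -> 'I_N.+1}) t N f * u ^+ wt f.
  rewrite /S /e bigA_distr_bigA/=; apply: eq_bigr => f _.
  rewrite /t /wt -prodrXr -big_split/=; apply: eq_bigr => j _.
  by rewrite exprMn exprM mulrAC.
pose D N := \sum_(0 <= n < N.+1) (\sum_(m in Omega k n) \prod_(j < k) (x j ^+ m j / (m j)`!%:R)) * u ^+ n.
have DE N : D N = \sum_(f : {ffun 'I_k -> 'I_N.+1} | (wt f < N.+1)%N) t N f * u ^+ wt f.
  rewrite /D big_mkord.
  transitivity (\sum_(n < N.+1) \sum_(f : {ffun 'I_k -> 'I_N.+1} | (wt f < N.+1)%N && (inord (wt f) == n)) t N f * u ^+ wt f).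
    apply: eq_bigr => n _.
    have nN : (n <= N)%N by rewrite -ltnS.
    have /= -> := sum_Omega_widen (fun j m => x j ^+ m / m`!%:R) nN.
    rewrite mulr_suml; apply: eq_big => [f|f /eqP <-//].
    apply/eqP/andP => [->|[wf /eqP <-]]; last by rewrite inordK.
    by rewrite ltn_ord inord_val.
  by rewrite -partition_big.
pose C := expR (\sum_(j < k) x j).
have C0 N : \sum_(f : {ffun 'I_k -> 'I_N.+1}) t N f <= C.
  rewrite /t -(bigA_distr_bigA (fun j (m : 'I_N.+1) => x j ^+ m / m`!%:R)) /C expR_sum.
  apply: ler_prod => j _; rewrite e_le// andbT.
  by apply: sumr_ge0 => m _; rewrite divr_ge0// exprn_ge0.
(* The truncated product also contains tuples of weight above N. Together they contribute at most C
   u^(N+1), where C bounds the sum of all coefficients. *)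
have SD N : D N <= S N <= D N + C * u ^+ N.+1.
  have split := bigID (fun f : {ffun 'I_k -> 'I_N.+1} => (wt f < N.+1)%N) xpredT (fun f => t N f * u ^+ wt f).
  rewrite SE DE [X in _ <= X <= _]split/=.
  rewrite lerDl sumr_ge0/=; last by move=> f _; rewrite mulr_ge0// exprn_ge0// ltW.
  rewrite lerD2l; apply: (@le_trans _ _ ((\sum_(f : {ffun 'I_k -> 'I_N.+1}) t N f) * u ^+ N.+1)).
    rewrite mulr_suml big_mkcond/=; apply: ler_sum => f _.
    case: ifPn => [|_]; last by rewrite mulr_ge0// exprn_ge0// ltW.
    rewrite -leqNgt => wf; rewrite ler_wpM2l//.
    by apply: ler_wiXn2l => //; exact: ltW.
  by rewrite ler_wpM2r// exprn_ge0// ltW.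
have un : C * u ^+ N.+1 @[N --> \oo] --> 0.
  rewrite -(mulr0 C); apply: cvgM; first exact: cvg_cst.
  by rewrite cvg_shiftS; apply: cvg_expr; rewrite gtr0_norm.
rewrite -cvg_shiftS/=.
have lowL : S N - C * u ^+ N.+1 @[N --> \oo] --> expR (\sum_(j < k) x j * u ^+ j.+1).
  by rewrite -[X in _ --> X]subr0; apply: cvgB.
apply: (squeeze_cvgr _ lowL SL); near=> N.
by have /andP[-> h] := SD N; rewrite lerBlDr h.
Unshelve. all: end_near. Qed.

Lemma gcp_pmf_series lam t u : (forall j, 0 <= lam j) -> 0 <= t -> 0 < u < 1 ->
  \sum_(0 <= n < N) gcp_pmf lam t n * u ^+ n @[N --> \oo] -->
    expR (- t * \sum_(j < k) lam j * (1 - u ^+ j.+1)).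
Proof.
move=> l0 t0 u01.
have := @Omega_series (fun j => lam j * t) u (fun j => mulr_ge0 (l0 j) t0) u01.
move=> /(cvgM (cvg_cst (expR (- (\sum_(j < k) lam j) * t)))).
rewrite -expRD (_ : - (\sum_(j < k) lam j) * t + _ = - t * \sum_(j < k) lam j * (1 - u ^+ j.+1)).
  apply: cvg_trans; apply: near_eq_cvg; near=> N.
  by rewrite /= mulr_sumr; apply: eq_bigr => n _; rewrite /gcp_pmf mulrA.
rewrite mulNr mulr_suml -sumrN -big_split/= mulr_sumr; apply: eq_bigr => j _; ring.
Unshelve. all: end_near. Qed.

Lemma gcp_pmf_ge0 lam t n : (forall j, 0 <= lam j) -> 0 <= t -> 0 <= gcp_pmf lam t n.
Proof.
move=> l0 t0; rewrite mulr_ge0 ?expR_ge0// sumr_ge0// => m _.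
by apply: prodr_ge0 => j _; rewrite divr_ge0// exprn_ge0// mulr_ge0.
Qed.

(** A single term of a nonnegative series is at most its sum, here at most 1; then u tends to 1 from
    the left. Uniqueness of power series needs this bound before [gcp_pmf] is known to be a law. *)
Lemma gcp_pmf_le1 lam t n : (forall j, 0 <= lam j) -> 0 <= t -> gcp_pmf lam t n <= 1.
Proof.
move=> l0 t0.
have h u : 0 < u < 1 -> gcp_pmf lam t n * u ^+ n <= 1.
  move=> u01; have /andP[u0 u1] := u01; have cv := gcp_pmf_series l0 t0 u01.
  have L1 : expR (- t * \sum_(j < k) lam j * (1 - u ^+ j.+1)) <= 1.
    rewrite -[leRHS]expR0 ler_expR mulNr oppr_le0 mulr_ge0// sumr_ge0// => j _.
    by rewrite mulr_ge0// subr_ge0 exprn_ile1// ltW.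
  apply: le_trans L1; apply: (@cvgr_to_ge _ \oo _ _ _ _ _ cv); near=> N.
  have nN : (n < N)%N by near: N; exact: nbhs_infty_gt.
  rewrite (bigD1_seq n) ?mem_index_iota ?iota_uniq//= lerDl sumr_ge0// => m _.
  by rewrite mulr_ge0 ?gcp_pmf_ge0// exprn_ge0// ltW.
have cv : gcp_pmf lam t n * u ^+ n @[u --> 1^'-] --> gcp_pmf lam t n * 1 ^+ n.
  apply: cvgM; first exact: cvg_cst.
  by apply: cvg_at_left_filter; exact: exprn_continuous.
suff : gcp_pmf lam t n * 1 ^+ n <= 1 by rewrite expr1n mulr1.
apply: (@cvgr_to_le _ (1^'-) _ _ _ _ _ cv); near=> u.
by apply: h; apply/andP; split; near: u; [exact: nbhs_left_gt|exact: nbhs_left_lt].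
Unshelve. all: end_near. Qed.

Lemma continuous_gcp_pmf lam n : continuous (gcp_pmf lam ^~ n).
Proof.
move=> t; apply: cvgM.
  apply: continuous_comp; last exact: continuous_expR.
  exact: mulrl_continuous.
apply: cvg_big => [|m _]; first exact: add_continuous.
apply: cvg_big => [|j _]; first exact: mul_continuous.
apply: cvgM; last exact: cvg_cst.
apply: (@continuous_comp _ _ _ (fun t => lam j * t) (fun y => y ^+ m j)).
  exact: mulrl_continuous.
exact: exprn_continuous.
Qed.

End gcp_pmf.

Lemma gcp_law (R : realType) (d : measure_display) (T : measurableType d)
    (P : probability T R) (k : nat) (lam : 'I_k -> R) (M : R -> T -> nat) :
  (forall j, 0 <= lam j) -> gcp P lam M -> forall t n, 0 <= t ->
  P [set w | M t w = n] = (gcp_pmf lam t n)%:E.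
Proof.
move=> l0 [[mM _ _ _ _] pgf] t + t0.
have mMn n : measurable [set w | M t w = n].
  rewrite (_ : [set _ | _] = (fun w => (M t w)%:R : R) @^-1` [set n%:R]); last first.
    by apply/seteqP; split => w /= => [->//|/eqP]; rewrite eqr_nat => /eqP.
  by rewrite -[X in measurable X]setTI; apply: mM.
have p_cvg u : 0 < u < 1 -> \sum_(0 <= n < N) fine (P [set w | M t w = n]) * u ^+ n @[N --> \oo] -->
    expR (- t * \sum_(j < k) lam j * (1 - u ^+ j.+1)).
  move=> /andP[u0 u1].
  have E : (\int[P]_w (u ^+ M t w)%:E)%E = (expR (- t * \sum_(j < k) lam j * (1 - u ^+ j.+1)))%:E.
    by rewrite -pgf ?unlock// ger0_norm// ltW.
  have I n : (\int[P]_w (u ^+ n * \1_[set w | M t w = n] w)%:E = (u ^+ n * fine (P [set w | M t w = n]))%:E)%E.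
    under eq_integral do rewrite EFinM.
    rewrite ge0_integralZl//; last 2 first.
    - by apply/measurable_EFinP; exact: measurable_indic.
    - by rewrite lee_fin exprn_ge0// ltW.
    by rewrite integral_indicT// EFinM fineK// fin_num_measure.
  (* Truncations of [u ^+ M t w], whose means are the partial sums of the generating function;
     bounded convergence gives the whole series. *)
  pose f N w := \sum_(0 <= n < N) u ^+ n * \1_[set w | M t w = n] w.
  have fE N w : f N w = if (M t w < N)%N then u ^+ M t w else 0.
    rewrite /f; case: ltnP => MN.
      rewrite (bigD1_seq (M t w)) ?mem_index_iota ?iota_uniq//= big1 ?addr0.
        by rewrite indicE mem_set// mulr1.
      by move=> n /eqP nM; rewrite indicE memNset ?mulr0// => /= /esym.
    rewrite big_nat_cond big1// => n; rewrite andbT => /andP[_ nN].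
    by rewrite indicE memNset ?mulr0//= => Mn; move: nN; rewrite -Mn ltnNge MN.
  have := @bounded_convergence R d T P f (fun w => u ^+ M t w).
  move=> H.
  have {}H : (\int[P]_x (f N x)%:E @[N --> \oo] --> \int[P]_x (u ^+ M t x)%:E)%E.
    apply: H.
    - move=> N; apply: measurable_sum => n; exact: measurable_funM.
    - move=> N w; rewrite fE; case: ifP => _; last by rewrite lexx ler01.
      by rewrite exprn_ge0 ?(ltW u0)//= exprn_ile1// ltW.
    - move=> w; apply: cvg_near_cst; near=> N; rewrite fE ifT//.
      by near: N; exact: nbhs_infty_gt.
  rewrite E in H; move/fine_cvgP: H => [_]; apply: cvg_trans; apply: near_eq_cvg; near=> N.
  rewrite /= /f.
  under eq_integral do rewrite -sumEFin.
  rewrite ge0_integral_sum//; last 2 first.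
  - by move=> n; apply/measurable_EFinP/measurable_funM => //; exact: measurable_indic.
  - by move=> n w _; rewrite lee_fin mulr_ge0// exprn_ge0// ltW.
  rewrite (eq_bigr _ (fun n _ => I n)) sumEFin/=.
  by apply: eq_bigr => n _; rewrite mulrC.
have C1 n : `|fine (P [set w | M t w = n])| <= 1.
  by rewrite ger0_norm; have /andP[] := fine_probability_le1 P (mMn n).
have C2 n : `|gcp_pmf lam t n| <= 1.
  by rewrite ger0_norm ?gcp_pmf_ge0// gcp_pmf_le1.
move=> n.
rewrite -(power_series_unique C1 C2 p_cvg (fun u => gcp_pmf_series l0 t0)).
by rewrite fineK// fin_num_measure.
Unshelve. all: end_near. Qed.

(** * Gamma mixtures *)

Section gamma_moments.
Context {R : realType}.
Notation mu := (@lebesgue_measure R).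

Lemma Gamma_gamma_int (s : R) : Gamma s = fine (gamma_int s 1).
Proof.
rewrite /Gamma /Rintegral /gamma_int; congr fine.
by apply: eq_integral => x _; rewrite mulN1r.
Qed.

Lemma Gamma_nat n : Gamma n.+1%:R = n`!%:R :> R.
Proof. by rewrite Gamma_gamma_int gamma_int_nat. Qed.

Lemma pochhammerS (x : R) n : pochhammer x n.+1 = pochhammer x n * (x + n%:R).
Proof. by rewrite /pochhammer big_ord_recr. Qed.

Lemma gamma_int_pochhammer (s b : R) n : 0 < s -> 0 < b ->
  gamma_int (s + n%:R) b = ((pochhammer s n / b ^+ n)%:E * gamma_int s b)%E.
Proof.
move=> s0 b0; elim: n => [|n IH].
  by rewrite addr0 /pochhammer big_ord0 expr0 divr1 mul1e.
have sn0 : 0 < s + n%:R by rewrite ltr_wpDr.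
have := gamma_int_rec sn0 b0; rewrite -addrA natr1 IH => h.
have : (b^-1%:E * (b%:E * gamma_int (s + n.+1%:R) b) =
  b^-1%:E * ((s + n%:R)%:E * ((pochhammer s n / b ^+ n)%:E * gamma_int s b)))%E by rewrite h.
rewrite !muleA -!EFinM mulVf ?gt_eqF// mul1e => ->; congr (_%:E * _)%E.
by rewrite pochhammerS exprS; field; rewrite ?expf_neq0 ?(gt_eqF b0).
Qed.

Lemma integral_gamma_density (s a c : R) n : 0 < s -> 0 < a -> 0 <= c ->
  Gamma s != 0 ->
  (\int[mu]_(x in `]0%R, +oo[) (x ^+ n * expR (- c * x) * gamma_density s a x)%:E =
   ((a / (a + c)) `^ s * pochhammer s n / (a + c) ^+ n)%:E)%E.
Proof.
move=> s0 a0 c0 G0.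
have ac0 : 0 < a + c by rewrite ltr_wpDr.
(* [fine] sends +oo to 0, so a nonzero [Gamma s] certifies that the integral is finite. *)
have fin : gamma_int s 1 = (Gamma s)%:E.
  rewrite Gamma_gamma_int fineK//; apply: contraNT G0 => /negbTE.
  rewrite Gamma_gamma_int; case: (gamma_int s 1) => //=.
have Gs0 : 0 <= Gamma s by rewrite Gamma_gamma_int fine_ge0// gamma_int_ge0.
transitivity (\int[mu]_(x in `]0%R, +oo[)
    ((a `^ s / Gamma s)%:E * (x `^ (s + n%:R - 1) * expR (- (a + c) * x))%:E))%E.
  apply: eq_integral => x; rewrite inE/= in_itv/= andbT => x0.
  have -> : x `^ (s + n%:R - 1) = x `^ (s - 1) * x ^+ n.
    by rewrite addrAC -powR_mulrn ?(ltW x0)// -powRD// (gt_eqF x0) implybT.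
  rewrite -EFinM /gamma_density opprD mulrDl expRD; congr EFin; ring.
rewrite ge0_integralZl//; last 3 first.
- by apply/measurable_EFinP; exact: measurable_powR_expR.
- by move=> x _; rewrite lee_fin mulr_ge0 ?powR_ge0 ?expR_ge0.
- by rewrite lee_fin divr_ge0 ?powR_ge0.
rewrite -/(gamma_int _ _) gamma_int_pochhammer// gamma_int_scale// fin -!EFinM; congr EFin.
have E : (a / (a + c)) `^ s = a `^ s / (a + c) `^ s.
  have b0 : (a + c) `^ s != 0 by rewrite gt_eqF// powR_gt0.
  apply: (mulIf b0); rewrite divfK// -powRM ?divr_ge0 ?(ltW a0) ?(ltW ac0)//.
  by rewrite divfK// gt_eqF.
rewrite E; field; rewrite G0/= expf_neq0 ?(gt_eqF ac0)//= gt_eqF// powR_gt0//.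
Qed.

End gamma_moments.

Section gamma_mixture.
Context {R : realType} (k : nat) (lam : 'I_k -> R).
Notation mu := (@lebesgue_measure R).
Let Lam := \sum_(j < k) lam j.

(** Negative multinomial weights of the jump counts, for a gamma time of shape s and rate a. At s =
    0 the formula gives the point mass at 0. *)
Definition gamma_mix (a s : R) n : R := (a / (a + Lam)) `^ s *
  \sum_(m in Omega k n) pochhammer s (etan m) *
    \prod_(j < k) ((lam j / (a + Lam)) ^+ m j / (m j)`!%:R).

Hypothesis lam0 : forall j, 0 <= lam j.

Let Lam0 : 0 <= Lam. Proof. exact: sumr_ge0. Qed.

Lemma gcp_pmfE x n : gcp_pmf lam x n = \sum_(m in Omega k n)
  (\prod_(j < k) (lam j ^+ m j / (m j)`!%:R)) * (x ^+ etan m * expR (- Lam * x)).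
Proof.
rewrite /gcp_pmf mulr_sumr; apply: eq_bigr => m _.
rewrite mulrC mulrA; congr (_ * _).
rewrite /etan -prodrXr -big_split/=; apply: eq_bigr => j _.
by rewrite exprMn mulrAC.
Qed.

Lemma integral_gcp_pmf_gamma (a s : R) n : 0 < a -> 0 < s -> Gamma s != 0 ->
  (\int[mu]_(x in `]0%R, +oo[) (gcp_pmf lam x n * gamma_density s a x)%:E =
   (gamma_mix a s n)%:E)%E.
Proof.
move=> a0 s0 G0.
pose w (m : {ffun 'I_k -> 'I_n.+1}) := \prod_(j < k) (lam j ^+ m j / (m j)`!%:R).
have w0 m : 0 <= w m by apply: prodr_ge0 => j _; rewrite divr_ge0// exprn_ge0.
have Gs0 : 0 <= Gamma s by rewrite Gamma_gamma_int fine_ge0// gamma_int_ge0.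
have d0 x : 0 <= gamma_density s a x.
  by rewrite /gamma_density !mulr_ge0 ?powR_ge0 ?expR_ge0 ?invr_ge0.
have md : measurable_fun setT (gamma_density s a).
  apply: (eq_measurable_fun (fun x => a `^ s / Gamma s * (x `^ (s - 1) * expR (- a * x)))).
    by move=> x _; rewrite /gamma_density mulrA.
  by apply: measurable_funM => //; exact: measurable_powR_expR.
transitivity (\int[mu]_(x in `]0%R, +oo[) (\sum_(m in Omega k n)
    ((w m)%:E * (x ^+ etan m * expR (- Lam * x) * gamma_density s a x)%:E)))%E.
  apply: eq_integral => x _; rewrite gcp_pmfE mulr_suml -sumEFin.
  by apply: eq_bigr => m _; rewrite -EFinM /w !mulrA.
have mf (m : {ffun 'I_k -> 'I_n.+1}) : measurable_fun setT (fun x : R => x ^+ etan m * expR (- Lam * x) * gamma_density s a x).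
  apply: measurable_funM => //; apply: measurable_funM.
    exact: exprn_measurable.
  by apply: measurableT_comp => //; exact: measurable_funM.
have f0 (m : {ffun 'I_k -> 'I_n.+1}) x : 0 < x -> 0 <= x ^+ etan m * expR (- Lam * x) * gamma_density s a x.
  by move=> x0; rewrite mulr_ge0// mulr_ge0 ?expR_ge0// exprn_ge0// ltW.
under eq_integral do rewrite -big_enum.
rewrite ge0_integral_sum//; last 2 first.
- by move=> m; apply: measurable_funeM; apply/measurable_EFinP/measurable_funTS; exact: mf.
- move=> m x; rewrite /= in_itv/= andbT => x0.
  by rewrite mule_ge0// lee_fin// f0.
rewrite big_enum/= /gamma_mix mulr_sumr -sumEFin.
apply: eq_bigr => m _; rewrite ge0_integralZl//; last 3 first.
- by apply/measurable_EFinP/measurable_funTS; exact: mf.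
- by move=> x; rewrite /= in_itv/= andbT => x0; rewrite lee_fin f0.
- by rewrite lee_fin.
rewrite integral_gamma_density// -EFinM; congr EFin.
have -> : \prod_(j < k) ((lam j / (a + Lam)) ^+ m j / (m j)`!%:R) = w m / (a + Lam) ^+ etan m.
  rewrite /w /etan -prodrXr -prodf_div; apply: eq_bigr => j _.
  by rewrite expr_div_n mulrAC.
by ring.
Qed.

End gamma_mixture.

Section gamma_process_law.
Context (R : realType) (d : measure_display) (T : measurableType d) (P : probability T R).
Variables (lambda a : R) (Z : R -> T -> R).
Hypotheses (lambda0 : 0 < lambda) (a0 : 0 < a) (Zg : gamma_process P lambda a Z).
Notation mu := (@lebesgue_measure R).

(** Were it 0, possibly because the integral diverges, the density would vanish identically and the
    law of [Z t] would have mass 0. Finiteness of the gamma integral is drawn from here. *)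
Lemma gamma_process_Gamma_neq0 t : 0 < t -> Gamma (lambda * t) != 0.
Proof.
move=> t0; apply/eqP => G0; have [_ /(_ _ _ t0 measurableT)] := Zg.
rewrite preimage_setT probability_setT setTI integral0_eq.
  by move=> /eqP; rewrite onee_eq0.
by move=> x _; rewrite /gamma_density G0 invr0 mulr0 !mul0r.
Qed.

Lemma gamma_process_integral t (f : R -> R) : 0 < t -> measurable_fun setT f ->
  (forall x, 0 <= f x) ->
  (\int[P]_w (f (Z t w))%:E =
   \int[mu]_(x in `]0%R, +oo[) (f x * gamma_density (lambda * t) a x)%:E)%E.
Proof.
move=> t0 mf f0; have [[mZ _ _ _ _] law] := Zg.
have Gs0 : 0 <= Gamma (lambda * t) by rewrite Gamma_gamma_int fine_ge0// gamma_int_ge0.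
have d0 x : 0 <= gamma_density (lambda * t) a x.
  by rewrite /gamma_density !mulr_ge0 ?powR_ge0 ?expR_ge0 ?invr_ge0.
have md : measurable_fun setT (gamma_density (lambda * t) a).
  apply: (eq_measurable_fun (fun x => a `^ (lambda * t) / Gamma (lambda * t) *
      (x `^ (lambda * t - 1) * expR (- a * x)))).
    by move=> x _; rewrite /gamma_density mulrA.
  by apply: measurable_funM => //; exact: measurable_powR_expR.
have t0' := ltW t0.
have := @eq_integral_comp _ _ _ T (measurableTypeR R) R R P mu (Z t) id (cst 1)
  (fun x => \1_(`]0%R, +oo[%classic : set R) x * gamma_density (lambda * t) a x) f.
move=> H.
transitivity (\int[P]_w (f (Z t w) * cst 1 w)%:E)%E.
  by apply: eq_integral => w _; rewrite mulr1.
rewrite H//; last 4 first.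
- exact: mZ.
- by apply: measurable_funM => //; exact: measurable_indic.
- by move=> x; rewrite mulr_ge0.
- move=> A mA.
  have mZA : measurable (Z t @^-1` A) by rewrite -[X in measurable X]setTI; exact: mZ.
  under eq_integral do rewrite mulr1.
  rewrite (integral_indicT _ mZA) law// [LHS]integral_mkcond; apply: eq_integral => x _.
  rewrite patchE in_setI !indicE.
  by case: (x \in A); case: (x \in _); rewrite ?mul1r ?mul0r.
rewrite [RHS]integral_mkcond; apply: eq_integral => x _.
by rewrite patchE indicE; case: (x \in _); rewrite ?mul1r// mul0r mulr0.
Qed.

Lemma gamma_process_gcp_pmf (k : nat) (lam : 'I_k -> R) t n : (forall j, 0 <= lam j) -> 0 < t ->
  (\int[P]_w (gcp_pmf lam `|Z t w| n)%:E = (gamma_mix lam a (lambda * t) n)%:E)%E.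
Proof.
move=> l0 t0; rewrite (@gamma_process_integral _ (fun x => gcp_pmf lam `|x| n))//.
- rewrite -(integral_gcp_pmf_gamma l0 _ a0) ?mulr_gt0//; last exact: gamma_process_Gamma_neq0.
  by apply: eq_integral => x; rewrite inE/= in_itv/= andbT => x0; rewrite gtr0_norm.
- apply: (measurableT_comp (f := gcp_pmf lam ^~ n)) => //.
  by apply: continuous_measurable_fun; exact: continuous_gcp_pmf.
- by move=> x; exact: gcp_pmf_ge0.
Qed.

End gamma_process_law.

(** * Regular paths on events of probability one *)

Section full_events.
Context (R : realType) (d : measure_display) (T : measurableType d) (P : probability T R).

Definition full_event (O : set T) := measurable O /\ P O = 1%E.

Lemma full_eventP (O : set T) : measurable O -> full_event O <-> P (~` O) = 0%E.
Proof.
move=> mO; split=> [[_ PO]|PO].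
  by apply: etrans (probability_setC P mO) _; rewrite PO subee.
split=> //; have := probability_setC P (measurableC mO); rewrite setCK PO sube0.
by [].
Qed.

Lemma full_event_bigcap (F : nat -> set T) :
  (forall n, full_event (F n)) -> full_event (\bigcap_n F n).
Proof.
move=> fF; have mF n : measurable (F n) by case: (fF n).
have mb : measurable (\bigcap_n F n) by exact: bigcap_measurableType.
apply/(full_eventP mb); rewrite setC_bigcap.
apply/negligibleP; first by apply: bigcup_measurable => n _; exact: measurableC.
apply: negligible_bigcup => n; apply/negligibleP; first exact: measurableC.
by apply/full_eventP.
Qed.

Lemma full_eventI (A B : set T) : full_event A -> full_event B -> full_event (A `&` B).
Proof.
move=> [mA PA] [mB PB]; split; first exact: measurableI.
by rewrite (probability_full mA PA).
Qed.

Lemma full_event_forall (J : countType) (F : J -> set T) :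
  (forall j, full_event (F j)) -> full_event [set w | forall j, F j w].
Proof.
move=> fF; pose F' n := if unpickle n is Some j then F j else setT.
rewrite (_ : [set _ | _] = \bigcap_n F' n).
  apply: full_event_bigcap => n; rewrite /F'; case: unpickle => // .
  by split; rewrite ?probability_setT.
apply/seteqP; split => w /= h.
  by move=> n _; rewrite /F'; case: unpickle.
by move=> j; have := h (pickle j) I; rewrite /F' pickleK.
Qed.

Lemma full_event_subset (A B : set T) : full_event A -> measurable B -> A `<=` B -> full_event B.
Proof.
move=> [mA PA] mB AB; split=> //; apply/eqP; rewrite eq_le probability_le1//=.
by rewrite -PA le_measure// inE.
Qed.

End full_events.

Section nondecreasing_paths.
Context (R : realType) (d : measure_display) (T : measurableType d) (P : probability T R).

(** An increment has the law of [X] at its length, hence is almost surely nonnegative. Countably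
    many pairs of dyadic times share one almost sure event, and right continuity extends the
    inequality to all times. *)
Lemma levy_nondecreasing (X : R -> T -> R) : levy_process P X ->
  (forall t, 0 <= t -> P [set w | X t w < 0] = 0%E) ->
  exists2 O, full_event P O &
    forall w, O w -> forall s t, 0 <= s <= t -> 0 <= X s w <= X t w.
Proof.
move=> [mX X0 [_ sX] _ cX] Xneg.
pose p (n j : nat) : R := j%:R / 2 ^+ n.
have p0 n j : 0 <= p n j by rewrite divr_ge0// exprn_ge0.
pose F n j l := [set w | X (p n j) w <= X (p n j + p n l) w].
have fF n j l : full_event P (F n j l).
  have mF : measurable (F n j l).
    rewrite (_ : F n j l = (fun w => X (p n j + p n l) w - X (p n j) w) @^-1` `[0, +oo[%classic).
      rewrite -[X in measurable X]setTI; apply: measurable_funB => //; apply: mX => //.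
      by rewrite addr_ge0.
    by apply/seteqP; split => w; rewrite /F/= in_itv/= andbT subr_ge0.
  apply/(full_eventP P mF).
  have := sX (p n j) (p n l) `]-oo, 0[%classic (p0 _ _) (p0 _ _) (measurable_itv _).
  rewrite [X in _ = P X](_ : _ = [set w | X (p n l) w < 0]); last first.
    by apply/seteqP; split => w /=; rewrite in_itv.
  rewrite Xneg//; apply: etrans; congr (P _).
  apply/seteqP; split => w; rewrite /F/= in_itv/= subr_lt0.
    by move=> /negP; rewrite -ltNge.
  by rewrite ltNge => /negP.
have fX0 : full_event P [set w | 0 <= X 0 w].
  have m0 : measurable [set w | 0 <= X 0 w].
    rewrite (_ : [set w | _] = X 0 @^-1` `[0, +oo[%classic).
      by rewrite -[X in measurable X]setTI; apply: mX.
    by apply/seteqP; split => w; rewrite /= in_itv/= andbT.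
  apply/(full_eventP P m0); rewrite -[RHS](Xneg 0)//; congr (P _).
  by apply/seteqP; split => w /=; rewrite ltNge => /negP.
pose O := [set w | 0 <= X 0 w] `&` \bigcap_n \bigcap_j \bigcap_l F n j l.
exists O.
  by apply: full_eventI => //; do 3 apply: full_event_bigcap => ?.
move=> w [Xw0 Ow].
have mono s t : 0 <= s <= t -> X s w <= X t w.
  move=> /andP[s0 st]; have t0 := le_trans s0 st.
  have cv u : 0 <= u -> X (grid n u) w @[n --> \oo] --> X u w.
    move=> u0; have [cr _] := cX w u u0.
    exact: (cvg_comp _ _ (grid_cvg_right u0) cr).
  apply: (ler_cvg_to (cv s s0) (cv t t0)); apply: nearW => n; rewrite /grid /grid_pt.
  have := Ow n I (grid_ix n s).+1 I (grid_ix n t - grid_ix n s)%N I.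
  rewrite /F/= /p -mulrDl -natrD addSn subnKC// grid_ix_le//.
move=> s t /andP[s0 st]; rewrite mono ?s0// andbT.
by apply: le_trans Xw0 _; apply: mono; rewrite lexx.
Qed.

(** Naturals at distance less than 1 are equal, so right continuity becomes local constancy. *)
Lemma nat_cadlag_right (f : R -> nat) t : cadlag (fun s => (f s)%:R : R) -> 0 <= t ->
  \forall s \near t^'+, f s = f t.
Proof.
move=> cf t0; have [/cvgrPdist_lt/(_ 1 ltr01) h _] := cf t t0.
near=> s; have : `|(f t)%:R - (f s)%:R| < 1 :> R by near: s; exact: h.
rewrite ltr_norml => /andP[h1 h2]; apply/eqP; rewrite eqn_leq.
by apply/andP; split; rewrite -ltnS -(ltr_nat R) -natr1; lra.
Unshelve. all: end_near. Qed.

End nondecreasing_paths.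

(** * The gamma subordinator *)

Section subordinator.
Context (R : realType) (d : measure_display) (T : measurableType d) (P : probability T R).
Context (q : nat) (lambda theta : R) (a : 'I_q -> R).
Context (Z : 'I_q -> R -> T -> R) (B : R -> T -> nat).
Hypotheses (lambda0 : 0 < lambda) (theta01 : 0 < theta < 1) (a0 : forall i, 0 < a i).
Hypothesis Z_gamma : forall i, gamma_process P lambda (a i) (Z i).
Hypothesis Z_indep : independent_processes P Z.
Hypothesis B_nb : negative_binomial_process P lambda theta B.
Hypothesis ZB_indep : sigma_independent P (process_sigma Z)
  (process_sigma (fun (_ : unit) t w => (B (lambda * t) w)%:R)).

Let G := gamma_subordinator lambda Z B.
Let Bl t w := B (lambda * t) w.
Let SB := process_sigma (fun (_ : unit) t w => (Bl t w)%:R : R).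

Let mZ i t : 0 <= t -> measurable_fun setT (Z i t).
Proof. by move=> t0; have [[mZ _ _ _ _] _] := Z_gamma i; exact: mZ. Qed.

Let mB t : 0 <= t -> measurable_fun setT (fun w => (Bl t w)%:R : R).
Proof. by move=> t0; have [[mB _ _ _ _] _] := B_nb; exact: mB. Qed.

Let SB_event t n : 0 <= t -> SB [set w | Bl t w = n].
Proof.
move=> t0; rewrite (_ : [set _ | _] = (fun w => (Bl t w)%:R : R) @^-1` [set n%:R]).
  exact: (@process_sigma_preimage _ _ _ _ (fun (_ : unit) t w => (Bl t w)%:R : R) tt t _ t0 (measurable_set1 _)).
by apply/seteqP; split => w /= => [->//|/eqP]; rewrite eqr_nat => /eqP.
Qed.

Let SB_measurable : SB `<=` measurable.
Proof. by apply: process_sigma_sub => _ t t0; exact: mB. Qed.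

Let time_ge0 t n : 0 <= t -> 0 <= t + lambda^-1 * n%:R.
Proof. by move=> t0; rewrite addr_ge0// mulr_ge0// invr_ge0 ltW. Qed.

(** The clock takes countably many values, and for each of them the subordinator is [Z i] at a fixed
    time. *)
Lemma measurable_subordinator i t : 0 <= t -> measurable_fun setT (G i t).
Proof.
move=> t0 _ A mA; rewrite setTI.
rewrite (_ : _ @^-1` _ = \bigcup_n ([set w | Bl t w = n] `&` Z i (t + lambda^-1 * n%:R) @^-1` A)).
  apply: bigcup_measurable => n _; apply: measurableI; first by apply: SB_measurable; exact: SB_event.
  by rewrite -[X in measurable X]setTI; apply: mZ => //; exact: time_ge0.
apply/seteqP; split => [w Aw|w [n _ [/= Bn Aw]]].
  by exists (Bl t w).
by rewrite /G /gamma_subordinator -/(Bl t w) Bn.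
Qed.

Definition nb_pmf (x : R) n := (1 - theta) `^ x * (pochhammer x n / n`!%:R) * theta ^+ n.

Lemma nb_pmfE t n : 0 <= t -> P [set w | Bl t w = n] = (nb_pmf (lambda * t) n)%:E.
Proof.
move=> t0; have [_ ->//] := B_nb; congr (_ * (_ / _) * _)%:E.
(* Reversing the order of the factors turns the descending product of [gbinom] into a rising one. *)
rewrite /pochhammer (reindex_inj rev_ord_inj)/=; apply: eq_bigr => l _.
rewrite natrB// -natr1; ring.
Qed.

(** The last clause is right continuity in a form that survives composition: [G i] is nondecreasing,
    so it approaches [G i t w] from the right or stays equal to it, whence the condition
    [A (G i t w)]. *)
Lemma subordinator_paths : exists2 W, full_event P W & forall w, W w ->
  [/\ forall i s t, 0 <= s <= t -> 0 <= G i s w <= G i t w,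
      forall s t, 0 <= s <= t -> (Bl s w <= Bl t w)%N
    & forall i (A : set R) t, 0 <= t -> (\forall s \near (G i t w)^'+, A s) -> A (G i t w) ->
        \forall s \near t^'+, A (G i s w)].
Proof.
have [|WB fWB hB] := @levy_nondecreasing _ _ _ P _ (proj1 B_nb).
  move=> t t0; rewrite (_ : [set _ | _] = set0) ?measure0//.
  by apply/seteqP; split => w //=; rewrite ltNge ler0n.
have hZ i : {W | full_event P W & forall w, W w -> forall s t, 0 <= s <= t -> 0 <= Z i s w <= Z i t w}.
  apply: cid2; have [lZ law] := Z_gamma i; apply: levy_nondecreasing => // t.
  (* The gamma law is given at positive times only; at time 0 the process vanishes almost surely. *)
  rewrite le_eqVlt => /predU1P[<-|t0].
    have [_ Z0 _ _ _] := lZ; have m0 : measurable [set w | Z i 0 w < 0].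
      rewrite (_ : [set w | _] = Z i 0 @^-1` `]-oo, 0[%classic).
        by rewrite -[X in measurable X]setTI; apply: mZ.
      by apply/seteqP; split => w; rewrite /= in_itv/=.
    apply/negligibleP => //; apply: negligibleS Z0 => w /= Zw Z0; move: Zw; rewrite Z0 ltxx.
    by [].
  have -> : [set w | Z i t w < 0] = Z i t @^-1` `]-oo, 0[%classic.
    by apply/seteqP; split => w; rewrite /= in_itv/=.
  rewrite law// (_ : _ `&` _ = set0) ?integral_set0//.
  apply/seteqP; split => x //=; rewrite !in_itv/= andbT => -[x0 x0'].
  by move: (lt_trans x0 x0'); rewrite ltxx.
pose WZ i := s2val (hZ i).
exists (WB `&` [set w | forall i, WZ i w]).
  by apply: full_eventI => //; apply: full_event_forall => i; exact: s2valP (hZ i).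
move=> w [/= WBw WZw].
have Bmono s t : 0 <= s <= t -> (Bl s w <= Bl t w)%N.
  by move=> st; have /andP[_] := hB w WBw s t st; rewrite ler_nat.
have Zmono i s t : 0 <= s <= t -> 0 <= Z i s w <= Z i t w by exact: (s2valP' (hZ i)) (WZw i) s t.
have Gmono i s t : 0 <= s <= t -> 0 <= G i s w <= G i t w.
  move=> /andP[s0 st]; rewrite /G /gamma_subordinator; apply: Zmono.
  rewrite time_ge0//= lerD// ler_pM2l ?invr_gt0// ler_nat Bmono// s0//.
split=> // i A t t0 At AGt.
have [[_ _ _ _ cB] _] := B_nb.
have Bright := nat_cadlag_right (cB w) t0.
have [[_ _ _ _ cZ] _] := Z_gamma i.
have tb0 := time_ge0 (Bl t w) t0.
have [cr _] := cZ w (t + lambda^-1 * (Bl t w)%:R) tb0.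
have At' : \forall s \near G i t w, G i t w <= s -> A s.
  have At2 : \forall s \near G i t w, G i t w < s -> A s := At.
  by apply: filterS At2 => s h; rewrite le_eqVlt => /predU1P[<-//|]; exact: h.
(* Just after t the clock stays at [Bl t w], so [G i] is there [Z i] at a shifted time and right
   continuity of [Z i] applies. *)
have h1 : \forall s \near (t + lambda^-1 * (Bl t w)%:R)^'+, Z i (t + lambda^-1 * (Bl t w)%:R) w <= Z i s w -> A (Z i s w).
  exact: cr At'.
have h2 : \forall s \near t^'+, Z i (t + lambda^-1 * (Bl t w)%:R) w <= Z i (s + lambda^-1 * (Bl t w)%:R) w -> A (Z i (s + lambda^-1 * (Bl t w)%:R) w).
  have cs : s + lambda^-1 * (Bl t w)%:R @[s --> t] --> t + lambda^-1 * (Bl t w)%:R.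
    by apply: cvgD; [exact: cvg_id|exact: cvg_cst].
  pose c := lambda^-1 * (Bl t w)%:R.
  have h1' : \forall s \near t, t + c < s + c -> Z i (t + c) w <= Z i (s + c) w -> A (Z i (s + c) w).
    exact: cs h1.
  have h2' : \forall s \near t, t < s -> Z i (t + c) w <= Z i (s + c) w -> A (Z i (s + c) w).
    by apply: filterS h1' => s h ts; apply: h; rewrite ltrD2r.
  exact: h2'.
near=> s.
have ts : t < s by near: s; exact: nbhs_right_gt.
have Bs : Bl s w = Bl t w by near: s.
have h : Z i (t + lambda^-1 * (Bl t w)%:R) w <= Z i (s + lambda^-1 * (Bl t w)%:R) w -> A (Z i (s + lambda^-1 * (Bl t w)%:R) w).
  by near: s.
have := Gmono i t s; rewrite /G /gamma_subordinator -/(Bl s w) -/(Bl t w) Bs.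
by move=> /(_ _)/andP[|_]; [rewrite t0 ltW|exact: h].
Unshelve. all: end_near. Qed.

Let Y i s u w := Z i (s + u) w - Z i s w.

Let integral_Y i s u (f : R -> R) : 0 <= s -> 0 <= u -> measurable_fun setT f -> (forall x, 0 <= f x) ->
  (\int[P]_w (f (Y i s u w))%:E = \int[P]_w (f (Z i u w))%:E)%E.
Proof.
move=> s0 u0 mf f0.
have mY : measurable_fun setT (Y i s u) by apply: measurable_funB; apply: mZ => //; exact: addr_ge0.
have := @eq_integral_comp _ _ _ T T R R P P (Y i s u) (Z i u) (cst 1) (cst 1) f mY (mZ i u0) _ _ _ _ _ mf f0.
move=> H.
transitivity (\int[P]_w (f (Y i s u w) * cst 1 w)%:E)%E.
  by apply: eq_integral => w _; rewrite mulr1.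
rewrite H//.
  by apply: eq_integral => w _; rewrite mulr1.
move=> A mA.
have [[_ _ [_ st] _ _] _] := Z_gamma i.
have m1 : measurable (Y i s u @^-1` A) by rewrite -[X in measurable X]setTI; exact: mY.
have m2 : measurable (Z i u @^-1` A) by rewrite -[X in measurable X]setTI; exact: mZ.
under eq_integral do rewrite mulr1.
under [RHS]eq_integral do rewrite mulr1.
rewrite (integral_indicT P m1) (integral_indicT P m2).
exact: st.
Qed.

Section mixture.
Variables (f : 'I_q -> R -> R) (t h : R).
Hypotheses (mf : forall i, measurable_fun setT (f i)) (f01 : forall i x, 0 <= f i x <= 1).
Hypotheses (t0 : 0 <= t) (h0 : 0 <= h).

(** On this event both random times are deterministic, and the increment of [G i] is that of [Z i]
    over a time h + c / lambda, whose law does not depend on b. *)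
Let D c b := [set w | Bl t w = b] `&` [set w | Bl (t + h) w = (b + c)%N].
Let th0 : 0 <= t + h. Proof. exact: addr_ge0. Qed.

Let SD c b : SB (D c b).
Proof.
have := @sigma_algebra_forall _ T SB bool (fun x => if x then [set w | Bl t w = b] else [set w | Bl (t + h) w = (b + c)%N]).
move=> /(_ _ _ _)H.
rewrite (_ : D c b = [set w | forall x : bool, (if x then [set w | Bl t w = b] else [set w | Bl (t + h) w = (b + c)%N]) w]).
  apply: H; first exact: sigma_algebra_process_sigma.
  by case; exact: SB_event.
by apply/seteqP; split => w /=; [move=> [? ?] []|move=> /[dup] /(_ true) ? /(_ false)].
Qed.

Let mD c b : measurable (D c b). Proof. by apply: SB_measurable; exact: SD. Qed.

Let F w := \prod_(i < q) f i (G i (t + h) w - G i t w).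

Let mF : measurable_fun setT F.
Proof.
apply: measurable_prod => i _; apply: (measurableT_comp (mf i)).
by apply: measurable_funB; exact: measurable_subordinator.
Qed.

Let F0 w : 0 <= F w. Proof. by apply: prodr_ge0 => i _; case/andP: (f01 i (G i (t + h) w - G i t w)). Qed.

Let val c := \prod_(i < q) fine (\int[P]_w (f i (Z i (h + lambda^-1 * c%:R) w))%:E)%E.

Let integral_D c b : (\int[P]_(w in D c b) (F w)%:E = P (D c b) * (val c)%:E)%E.
Proof.
pose s := t + lambda^-1 * b%:R; pose u := h + lambda^-1 * c%:R.
have s0 : 0 <= s by exact: time_ge0.
have u0 : 0 <= u by exact: time_ge0.
transitivity (\int[P]_w (\1_(D c b) w * \prod_(i < q) f i (Y i s u w))%:E)%E.
  rewrite integral_mkcond; apply: eq_integral => w _; rewrite patchE indicE.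
  case: ifPn => [|_]; last by rewrite mul0r.
  rewrite inE mul1r => -[/= Bt Bth]; congr EFin; apply: eq_bigr => i _.
  rewrite /Y /G /gamma_subordinator -/(Bl t w) -/(Bl (t + h) w) Bt Bth /s /u natrD mulrDr.
  by congr (f i (Z i _ w - _)); ring.
rewrite (@integral_prod_indep _ _ _ P q (fun i => Y i s u) f)//; last 2 first.
- by move=> i; apply: measurable_funB; apply: mZ => //; exact: addr_ge0.
- move=> A mA.
  have ZE i : process_sigma (fun _ : unit => Z i) [set w | A i (Y i s u w)].
    by apply: (@process_sigma_increment _ _ _ _ (fun _ : unit => Z i) tt s (s + u) (A i)) => //; exact: addr_ge0.
  have ZA : process_sigma Z [set w | forall i, A i (Y i s u w)].
    apply: sigma_algebra_forall; first exact: sigma_algebra_process_sigma.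
    by move=> i; apply: process_sigma_unit (ZE i).
  have mA' : measurable [set w | forall i, A i (Y i s u w)].
    by apply: (process_sigma_sub mZ).
  rewrite setIC (ZB_indep ZA (SD c b)) muleC [RHS]EFinM; congr (_ * _)%E.
    by rewrite fineK//; exact: fin_num_measure.
  apply: etrans _ (congr1 EFin (Z_indep ZE)).
  by rewrite fineK//; exact: fin_num_measure.
rewrite [LHS]EFinM; congr (_ * _)%E.
  by rewrite fineK//; exact: fin_num_measure.
congr EFin; apply: eq_bigr => i _.
by rewrite integral_Y// => x; case/andP: (f01 i x).
Qed.

Lemma subordinator_increment_mixture :
  (\int[P]_w (F w)%:E = \sum_(c <oo) (nb_pmf (lambda * h) c * val c)%:E)%E.
Proof.
(* The clock gains c over the step: by stationarity this has probability
   [nb_pmf theta (lambda * h) c], and these events have a union of probability one because the clock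
   is almost surely nondecreasing. *)
pose C c := \bigcup_b D c b.
have mC c : measurable (C c) by apply: bigcup_measurable => b _; exact: mD.
have mFE X : measurable_fun X (EFin \o F) by apply/measurable_EFinP; exact: measurable_funTS.
have tD c : trivIset setT (D c).
  by apply/trivIsetP => i j _ _ ij; apply/seteqP; split => w //= [[/= ei _] [/= ej _]]; move: ij; rewrite -ei -ej eqxx.
have tC : trivIset setT C.
  apply/trivIsetP => i j _ _ ij; apply/seteqP; split => w //= [[b _ [/= <- e1]] [b' _ [/= <- e2]]].
  by move: ij; rewrite e1 in e2; move/addnI: e2 => ->; rewrite eqxx.
have PC c : P (C c) = (nb_pmf (lambda * h) c)%:E.
  rewrite -nb_pmfE//; have [[_ _ [_ st] _ _] _] := B_nb.
  have := st t h [set c%:R] t0 h0 (measurable_set1 _).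
  have -> : [set w | [set c%:R : R] (Bl h w)%:R] = [set w | Bl h w = c].
    by apply/seteqP; split => w /= => [/eqP|->//]; rewrite eqr_nat => /eqP.
  move=> <-; congr (P _); apply/seteqP; split => w /=.
    by move=> [b _ [/= Bt]]; rewrite /Bl in Bt * => ->; rewrite Bt natrD addrAC subrr add0r.
  move=> e; exists (Bl t w) => //; split => //=.
  by apply/eqP; rewrite -(eqr_nat R) natrD -e /Bl addrCA subrr addr0.
have [W fW hW] := subordinator_paths.
have WC : W `<=` \bigcup_c C c.
  move=> w Ww; have [_ Bm _] := hW w Ww.
  exists (Bl (t + h) w - Bl t w)%N => //; exists (Bl t w) => //; split => //=.
  by rewrite subnKC// Bm// t0 lerDl.
have mUC : measurable (\bigcup_c C c) by exact: bigcup_measurable.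
have [_ PUC] : full_event P (\bigcup_c C c) by exact: full_event_subset fW mUC WC.
rewrite (@ge0_negligible_integral _ _ _ _ _ (~` \bigcup_c C c))//; last 3 first.
- exact: measurableC.
- by move=> w _; rewrite lee_fin.
- by apply: etrans (probability_setC P mUC) _; rewrite PUC subee.
rewrite setTD setCK ge0_integral_bigcup//; last by move=> w _; rewrite lee_fin.
apply: eq_eseriesr => c _.
rewrite ge0_integral_bigcup//; last by move=> w _; rewrite lee_fin.
under eq_eseriesr do rewrite integral_D.
under eq_eseriesr do rewrite muleC.
rewrite nneseriesZl// muleC EFinM; congr (_ * _)%E.
by apply: etrans (esym _) (PC c); apply: measure_semi_bigcup => //; exact: mC.
Qed.

End mixture.
End subordinator.

(** * Increments of the time-changed process *)

Section increment_law.
Context (R : realType) (d : measure_display) (T : measurableType d) (P : probability T R).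
Context (q : nat) (k : 'I_q -> nat) (lam : forall i : 'I_q, 'I_(k i) -> R).
Context (lambda theta : R) (a : 'I_q -> R).
Context (M : 'I_q -> R -> T -> nat) (Z : 'I_q -> R -> T -> R) (B : R -> T -> nat).
Arguments lam : clear implicits.
Hypotheses (lam0 : forall i j, 0 <= lam i j) (lambda0 : 0 < lambda) (theta01 : 0 < theta < 1).
Hypothesis a0 : forall i, 0 < a i.
Hypothesis M_gcp : forall i, gcp P (lam i) (M i).
Hypothesis M_indep : independent_processes P (fun i t w => (M i t w)%:R).
Hypothesis Z_gamma : forall i, gamma_process P lambda (a i) (Z i).
Hypothesis Z_indep : independent_processes P Z.
Hypothesis B_nb : negative_binomial_process P lambda theta B.
Hypothesis ZB_indep : sigma_independent P (process_sigma Z)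
  (process_sigma (fun (_ : unit) t w => (B (lambda * t) w)%:R)).
Let G := gamma_subordinator lambda Z B.
Hypothesis MG_indep : sigma_independent P
  (process_sigma (fun i t w => (M i t w)%:R)) (process_sigma G).

Let x i t w := M i (G i t w) w.

Let mM i t : 0 <= t -> measurable_fun setT (fun w => (M i t w)%:R : R).
Proof. by move=> t0; have [[mM _ _ _ _] _] := M_gcp i; exact: mM. Qed.

Lemma gcp_paths i : exists2 W, full_event P W & forall w, W w ->
  (forall s t, 0 <= s <= t -> (M i s w <= M i t w)%N) /\
  (forall t, 0 <= t -> \forall s \near t^'+, M i s w = M i t w).
Proof.
have [lM _] := M_gcp i; have [_ _ _ _ cM] := lM.
have [|W fW hW] := levy_nondecreasing lM.
  move=> t t0; rewrite (_ : [set _ | _] = set0) ?measure0// -subset0 => w /=.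
  by rewrite ltNge ler0n.
exists W => // w Ww; split=> [s t st|t t0].
  by have /andP[_] := hW w Ww s t st; rewrite ler_nat.
exact: (nat_cadlag_right (cM w)).
Qed.

Lemma time_changed_paths : exists2 W, full_event P W & forall w, W w ->
  [/\ forall i s t, 0 <= s <= t -> 0 <= G i s w <= G i t w,
      forall i t, 0 <= t -> \forall s \near t^'+, M i s w = M i t w,
      forall i s t, 0 <= s <= t -> (x i s w <= x i t w)%N
    & forall i t, 0 <= t -> \forall s \near t^'+, x i s w = x i t w].
Proof.
have [W0 fW0 hW0] := subordinator_paths lambda0 Z_gamma B_nb.
have /choice[W fW] : forall i, exists W, full_event P W /\ forall w, W w ->
  (forall s t, 0 <= s <= t -> (M i s w <= M i t w)%N) /\
  (forall t, 0 <= t -> \forall s \near t^'+, M i s w = M i t w).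
  by move=> i; have [W fW hW] := gcp_paths i; exists W.
exists (W0 `&` [set w | forall i, W i w]).
  apply: full_eventI => //; apply: full_event_forall => i; exact: (fW i).1.
move=> w [/hW0[Gw Bw Gr] Ww].
have Mw i := (fW i).2 w (Ww i).
split=> // [i t t0|i s t st|i t t0]; first exact: (Mw i).2.
  by apply: (Mw i).1; exact: Gw.
have /andP[Gt0 _] : 0 <= G i t w <= G i t w by apply: Gw; rewrite t0 lexx.
(* [M i] is constant just to the right of [G i t w], and this property is carried over to times just
   to the right of t. *)
apply: (Gr i [set s | M i s w = M i (G i t w) w]) => //.
exact: (Mw i).2.
Qed.

Let pE (v : 'I_q -> nat) (s t : 'I_q -> R) : (forall i, 0 <= s i <= t i) ->
  P [set w | forall i, (M i (t i) w)%:R - (M i (s i) w)%:R = (v i)%:R :> R] =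
  (\prod_(i < q) gcp_pmf (lam i) (t i - s i) (v i))%:E.
Proof.
move=> st.
pose D i := [set w | (M i (t i) w)%:R - (M i (s i) w)%:R = (v i)%:R :> R].
have s0 i : 0 <= s i by have /andP[] := st i.
have t0 i : 0 <= t i by have /andP[s0' /(le_trans s0')] := st i.
have ts0 i : 0 <= t i - s i by rewrite subr_ge0; have /andP[] := st i.
have SD i : process_sigma (fun _ : unit => (fun t w => (M i t w)%:R : R)) (D i).
  exact: (@process_sigma_increment _ _ _ _ (fun _ : unit => (fun t w => (M i t w)%:R : R)) tt _ _
    [set (v i)%:R]).
have mD i : measurable (D i).
  by apply: (process_sigma_sub _ (SD i)) => _ u u0; exact: mM.
have PD i : P (D i) = (gcp_pmf (lam i) (t i - s i) (v i))%:E.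
  have [[_ _ [_ sM] _ _] _] := M_gcp i.
  have := sM (s i) (t i - s i) [set (v i)%:R] (s0 i) (ts0 i) (measurable_set1 _).
  rewrite addrC subrK => ->; rewrite -(gcp_law (@lam0 i) (M_gcp i))//.
  congr (P _); apply/seteqP; split => w /= => [/eqP|->//].
  by rewrite eqr_nat => /eqP.
have := congr1 EFin (@M_indep D SD); rewrite fineK; last first.
  apply: fin_num_measure; rewrite (_ : [set _ | _] = \bigcap_i (D i)).
    by apply: fin_bigcap_measurable => //; exact: finite_finset.
  by apply/seteqP; split => w /= h i; [move=> _|]; exact: h.
by move=> ->; congr EFin; apply: eq_bigr => i _; rewrite PD.
Qed.

Section law.
Variables (W : set T) (v : 'I_q -> nat) (t h : R).
Hypotheses (fW : full_event P W) (t0 : 0 <= t) (h0 : 0 < h).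
Hypothesis WG : forall w, W w -> forall i s t, 0 <= s <= t -> 0 <= G i s w <= G i t w.
Hypothesis WM : forall w, W w -> forall i t, 0 <= t -> \forall s \near t^'+, M i s w = M i t w.

Let E := [set w | forall i, (x i (t + h) w)%:R - (x i t w)%:R = (v i)%:R :> R].

Let th0 : 0 <= t + h. Proof. by rewrite addr_ge0// ltW. Qed.

Let GS i s A : 0 <= s -> measurable A -> process_sigma G (G i s @^-1` A).
Proof. by move=> s0 mA; exact: process_sigma_preimage. Qed.

Let GW w : W w -> forall i, 0 <= G i t w <= G i (t + h) w.
Proof. by move=> Ww i; apply: WG => //; rewrite t0 lerDl ltW. Qed.

Let Nr w : W w -> forall i s, 0 <= s -> \forall r \near s^'+, (M i r w)%:R = (M i s w)%:R :> R.
Proof. by move=> Ww i s s0; apply: filterS (WM Ww i s0) => r ->. Qed.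

Lemma increment_measurable : measurable (W `&` E).
Proof.
apply: (@time_mixing_measurable _ _ _ _ (fun i t w => (M i t w)%:R) (G ^~ t) (G ^~ (t + h))
  (process_sigma G)) => //.
- exact: sigma_algebra_process_sigma.
- by apply: process_sigma_sub => i s s0; exact: (measurable_subordinator lambda0 Z_gamma B_nb).
- by move=> i A; exact: GS.
- by move=> i A; exact: GS.
- exact: fW.1.
Qed.

(** Two successive conditionings: [time_mixing] replaces [M] by its point probabilities at the
    increments of [G], then [subordinator_increment_mixture] conditions on the clock. The result is
    free of t, so all dyadic cells are alike. *)
Lemma increment_law : P (W `&` E) = (\sum_(0 <= c <oo)
  (nb_pmf theta (lambda * h) c *
   \prod_(i < q) gamma_mix (lam i) (a i) (lambda * h + c%:R) (v i))%:E)%E.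
Proof.
have := @time_mixing _ _ _ P _ (fun i t w => (M i t w)%:R) (G ^~ t) (G ^~ (t + h))
  (process_sigma G) W mM _ _ _ _ MG_indep fW.1 fW.2 GW Nr
  (fun i s => gcp_pmf (lam i) s (v i)) (fun i => (v i)%:R) _ (@pE v).
rewrite -/E => ->.
- rewrite (subordinator_increment_mixture lambda0 Z_gamma Z_indep B_nb ZB_indep
    (f := fun i s => gcp_pmf (lam i) `|s| (v i)) _ _ t0 (ltW h0)).
  + apply: eq_eseriesr => c _; congr (_ * _)%:E; apply: eq_bigr => i _.
    rewrite (gamma_process_gcp_pmf lambda0 (a0 i) (Z_gamma i))//.
      (* The time h + c / lambda corresponds to the shape lambda h + c. *)
      by rewrite mulrDr mulVKf// gt_eqF.
    by rewrite ltr_wpDr// mulr_ge0// invr_ge0 ltW.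
  + move=> i; apply: continuous_measurable_fun => s.
    apply: (@continuous_cvg _ _ _ _ _ (fun y : R => `|y|) (fun y : R => gcp_pmf (lam i) y (v i))).
      exact: continuous_gcp_pmf.
    exact: norm_continuous.
  + by move=> i s; rewrite gcp_pmf_ge0// gcp_pmf_le1.
- exact: sigma_algebra_process_sigma.
- by apply: process_sigma_sub => i s s0; exact: (measurable_subordinator lambda0 Z_gamma B_nb).
- by move=> i A; exact: GS.
- by move=> i A; exact: GS.
- by move=> i; exact: continuous_gcp_pmf.
Qed.

End law.
End increment_law.

(** * Small time asymptotics *)

Lemma cvg_real_EFin (R : realType) (I : Type) (F : set_system I) (f : I -> R) (l : R) : Filter F ->
  f x @[x --> F] --> l -> (f x)%:E @[x --> F] --> l%:E.
Proof.
by move=> FF fl; apply: (@cvg_EFin _ _ _ _ (EFin \o f)) => //; exact: nearW.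
Qed.

Section pochhammer_limits.
Context {R : realType}.

Lemma pochhammerSl (x : R) n : pochhammer x n.+1 = x * pochhammer (x + 1) n.
Proof.
rewrite /pochhammer big_ord_recl addr0; congr (_ * _); apply: eq_bigr => l _.
by rewrite /bump/= -natr1 -addrA (addrC 1).
Qed.

Lemma pochhammer_ge0 (x : R) n : 0 <= x -> 0 <= pochhammer x n.
Proof. by move=> x0; apply: prodr_ge0 => l _; rewrite addr_ge0. Qed.

Lemma pochhammer1 n : pochhammer 1 n = n`!%:R :> R.
Proof.
elim: n => [|n IH]; first by rewrite /pochhammer big_ord0.
by rewrite pochhammerS IH factS natrM mulrC -natr1 addrC.
Qed.

Lemma continuous_pochhammer n : continuous (fun x : R => pochhammer x n).
Proof.
move=> x; apply: cvg_big => [|l _]; first exact: mul_continuous.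
by apply: cvgD; [exact: cvg_id|exact: cvg_cst].
Qed.

Lemma continuous_powR_exponent (b : R) : 0 < b -> continuous (fun x => b `^ x).
Proof.
move=> b0 x; rewrite /powR gt_eqF//.
apply: continuous_comp; last exact: continuous_expR.
exact: mulrr_continuous.
Qed.

End pochhammer_limits.

Section gamma_mix_limits.
Context {R : realType} (k : nat) (lam : 'I_k -> R) (a : R).
Hypotheses (lam0 : forall j, 0 <= lam j) (a0 : 0 < a).
Let Lam := \sum_(j < k) lam j.

Let base0 : 0 < a / (a + Lam).
Proof. by rewrite divr_gt0// ltr_wpDr// sumr_ge0. Qed.

Let ratio0 n (m : {ffun 'I_k -> 'I_n.+1}) :
  0 <= \prod_(j < k) ((lam j / (a + Lam)) ^+ m j / (m j)`!%:R).
Proof.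
apply: prodr_ge0 => j _; rewrite divr_ge0// exprn_ge0// divr_ge0//.
by rewrite addr_ge0 ?sumr_ge0// ltW.
Qed.

Lemma gamma_mix_ge0 s n : 0 <= s -> 0 <= gamma_mix lam a s n.
Proof.
move=> s0; rewrite mulr_ge0 ?powR_ge0// sumr_ge0// => m _.
by rewrite mulr_ge0// pochhammer_ge0.
Qed.

Lemma continuous_gamma_mix n : continuous (gamma_mix lam a ^~ n).
Proof.
move=> s; apply: cvgM; first exact: continuous_powR_exponent.
apply: cvg_big => [|m _]; first exact: add_continuous.
by apply: cvgM; [exact: continuous_pochhammer|exact: cvg_cst].
Qed.

(** A nonzero total needs at least one jump, and this provides the factor s in
    [pochhammer s (etan m)] that division by s cancels. *)
Lemma Omega_etan_gt0 n (m : {ffun 'I_k -> 'I_n.+1}) :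
  n != 0 -> m \in Omega k n -> (0 < etan m)%N.
Proof.
move=> n0; rewrite inE lt0n; apply: contraTneq => /eqP.
rewrite sum_nat_eq0 => /forallP m0; rewrite big1 1?eq_sym// => j _.
by rewrite (eqP (implyP (m0 j) isT)) muln0.
Qed.

Lemma gamma_mixn0 s : gamma_mix lam a s 0 = (a / (a + Lam)) `^ s.
Proof.
have m0 (m : {ffun 'I_k -> 'I_1}) j : (m j = 0 :> nat) by case: (m j) => -[].
rewrite /gamma_mix (big_pred1 [ffun=> ord0]) => [|m]; last first.
  transitivity true; last by apply/esym/eqP/ffunP => j; rewrite ord1 [RHS]ord1.
  by rewrite inE big1// => j _; rewrite m0 muln0.
rewrite (_ : etan _ = 0) ?/pochhammer ?big_ord0 ?mul1r; last first.
  by rewrite /etan big1// => j _; rewrite m0.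
by rewrite [\prod_(j < k) _]big1 ?mulr1// => j _; rewrite m0 expr0 fact0 divr1.
Qed.

Lemma gamma_mix0 n : gamma_mix lam a 0 n = (n == 0)%:R.
Proof.
have [->|n0] := eqVneq n 0; first by rewrite gamma_mixn0 powRr0.
rewrite /gamma_mix powRr0 mul1r.
rewrite big1// => m mO; have := Omega_etan_gt0 n0 mO.
by case: (etan m) => // e _; rewrite pochhammerSl !mul0r.
Qed.

Lemma gamma_mix_small_time n (x : nat -> R) : n != 0 -> (forall l, x l != 0) ->
  x @ \oo --> 0 -> gamma_mix lam a (x l) n / x l @[l --> \oo] -->
  \sum_(m in Omega k n) Gamma (etan m)%:R *
    \prod_(j < k) ((lam j / (a + Lam)) ^+ m j / (m j)`!%:R).
Proof.
move=> n0 x0 cx.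
have e l : gamma_mix lam a (x l) n / x l = (a / (a + Lam)) `^ (x l) *
   \sum_(m in Omega k n) pochhammer (x l + 1) (etan m).-1 *
    \prod_(j < k) ((lam j / (a + Lam)) ^+ m j / (m j)`!%:R).
  rewrite /gamma_mix -mulrA; congr (_ * _); rewrite mulr_suml; apply: eq_bigr => m mO.
  rewrite -(prednK (Omega_etan_gt0 n0 mO)) pochhammerSl/=.
  by rewrite -(mulrA (x l)) mulrC mulKf.
rewrite (funext e).
rewrite -[X in _ --> X]mul1r; apply: cvgM.
  rewrite -[X in _ --> X](powRr0 (a / (a + Lam))).
  apply: (@continuous_cvg _ _ _ _ _ x (fun y => (a / (a + Lam)) `^ y)) => //.
  exact: continuous_powR_exponent.
under [X in _ --> X]eq_bigr => m mO.
  rewrite -(prednK (Omega_etan_gt0 n0 mO)) Gamma_nat -pochhammer1.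
  over.
apply: cvg_big => [|m mO]; first exact: add_continuous.
apply: cvgM; last exact: cvg_cst.
apply: (@continuous_cvg _ _ _ _ _ (fun l => x l + 1) (fun y : R => pochhammer y _)).
  exact: continuous_pochhammer.
by rewrite -[X in _ --> X]add0r; apply: cvgD => //; exact: cvg_cst.
Qed.

End gamma_mix_limits.

Section small_time.
Context {R : realType} (q : nat) (theta : R) (g : 'I_q -> R -> R) (z : pred 'I_q) (kappa : 'I_q -> R).
Hypothesis theta01 : 0 < theta < 1.
Hypothesis cg : forall i, continuous (g i).
Hypothesis g01 : forall i s, 0 < s -> 0 <= g i s <= 1.
Hypothesis g0 : forall i, g i 0 = (z i)%:R.
Variable x : nat -> R.
Hypotheses (x01 : forall n, 0 < x n <= 1) (cx : x @ \oo --> 0).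
Hypothesis gk : forall i, ~~ z i -> g i (x n) / x n @[n --> \oo] --> kappa i.
Hypothesis nz : exists i, ~~ z i.

(** Read [g i s] as the probability that component i moves by its prescribed amount in a gamma time
    of shape s; [z] marks the components prescribed not to move, and [kappa] gives the rates of the
    others. *)
Let F s c := nb_pmf theta s c * \prod_(i < q) g i (s + c%:R).

Let x0 n : 0 < x n. Proof. by have /andP[] := x01 n. Qed.
Let x1 n : x n <= 1. Proof. by have /andP[] := x01 n. Qed.
Let th0 : 0 < theta. Proof. by have /andP[] := theta01. Qed.
Let th1 : 0 < 1 - theta. Proof. by rewrite subr_gt0; have /andP[] := theta01. Qed.

Let prod01 s : 0 < s -> 0 <= \prod_(i < q) g i s <= 1.
Proof.
move=> s0; rewrite prodr_ge0/=; last by move=> i _; have /andP[] := g01 i s0.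
by apply: prodr_ile1 => i _; exact: g01.
Qed.

Let nbS s c : s != 0 -> s^-1 * nb_pmf theta s c.+1 =
  (1 - theta) `^ s * (pochhammer (s + 1) c / c.+1`!%:R) * theta ^+ c.+1.
Proof.
by move=> s0; rewrite /nb_pmf pochhammerSl -(mulrA s) [_ `^ s * (s * _)]mulrCA -[s * _ * _]mulrA mulKf.
Qed.

Let nb0 s c : 0 <= s -> 0 <= nb_pmf theta s c.
Proof.
by move=> s0; rewrite !mulr_ge0 ?powR_ge0 ?pochhammer_ge0 ?invr_ge0 ?exprn_ge0 ?(ltW th0).
Qed.

Let F0 s c : 0 < s -> 0 <= F s c.
Proof.
move=> s0; apply: mulr_ge0; first by rewrite nb0// ltW.
by have /andP[] := @prod01 (s + c%:R) (ltr_wpDr (ler0n _ _) s0).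
Qed.

Let FS n c := (x n)^-1 * F (x n) c.+1.

(** Since x <= 1, the quotient (x)_(c+1) / x = (x+1)_c is at most (2)_c = (c+1)!, which leaves a
    geometric bound independent of n. *)
Let nbS_le n c : (x n)^-1 * nb_pmf theta (x n) c.+1 <= theta ^+ c.
Proof.
rewrite nbS ?gt_eqF// exprS mulrA; apply: ler_piMl; first by rewrite exprn_ge0// ltW.
have p0 : 0 <= pochhammer (x n + 1) c / c.+1`!%:R.
  by rewrite divr_ge0// pochhammer_ge0// addr_ge0// ltW.
have b01 : 0 <= (1 - theta) `^ x n * (pochhammer (x n + 1) c / c.+1`!%:R) <= 1.
  rewrite mulr_ge0 ?powR_ge0//= mulr_ile1 ?powR_ge0//.
    rewrite -[leRHS](powRr0 (1 - theta)); apply: ger_powR; last exact/ltW.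
    by rewrite th1 gerBl ltW.
  rewrite ler_pdivrMr ?ltr0n ?fact_gt0// mul1r -[leRHS]pochhammer1 pochhammerSl mul1r.
  apply: ler_prod => l _; apply/andP; split; first by rewrite !addr_ge0// ltW.
  by rewrite !lerD2r.
have /andP[b0 b1] := b01; have /andP[_ /ltW t1] := theta01.
by rewrite mulr_ile1// ltW.
Qed.

Let FS0 n c : 0 <= FS n c.
Proof. by rewrite mulr_ge0 ?invr_ge0 ?F0// ltW. Qed.

Let FS_le n c : FS n c <= theta ^+ c.
Proof.
rewrite /FS /F mulrA; apply: le_trans (nbS_le n c); apply: ler_piMr.
  by rewrite mulr_ge0 ?invr_ge0 ?nb0// ltW.
by have /andP[] := @prod01 (x n + c.+1%:R) (ltr_wpDr (ler0n _ _) (x0 n)).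
Qed.

Let LS c := theta ^+ c.+1 / c.+1%:R * \prod_(i < q) g i c.+1%:R.

Let cvg_pow : (1 - theta) `^ (x n) @[n --> \oo] --> (1 : R).
Proof.
rewrite -[X in _ --> X](powRr0 (1 - theta)).
apply: (@continuous_cvg _ _ _ _ _ x (fun s => (1 - theta) `^ s)) => //.
exact: continuous_powR_exponent.
Qed.

Let cvg_FS c : FS n c @[n --> \oo] --> LS c.
Proof.
have e n : FS n c = (1 - theta) `^ x n * (pochhammer (x n + 1) c / c.+1`!%:R) * theta ^+ c.+1 *
    \prod_(i < q) g i (x n + c.+1%:R).
  by rewrite /FS /F [LHS]mulrA nbS ?gt_eqF.
rewrite (funext e).
apply: cvgM.
  rewrite /LS [theta ^+ _ / _]mulrC; apply: cvgM; last exact: cvg_cst.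
  rewrite -[X in _ --> X]mul1r; apply: cvgM; first exact: cvg_pow.
  have -> : c.+1%:R^-1 = pochhammer 1 c / c.+1`!%:R :> R.
    by rewrite pochhammer1 factS natrM invfM mulrC divfK// pnatr_eq0 -lt0n fact_gt0.
  apply: cvgM; last exact: cvg_cst.
  apply: (@continuous_cvg _ _ _ _ _ (fun n => x n + 1) (fun y : R => pochhammer y c)).
    exact: continuous_pochhammer.
  by rewrite -[X in _ --> X]add0r; apply: cvgD => //; exact: cvg_cst.
apply: cvg_big => [|i _]; first exact: mul_continuous.
apply: (@continuous_cvg _ _ _ _ _ (fun n => x n + c.+1%:R) (g i)); first exact: cg.
by rewrite -[X in _ --> X]add0r; apply: cvgD => //; exact: cvg_cst.
Qed.

Let cvg_F0 : (x n)^-1 * F (x n) 0 @[n --> \oo] -->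
  \sum_(i < q) (~~ z i)%:R * kappa i * \prod_(l < q | l != i) (z l)%:R.
Proof.
have [i0 zi0] := nz.
(* Every other summand contains the factor of [z i0], which is 0; the summand of [i0] itself
   survives only if [i0] is the single moving component. *)
rewrite (bigD1 i0)//= zi0 mul1r [X in _ + X]big1 ?addr0 => [|i ii0]; last first.
  by rewrite [X in _ * X](bigD1 i0) 1?eq_sym//= (negbTE zi0) mul0r mulr0.
have e n : (x n)^-1 * F (x n) 0 = nb_pmf theta (x n) 0 *
  ((g i0 (x n) / x n) * \prod_(l < q | l != i0) g l (x n)).
  rewrite /F (bigD1 i0)//= addr0 mulrCA; congr (_ * _).
  by rewrite mulrA [_^-1 * _]mulrC.
rewrite (funext e).
rewrite -[X in _ --> X]mul1r; apply: cvgM.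
  have e0 n : nb_pmf theta (x n) 0 = (1 - theta) `^ x n.
    by rewrite /nb_pmf /pochhammer big_ord0 fact0 divr1 !mulr1.
  by rewrite (funext e0); exact: cvg_pow.
apply: cvgM; first exact: gk.
apply: cvg_big => [|l _]; first exact: mul_continuous.
by rewrite -g0; apply: (@continuous_cvg _ _ _ _ _ x (g l)) => //; exact: cg.
Qed.

Let geom : (\sum_(0 <= c <oo) (theta ^+ c)%:E < +oo)%E.
Proof.
have h : series (geometric 1 theta) n @[n --> \oo] --> 1 * (1 - theta)^-1.
  by apply: cvg_geometric_series; rewrite ger0_norm ?ltW//; have /andP[] := theta01.
suff -> : (\sum_(0 <= c <oo) (theta ^+ c)%:E = (1 * (1 - theta)^-1)%:E)%E by rewrite ltry.
apply: cvg_lim => //; apply: cvg_trans (cvg_real_EFin _ h).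
rewrite (_ : (fun n => _) = EFin \o series (geometric 1 theta))//.
by apply/funext => n /=; rewrite sumEFin; congr EFin; apply: eq_bigr => c _ /=; rewrite mul1r.
Qed.

(** The term c = 0 is treated apart; the others form an integral against the counting measure, where
    the geometric bound allows dominated convergence. *)
Lemma small_time :
  ((x n)^-1%:E * \sum_(0 <= c <oo) (nb_pmf theta (x n) c * \prod_(i < q) g i (x n + c%:R))%:E)%E
    @[n --> \oo] -->
  ((\sum_(i < q) (~~ z i)%:R * kappa i * \prod_(l < q | l != i) (z l)%:R)%:E +
   \sum_(1 <= c <oo) (theta ^+ c / c%:R * \prod_(i < q) g i c%:R)%:E)%E.
Proof.
have e n : ((x n)^-1%:E * \sum_(0 <= c <oo) (F (x n) c)%:E =
  ((x n)^-1 * F (x n) 0)%:E + \int[counting]_c (FS n c)%:E)%E.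
  rewrite -nneseriesZl//; last by move=> c _; rewrite lee_fin F0.
  rewrite nneseries_recl//; last by move=> c _; rewrite -EFinM lee_fin mulr_ge0 ?invr_ge0 ?F0 ?ltW.
  rewrite EFinM; congr (_ + _)%E; rewrite ge0_integral_count; last by move=> c; rewrite lee_fin FS0.
  rewrite -(@nneseries_addn _ _ 1).
    by apply: eq_eseriesr => c _; rewrite addn1.
  by move=> c; rewrite -EFinM lee_fin mulr_ge0 ?invr_ge0 ?F0 ?ltW.
rewrite (funext e).
have LS0 c : 0 <= LS c.
  apply: mulr_ge0; first by rewrite divr_ge0// exprn_ge0// ltW.
  by have /andP[] := @prod01 c.+1%:R (ltr0Sn _ _).
have -> : (\sum_(1 <= c <oo) (theta ^+ c / c%:R * \prod_(i < q) g i c%:R)%:E =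
   \int[counting]_c (LS c)%:E)%E.
  rewrite ge0_integral_count//; rewrite -(@nneseries_addn _ _ 1).
    by apply: eq_eseriesr => c _; rewrite addn1.
  (* The shift of the series also asks for nonnegativity at index 0, where the term is 0 because
     0^-1 = 0. *)
  move=> [|c]; last exact: LS0.
  by rewrite invr0 mulr0 mul0r.
apply: cvgeD; first exact: fin_num_adde_defr.
  exact: cvg_real_EFin.
have [] := @dominated_convergence _ nat R counting setT measurableT (fun n c => (FS n c)%:E)
  (fun c => (LS c)%:E) (fun c => (theta ^+ c)%:E).
- by [].
- by [].
- by apply: aeW => c _; exact: cvg_real_EFin.
- apply/integrableP; split=> //.
  rewrite ge0_integral_count//; under eq_eseriesr do rewrite gee0_abs ?lee_fin ?exprn_ge0 ?ltW//.
  exact: geom.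
- by apply: aeW => c n _; rewrite gee0_abs lee_fin ?FS0 ?FS_le.
by [].
Qed.

End small_time.

(** * Expected number of jumps *)

Section countable_sums.
Context {R : realType} {J : countType}.

Let term (S : set J) (a : J -> \bar R) n : \bar R :=
  (if pickle_inv n is Some v then if v \in S then a v else 0 else 0)%E.

(** Indices outside the range of [pickle] contribute 0, so a sum over a countable type inherits
    measurability and exchange with the integral from series. *)
Lemma esum_nneseries (S : set J) (a : J -> \bar R) : (forall v, 0 <= a v)%E ->
  (\esum_(v in S) a v = \sum_(0 <= n <oo) term S a n)%E.
Proof.
move=> a0; have t0 n : (0 <= term S a n)%E.
  by rewrite /term; case: pickle_inv => // v; case: ifP.
rewrite nneseries_esumT// (esum_mkcond S).
have bij : set_bij setT (range (pickle : J -> nat)) (pickle : J -> nat).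
  by split=> // v v' _ _; exact: (pcan_inj pickleK_inv).
transitivity (\esum_(n in range (pickle : J -> nat)) term S a n)%E.
  rewrite (reindex_esum _ _ _ _ bij); apply: eq_esum => v _.
  by rewrite /term pickleK_inv.
rewrite esum_mkcond; apply: eq_esum => n _; case: ifPn => //; rewrite notin_setE => h.
rewrite /term; case: pickle_inv (@pickle_invK J n) => //= v vn.
by exfalso; apply: h; exists v.
Qed.

Context (d : measure_display) (T : measurableType d) (P : {measure set T -> \bar R}).
Variables (S : set J) (c : J -> T -> \bar R).
Hypotheses (mc : forall v, measurable_fun setT (c v)) (c0 : forall v w, (0 <= c v w)%E).

Let mterm n : measurable_fun setT (fun w => term S (c ^~ w) n).
Proof.
rewrite /term; case: pickle_inv => [v|]; last exact: measurable_cst.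
by case: (v \in S); [exact: mc|exact: measurable_cst].
Qed.

Let term0 n w : (0 <= term S (c ^~ w) n)%E.
Proof. by rewrite /term; case: pickle_inv => // v; case: ifP. Qed.

Lemma measurable_esum : measurable_fun setT (fun w => \esum_(v in S) c v w)%E.
Proof.
rewrite (funext (fun w => esum_nneseries S (c0 ^~ w))).
exact: ge0_emeasurable_sum.
Qed.

Lemma integral_esum :
  (\int[P]_w (\esum_(v in S) c v w) = \esum_(v in S) (\int[P]_w c v w))%E.
Proof.
rewrite (funext (fun w => esum_nneseries S (c0 ^~ w))).
rewrite integral_nneseries// esum_nneseries; last by move=> v; exact: integral_ge0.
apply: eq_eseriesr => n _; rewrite /term; case: pickle_inv => [v|]; last by rewrite integral0.
by case: ifP => // _; rewrite integral0.
Qed.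

End countable_sums.

Section integral_eq_full_event.
Import HBNNSimple.

(* [f] need not be measurable: the integral is then a supremum over simple functions. *)
Lemma integral_eq_full_event (R : realType) (d : measure_display) (T : measurableType d)
    (P : probability T R) (W : set T) (f g : T -> \bar R) :
  full_event P W -> measurable_fun setT g -> (forall w, 0 <= g w <= f w)%E ->
  (forall w, W w -> f w = g w) -> (\int[P]_w f w = \int[P]_w g w)%E.
Proof.
move=> [mW PW] mg gf fg.
have g0 w : (0 <= g w)%E by have /andP[] := gf w.
have f0 w : (0 <= f w)%E by have /andP[g0' /(le_trans g0')] := gf w.
apply/eqP; rewrite eq_le; apply/andP; split.
  rewrite [leLHS]ge0_integralTE// ge_ereal_sup// => _ [h hf <-].
  rewrite -integralT_nnsfun; apply: ae_ge0_le_integral => //.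
  - by move=> w _; rewrite lee_fin.
  - exact/measurable_EFinP.
  exists (~` W); split; [exact: measurableC|exact/(full_eventP P mW)|].
  move=> w /= h1 Ww; apply: h1 => _; rewrite -fg//; exact: hf.
rewrite [leLHS]ge0_integralTE// [leRHS]ge0_integralTE//.
apply: le_ereal_sup => _ [h hg <-]; exists h => // w; apply: le_trans (hg w) _.
by have /andP[] := gf w.
Qed.

End integral_eq_full_event.

Section dyadic_variation.
Context {R : realType} {V : eqType} (X : R -> V).

Definition moves n := (\sum_(k < 2 ^ n) (X (k.+1%:R / 2 ^+ n) != X (k%:R / 2 ^+ n)))%N.

(* Hence the limit of [moves] dominates all the dyadic counts of increments. *)
Lemma moves_nondecreasing n : (moves n <= moves n.+1)%N.
Proof.
have double m (f : nat -> nat) : (\sum_(j < m.*2) f j = \sum_(k < m) (f k.*2 + f k.*2.+1))%N.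
  elim: m => [|m IH]; first by rewrite !big_ord0.
  by rewrite doubleS !big_ord_recr/= IH addnA.
have half j : j.*2%:R / 2 ^+ n.+1 = j%:R / 2 ^+ n :> R.
  by rewrite -muln2 natrM exprS invfM mulrA mulfK.
rewrite /moves expnS mul2n.
rewrite (double _ (fun j => nat_of_bool (X (j.+1%:R / 2 ^+ n.+1) != X (j%:R / 2 ^+ n.+1)))).
apply: leq_sum => k _.
rewrite -doubleS !half.
(* If both half cells had zero increment, so would the whole cell. *)
have [//|ne] := eqVneq (X (k.+1%:R / _)).
by have [->|//] := eqVneq (X (k.*2.+1%:R / 2 ^+ n.+1)) (X (k%:R / 2 ^+ n)); rewrite ne.
Qed.

End dyadic_variation.

(** * Jump counts of monotone lattice paths *)

Section lattice_paths.
Context {R : realType} (q : nat).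

Definition lattice_pt (v : 'I_q -> nat) : 'rV[R]_q := \row_i (v i)%:R.

Lemma lattice_pt_inj (u v : {ffun 'I_q -> nat}) : lattice_pt u = lattice_pt v -> u = v.
Proof.
move=> /rowP uv; apply/ffunP => i; have := uv i; rewrite !mxE => /eqP.
by rewrite eqr_nat => /eqP.
Qed.

Lemma lattice_pt_eq0 (v : {ffun 'I_q -> nat}) : lattice_pt v = 0 <-> ~ exists i, v i != 0%N.
Proof.
split=> [/rowP v0 [i]|v0]; first by have /eqP := v0 i; rewrite !mxE pnatr_eq0 => ->.
by apply/rowP => i; rewrite !mxE; have [->//|vi] := eqVneq (v i) 0%N; case: v0; exists i.
Qed.

Variable y : 'I_q -> R -> nat.
Hypothesis mono : forall i s t, 0 <= s <= t -> (y i s <= y i t)%N.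
Hypothesis rcst : forall i t, 0 <= t -> \forall s \near t^'+, y i s = y i t.

Let X t := lattice_pt (y ^~ t).
Let jmp t := X t - lim (X s @[s --> t^'-]).

Let stepr t : 0 <= t -> exists2 e, 0 < e & forall s, t <= s < t + e -> X s = X t.
Proof.
move=> t0; have /nbhs_ballP[e e0 h] : nbhs t (fun s => t < s -> forall i, y i s = y i t).
  exact: filter_forall (fun i => rcst i t0).
exists e => // s /andP[]; rewrite le_eqVlt => /predU1P[<-//|ts st].
apply/rowP => i; rewrite !mxE; congr _%:R; apply: h => //=.
by rewrite /ball/= distrC ger0_norm; lra.
Qed.

Let left_cst i t : 0 < t -> exists c, \forall s \near t^'-, y i s = c.
Proof.
(* The values taken on [0, t[ are naturals bounded by [y i t]; once the largest one is attained,
   monotonicity freezes the path up to t. *)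
move=> t0; pose D m := `[< exists2 s, 0 <= s < t & y i s = m >].
have D0 : exists m, D m by exists (y i 0); apply/asboolP; exists 0 => //; rewrite lexx.
have Dle m : D m -> (m <= y i t)%N.
  by move=> /asboolP[s /andP[s0 st] <-]; apply: mono; rewrite s0 ltW.
have [m /asboolP[s /andP[s0 st] sm] mmax] := ex_maxnP D0 Dle.
exists m; near=> r.
have sr : s < r by near: r; exact: nbhs_left_gt.
have rt : r < t by near: r; exact: nbhs_left_lt.
apply/eqP; rewrite eqn_leq -{2}sm mono ?s0 ?ltW// andbT; apply: mmax; apply/asboolP.
by exists r => //; rewrite rt andbT (le_trans s0)// ltW.
Unshelve. all: end_near. Qed.

Let stepl t : 0 < t -> exists2 e, 0 < e & forall s s', 0 <= s -> 0 <= s' ->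
  t - e < s < t -> t - e < s' < t -> X s = X s'.
Proof.
move=> t0; have /choice[c hc] := fun i => left_cst i t0.
have /nbhs_ballP[e e0 h] : nbhs t (fun s => s < t -> forall i, y i s = c i).
  exact: filter_forall hc.
have {}h s i : t - e < s < t -> y i s = c i.
  by move=> /andP[es st]; apply: h => //=; rewrite /ball/= ger0_norm; lra.
exists e => // s s' _ _ hs hs'; apply/rowP => i.
by rewrite !mxE (h s)// (h s').
Qed.

Let S n (A : set 'rV[R]_q) : R :=
  \sum_(k < 2 ^ n) \1_A (X (k.+1%:R / 2 ^+ n) - X (k%:R / 2 ^+ n)).

(** One n serves all A at once, so that the count for a set can be compared with those for all
    singletons on the same grid. *)
Lemma jump_count_near : \forall n \near \oo, forall A : set 'rV[R]_q, ~ A 0 ->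
  counting [set t | [/\ 0 < t <= 1, jmp t != 0 & A (jmp t)]] = (S n A)%:E.
Proof.
apply: filterS (single_step_near stepr stepl) => n hn A A0.
apply: jump_count => // k kn; have n0 : 0 < 2 ^+ n :> R by rewrite exprn_gt0.
apply: hn.
  by rewrite divr_ge0 ?exprn_ge0//= ler_pdivrMr// mul1r -natrX ler_nat ltnW.
rewrite ler_pM2r ?invr_gt0// ler_nat leqnSn/= -natr1 mulrDl mul1r exprVn.
exact: lexx.
Qed.

Let incr n k : {ffun 'I_q -> nat} :=
  [ffun i => (y i (k.+1%:R / 2 ^+ n) - y i (k%:R / 2 ^+ n))%N].

Let incrE n k : X (k.+1%:R / 2 ^+ n) - X (k%:R / 2 ^+ n) = lattice_pt (incr n k).
Proof.
apply/rowP => i; rewrite !mxE ffunE natrB// mono//.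
by rewrite divr_ge0 ?exprn_ge0//= ler_pM2r ?ler_nat ?invr_gt0 ?exprn_gt0.
Qed.

Lemma counting_jumps_esum (A : set 'rV[R]_q) :
  counting [set t | [/\ 0 < t <= 1, jmp t != 0 & A (jmp t)]] =
  (\esum_(v in [set v : {ffun 'I_q -> nat} | (exists i, v i != 0%N) /\ A (lattice_pt v)])
     counting [set t | [/\ (0 < t <= 1)%R, jmp t != 0%R & jmp t = lattice_pt v]] :> \bar R)%E.
Proof.
have [n hn] := filter_ex jump_count_near.
set VA := [set v | _ /\ _].
(* The jumps counted are nonzero, so 0 may be removed from A, as the cell count requires. *)
have -> : [set t | [/\ 0 < t <= 1, jmp t != 0 & A (jmp t)]] =
    [set t | [/\ 0 < t <= 1, jmp t != 0 & (A `\ 0) (jmp t)]].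
  by apply/seteqP; split => t /= [t01 jt]; [move=> At; split=> //; split=> //; exact/eqP|case].
rewrite hn; last by move=> [_]; exact.
transitivity (\esum_(v in VA) \sum_(k < (2 ^ n)%N) (\1_[set lattice_pt v] (lattice_pt (incr n k)) : R)%:E)%E; last first.
  apply: eq_esum => v [v0 _]; apply: etrans (esym (hn [set lattice_pt v] _)); last first.
    by move=> /esym/lattice_pt_eq0.
  by rewrite sumEFin; congr EFin; apply: eq_bigr => k _; rewrite incrE.
rewrite esum_sum; last by move=> v k _ _; rewrite lee_fin.
rewrite /S -sumEFin; apply: eq_bigr => k _; rewrite incrE.
set u := incr n k.
transitivity (\esum_(v in VA) (if v \in [set u] then 1 else 0 : \bar R))%E; last first.
  apply: eq_esum => v _; rewrite indicE; case: ifPn => [|]; rewrite ?inE ?notin_setE/=.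
    by move=> ->; rewrite mem_set.
  by move=> vu; rewrite memNset//= => /lattice_pt_inj /esym.
rewrite -esum_mkcondr indicE.
have [[Au u0]|Au] := pselect ((A `\ 0) (lattice_pt u)).
  rewrite mem_set// (_ : VA `&` [set u] = [set u]) ?esum_set1//.
  apply/seteqP; split => [v []//|v ->]; split => //; split=> //.
  by apply: contrapT => /lattice_pt_eq0.
rewrite memNset// (_ : VA `&` [set u] = set0) ?esum_set0//.
apply/seteqP; split => // v [[v0 Av] /= vu]; apply: Au; rewrite -vu; split=> //.
by move=> /lattice_pt_eq0.
Qed.

End lattice_paths.

(** * Mean number of jumps from dyadic cell counts *)

Section expected_jumps.
Context (R : realType) (d : measure_display) (T : measurableType d) (P : probability T R).
Context (q : nat) (x : 'I_q -> R -> T -> nat) (W : set T).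
Hypothesis fW : full_event P W.
Hypothesis mono : forall w, W w -> forall i s t, 0 <= s <= t -> (x i s w <= x i t w)%N.
Hypothesis rcst : forall w, W w -> forall i t, 0 <= t -> \forall s \near t^'+, x i s w = x i t w.

Let X t w : 'rV[R]_q := lattice_pt (fun i => x i t w).
Let E (v : {ffun 'I_q -> nat}) t h := [set w | X (t + h) w - X t w = lattice_pt v].
Let v0 : {ffun 'I_q -> nat} := [ffun=> 0%N].

Variables (Q : {ffun 'I_q -> nat} -> R -> \bar R) (C : R) (nu : {ffun 'I_q -> nat} -> \bar R).
Hypothesis mE : forall v t h, 0 <= t -> 0 < h -> measurable (W `&` E v t h).
Hypothesis PE : forall v t h, 0 <= t -> 0 < h -> P (W `&` E v t h) = Q v h.
Hypothesis PC : forall t h, 0 <= t -> 0 < h -> (P (W `\` E v0 t h) <= (C * h)%:E)%E.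
Hypothesis Q_nu : forall v : {ffun 'I_q -> nat}, (exists i, v i != 0%N) ->
  ((2 ^ n)%N%:R%:E * Q v (2^-1 ^+ n))%E @[n --> \oo] --> nu v.

Let mW : measurable W. Proof. exact: fW.1. Qed.
Let pt n k : R := k%:R / 2 ^+ n.
Let pt_ge0 n k : 0 <= pt n k. Proof. by rewrite divr_ge0 ?exprn_ge0. Qed.
Let h0 n : 0 < 2^-1 ^+ n :> R. Proof. by rewrite exprn_gt0. Qed.
Let ptS n k : pt n k.+1 = pt n k + 2^-1 ^+ n.
Proof. by rewrite /pt -natr1 mulrDl mul1r exprVn. Qed.

(** Both counts are restricted to [W], where the increment events are measurable and the paths are
    regular. *)
Let N v n w : R := \sum_(k < 2 ^ n) \1_(W `&` E v (pt n k) (2^-1 ^+ n)) w.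
Let K n w : R := \sum_(k < 2 ^ n) \1_(W `\` E v0 (pt n k) (2^-1 ^+ n)) w.

Let mEpt v n k : measurable (W `&` E v (pt n k) (2^-1 ^+ n)). Proof. exact: mE. Qed.

Let mKpt n k : measurable (W `\` E v0 (pt n k) (2^-1 ^+ n)).
Proof.
rewrite (_ : _ `\` _ = W `\` (W `&` E v0 (pt n k) (2^-1 ^+ n))); first exact: measurableD.
by rewrite setDIr setDv set0U.
Qed.

Let mN v n : measurable_fun setT (N v n).
Proof. by apply: measurable_sum => k; exact: measurable_indic. Qed.

Let mK n : measurable_fun setT (K n).
Proof. by apply: measurable_sum => k; exact: measurable_indic. Qed.

Let integral_sum_indic n (F : 'I_n -> set T) : (forall k, measurable (F k)) ->
  (\int[P]_w (\sum_(k < n) \1_(F k) w)%:E = \sum_(k < n) P (F k))%E.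
Proof.
move=> mF; under eq_integral do rewrite -sumEFin.
rewrite ge0_integral_sum//; last first.
  by move=> k; apply/measurable_EFinP; exact: measurable_indic.
by apply: eq_bigr => k _; rewrite integral_indicT.
Qed.

Let integral_N v n : (\int[P]_w (N v n w)%:E = (2 ^ n)%N%:R%:E * Q v (2^-1 ^+ n))%E.
Proof.
rewrite integral_sum_indic//; under eq_bigr do rewrite PE//.
by rewrite sumr_const card_ord mule_natl.
Qed.

Let integral_K n : (\int[P]_w (K n w)%:E <= C%:E)%E.
Proof.
rewrite integral_sum_indic//.
apply: (@le_trans _ _ (\sum_(k < (2 ^ n)%N) (C * 2^-1 ^+ n)%:E)%E).
  by apply: lee_sum => k _; exact: PC.
rewrite sumEFin sumr_const card_ord -(mulr_natr (C * _)) natrX -mulrA -exprMn mulVf// expr1n mulr1.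
exact: lexx.
Qed.

Let notW F w : ~ W w -> \1_(W `&` F) w = 0 :> R.
Proof. by move=> Ww; rewrite indicE memNset// => -[]. Qed.

Let KE n w : K n w = \1_W w * (moves (X ^~ w) n)%:R.
Proof.
have [Ww|Ww] := pselect (W w); last first.
  by rewrite /K indicE memNset// mul0r big1// => k _; rewrite notW.
rewrite indicE mem_set// mul1r /moves natr_sum; apply: eq_bigr => k _.
rewrite indicE; congr (nat_of_bool _)%:R; rewrite -/(pt n k) -/(pt n k.+1) ptS -subr_eq0.
have -> : (0 : 'rV[R]_q) = lattice_pt v0 by apply/rowP => i; rewrite !mxE ffunE.
by apply/idP/idP => [/set_mem[_ ne]|/eqP ne]; [exact/eqP|rewrite mem_set].
Qed.

Let K_nd w : nondecreasing_seq (fun n => (K n w)%:E).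
Proof.
apply/nondecreasing_seqP => n; rewrite lee_fin !KE ler_wpM2l// ler_nat.
exact: moves_nondecreasing.
Qed.

Let g w := limn (fun n => (K n w)%:E).

Let K_g n w : ((K n w)%:E <= g w)%E.
Proof.
apply: lime_ge; first exact: ereal_nondecreasing_is_cvgn.
by exists n => // m /= nm; exact: K_nd.
Qed.

Let ig : P.-integrable setT g.
Proof.
have mg : measurable_fun setT g.
  apply: (@emeasurable_fun_cvg _ _ _ _ (fun n w => (K n w)%:E)) => [n|w _].
    exact/measurable_EFinP.
  exact: ereal_nondecreasing_is_cvgn.
apply/integrableP; split=> //.
under eq_integral do rewrite gee0_abs ?(le_trans _ (K_g 0 _)) ?lee_fin ?sumr_ge0//.
apply: (@le_lt_trans _ _ C%:E); last exact: ltry.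
have K0 n w : [set: T] w -> (0 <= (K n w)%:E)%E by move=> _; rewrite lee_fin sumr_ge0.
rewrite monotone_convergence//; last by move=> n; exact/measurable_EFinP.
apply: lime_le; last by apply: nearW => n; exact: integral_K.
apply: ereal_nondecreasing_is_cvgn => m n mn; apply: ge0_le_integral => //.
- by move=> w wT; exact: K0.
- by apply/measurable_EFinP.
- by apply/measurable_EFinP.
- by move=> w _; exact: K_nd.
Qed.

(** Vanishing off [W], it stays below the jump count everywhere, as [integral_eq_full_event] asks
    when the count itself may fail to be measurable. *)
Let c (v : {ffun 'I_q -> nat}) w : \bar R := ((\1_W w)%:E * counting (jump_times X [set lattice_pt v] w))%E.

Let cvgN (v : {ffun 'I_q -> nat}) w : (exists i, v i != 0%N) -> (N v n w)%:E @[n --> \oo] --> c v w.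
Proof.
move=> vn0; have [Ww|Ww] := pselect (W w); last first.
  rewrite /c indicE memNset// mul0e; apply: cvg_near_cst; apply: nearW => n.
  by rewrite /N big1// => k _; rewrite notW.
rewrite /c indicE mem_set// mul1e; apply: cvg_near_cst.
apply: filterS (jump_count_near (mono Ww) (rcst Ww)) => n hn.
apply: etrans (esym (hn [set lattice_pt v] _)); last by move=> /esym/lattice_pt_eq0.
congr EFin; apply: eq_bigr => k _; rewrite -/(pt n k) -/(pt n k.+1) ptS !indicE.
congr (nat_of_bool _)%:R; apply/idP/idP => [/set_mem[_ h]|/set_mem h]; rewrite mem_set//.
Qed.

Let mc v : measurable_fun setT (c v).
Proof.
have [vn0|vn0] := pselect (exists i, v i != 0%N).
  apply: (@emeasurable_fun_cvg _ _ _ _ (fun n w => (N v n w)%:E)) => [n|w _].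
    exact/measurable_EFinP.
  exact: cvgN.
apply: (eq_measurable_fun (cst 0%E)); last exact: measurable_cst.
move=> w _; rewrite /c /jump_times; have /lattice_pt_eq0 -> := vn0.
rewrite (_ : [set t | _] = set0) ?measure0 ?mule0//.
by apply/seteqP; split => // t /= [_ /eqP + /esym e]; rewrite -e.
Qed.

Let c_ge0 v w : (0 <= c v w)%E.
Proof. by rewrite mule_ge0 ?lee_fin. Qed.

Let integral_c (v : {ffun 'I_q -> nat}) : (exists i, v i != 0%N) -> (\int[P]_w c v w = nu v)%E.
Proof.
move=> vn0.
have [] := @dominated_convergence _ T R P setT measurableT (fun n w => (N v n w)%:E) (c v) g.
- by move=> n; exact/measurable_EFinP.
- exact: mc.
- by apply: aeW => w _; exact: cvgN.
- exact: ig.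
- apply: aeW => w n _; rewrite gee0_abs ?lee_fin ?sumr_ge0//; apply: le_trans (K_g n w).
  rewrite lee_fin; apply: ler_sum => k _; rewrite !indicE ler_nat.
  case: (boolP (w \in _)) => // /set_mem[Ww Ew]; rewrite mem_set//; split => // E0.
  have /lattice_pt_inj e : lattice_pt v = lattice_pt v0 :> 'rV[R]_q by rewrite -Ew -E0.
  by have [i] := vn0; rewrite e ffunE.
move=> _ _ h; apply: (cvg_unique _ h) => //=.
by under eq_cvg do rewrite integral_N; exact: Q_nu.
Qed.

Lemma expected_jump_count (A : set 'rV[R]_q) : levy_measure P X A =
  (\esum_(v in [set v : {ffun 'I_q -> nat} | (exists i, v i != 0%N) /\ A (lattice_pt v)]) nu v)%E.
Proof.
set VA := [set v | _ /\ _].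
rewrite /levy_measure (@integral_eq_full_event _ _ _ _ W _ (fun w => \esum_(v in VA) c v w)%E)//.
- by rewrite integral_esum//; apply: eq_esum => v [vn0 _]; exact: integral_c.
- exact: measurable_esum.
- move=> w; rewrite esum_ge0//=; have [Ww|Ww] := pselect (W w); last first.
    by rewrite esum1// => v _; rewrite /c indicE memNset// mul0e.
  rewrite [leRHS](counting_jumps_esum (mono Ww) (rcst Ww)); apply: le_esum => v _.
  by rewrite /c indicE mem_set// mul1e.
- move=> w Ww; apply: etrans (counting_jumps_esum (mono Ww) (rcst Ww) A) _.
  by apply: eq_esum => v _; rewrite /c indicE mem_set// mul1e.
Qed.

End expected_jumps.

(** * The two sums of the formula *)

Section lattice_sums.
Context {R : realType} (q : nat).

Lemma esumZl (J : countType) (S : set J) (f : J -> \bar R) (r : R) : (forall v, 0 <= f v)%E -> 0 <= r ->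
  (\esum_(v in S) (r%:E * f v) = r%:E * \esum_(v in S) f v)%E.
Proof.
move=> f0 r0; rewrite !esum_nneseries//; last by move=> v; rewrite mule_ge0.
rewrite -nneseriesZl//; last by move=> n _; case: pickle_inv => // v; case: ifP.
apply: eq_eseriesr => n _; case: pickle_inv => [v|]; last by rewrite mule0.
by case: ifP; rewrite ?mule0.
Qed.

Definition axis_pt (i : 'I_q) (n : nat) : {ffun 'I_q -> nat} := [ffun l => if l == i then n else 0%N].

Lemma axis_ptE i (v : {ffun 'I_q -> nat}) : (forall l, l != i -> v l = 0%N) -> v = axis_pt i (v i).
Proof.
by move=> vi; apply/ffunP => l; rewrite ffunE; have [->//|/vi] := eqVneq l i.
Qed.

(** The nonzero values of such an F sit at the points [axis_pt i n] with n > 0, which the positive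
    integers parametrize. *)
Lemma esum_axis i (F : {ffun 'I_q -> nat} -> \bar R) : (forall v, 0 <= F v)%E ->
  (forall (v : {ffun 'I_q -> nat}) l, l != i -> v l != 0%N -> F v = 0%E) -> F (axis_pt i 0) = 0%E ->
  (\esum_(v in [set v : {ffun 'I_q -> nat} | exists l, v l != 0%N]) F v =
   \sum_(1 <= n <oo) F (axis_pt i n))%E.
Proof.
move=> F0 Fi Fi0; pose pos := [set n | (0 < n)%N].
have inj : set_bij pos (axis_pt i @` pos) (axis_pt i).
  split=> // m n _ _ /ffunP/(_ i); rewrite !ffunE eqxx; exact.
rewrite eseries_cond nneseries_esum// -(reindex_esum _ _ _ F inj).
rewrite esum_mkcond [RHS]esum_mkcond; apply: eq_esum => v _.
have [/set_mem[n n0 <-]|vi] := boolP (v \in axis_pt i @` _).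
  by rewrite mem_set//=; exists i; rewrite ffunE eqxx -lt0n.
case: ifPn => // _; move: vi; rewrite notin_setE => vi.
have [vl|] := pselect (forall l, l != i -> v l = 0%N).
  have [vi0|vi0] := eqVneq (v i) 0%N; first by rewrite (axis_ptE vl) vi0.
  by exfalso; apply: vi; exists (v i); [rewrite /pos/= lt0n|rewrite -axis_ptE].
by move=> /existsNP[l] /not_implyP[li /eqP]; exact: Fi.
Qed.

End lattice_sums.

Section levy_density.
Context {R : realType} (q : nat) (k : 'I_q -> nat) (lam : forall i : 'I_q, 'I_(k i) -> R).
Arguments lam : clear implicits.
Variables (lambda theta : R) (a : 'I_q -> R).
Hypotheses (lam0 : forall i j, 0 <= lam i j) (a0 : forall i, 0 < a i).
Hypotheses (lambda0 : 0 < lambda) (theta01 : 0 < theta < 1).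

Let Lam i := \sum_(j < k i) lam i j.

Let ratio i n (m : {ffun 'I_(k i) -> 'I_n.+1}) : R :=
  \prod_(j < k i) ((lam i j / (a i + Lam i)) ^+ m j / (m j)`!%:R).

Definition axis_density i n : R := \sum_(m in Omega (k i) n) Gamma (etan m)%:R * ratio m.

(* In a small time step either the negative binomial clock stays put, and then a single
   component jumps, or it jumps by [r], which makes every component run for a further
   gamma time of shape [r]. *)
Definition simple_jumps (v : {ffun 'I_q -> nat}) : R :=
  \sum_(i < q) (v i != 0%N)%:R * axis_density i (v i) * \prod_(l < q | l != i) (v l == 0%N)%:R.

Definition common_jumps (v : {ffun 'I_q -> nat}) : \bar R :=
  (\sum_(1 <= r <oo) (theta ^+ r / r%:R * \prod_(i < q) gamma_mix (lam i) (a i) r%:R (v i))%:E)%E.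

Let ratio_ge0 i n (m : {ffun 'I_(k i) -> 'I_n.+1}) : 0 <= ratio m.
Proof.
apply: prodr_ge0 => j _; rewrite divr_ge0// exprn_ge0// divr_ge0//.
by rewrite addr_ge0 ?sumr_ge0// ltW.
Qed.

Let Gamma_ge0 (s : R) : 0 <= Gamma s.
Proof. by rewrite Gamma_gamma_int fine_ge0// gamma_int_ge0. Qed.

Let axis_ge0 i n : 0 <= axis_density i n.
Proof. by rewrite sumr_ge0// => m _; rewrite mulr_ge0. Qed.

Let axis_term_ge0 i (v : {ffun 'I_q -> nat}) :
  0 <= (v i != 0%N)%:R * axis_density i (v i) * \prod_(l < q | l != i) (v l == 0%N)%:R.
Proof. by rewrite !mulr_ge0// prodr_ge0. Qed.

Let simple_ge0 v : 0 <= simple_jumps v.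
Proof. by rewrite sumr_ge0. Qed.

Let theta_ge0 : 0 <= theta. Proof. by have /andP[/ltW] := theta01. Qed.

Let common_ge0 v : (0 <= common_jumps v)%E.
Proof.
apply: nneseries_ge0 => r _ _; rewrite lee_fin mulr_ge0 ?divr_ge0 ?exprn_ge0//.
by rewrite prodr_ge0// => i _; rewrite gamma_mix_ge0.
Qed.

Variable A : 'I_q -> set R.
Let V := [set v : {ffun 'I_q -> nat} | exists i, v i != 0%N].
Let D := [set v : {ffun 'I_q -> nat} | forall i, A i (v i)%:R].

(** The factors [v l == 0] confine summand i to axis i, which turns the sum over lattice points into
    one over positive integers. *)
Let esum_simple : (\esum_(v in V `&` D) (simple_jumps v)%:E =
  \sum_(i < q) \sum_(1 <= n <oo)
     (\sum_(m in Omega (k i) n) Gamma (etan m)%:R *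
        (\1_(A i) n%:R * \prod_(l < q | l != i) \1_(A l) 0) * ratio m)%:E)%E.
Proof.
rewrite esum_mkcondr; pose F i v : \bar R := ((v \in D)%:R *
  ((v i != 0%N)%:R * axis_density i (v i) * \prod_(l < q | l != i) (v l == 0%N)%:R))%:E.
have F0 i v : (0 <= F i v)%E by rewrite lee_fin mulr_ge0.
transitivity (\esum_(v in V) \sum_(i < q) F i v)%E.
  apply: eq_esum => v _; rewrite sumEFin -mulr_sumr -/(simple_jumps v).
  by case: ifP; rewrite ?mul1r ?mul0r.
rewrite esum_sum//; apply: eq_bigr => i _.
rewrite (@esum_axis _ _ i)//.
- rewrite eseries_cond [RHS]eseries_cond; apply: eq_eseriesr => n /= n0; congr EFin.
  rewrite /F ffunE eqxx -lt0n n0 mul1r.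
  rewrite [X in _ * (_ * X)]big1 ?mulr1 => [|l li]; last by rewrite ffunE (negbTE li).
  rewrite mulr_sumr; apply: eq_bigr => m _; rewrite mulrA [X in X * _]mulrC; congr (_ * _ * _).
  (* The point of axis i at n lies in the box exactly when n is in [A i] and 0 is in every other
     [A l]. *)
  have [/set_mem AD|] := boolP (axis_pt i n \in D).
    have := AD i; rewrite ffunE eqxx indicE => An; rewrite mem_set// mul1r big1// => l li.
    by have := AD l; rewrite ffunE (negbTE li) indicE => Al; rewrite mem_set.
  rewrite notin_setE => /existsNP[l]; rewrite ffunE indicE; case: eqVneq => [->|li] Al.
    by rewrite memNset// mul0r.
  by rewrite (bigD1 l)//= [X in _ * (X * _)]indicE (memNset Al) mul0r mulr0.
- by move=> v l li vl; rewrite /F [X in _ * (_ * X)](bigD1 l)//= (negbTE vl) mul0r !mulr0.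
- by rewrite /F ffunE !eqxx !mul0r mulr0.
Qed.

(** Off the box some indicator vanishes and annihilates the product for every r; on the box all
    indicators are 1. *)
Let esum_common : (\esum_(v in V `&` D) common_jumps v =
  \esum_(v in V) \sum_(1 <= r <oo)
     (theta ^+ r / r%:R * \prod_(i < q) ((a i / (a i + Lam i)) ^+ r *
        \sum_(m in Omega (k i) (v i))
          pochhammer r%:R (etan m) * \1_(A i) (v i)%:R * ratio m))%:E)%E.
Proof.
rewrite esum_mkcondr; apply: eq_esum => v _.
case: ifPn => [/set_mem Dv|]; last first.
  rewrite notin_setE => /existsNP[i Ai]; apply/esym; apply: eseries0 => r _ _.
  rewrite (bigD1 i)//= [\sum_(m in Omega (k i) (v i)) _]big1 ?mulr0 ?mul0r ?mulr0// => m _.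
  by rewrite indicE memNset// mulr0 mul0r.
apply: eq_eseriesr => r _; congr (_ * _)%:E; apply: eq_bigr => i _.
rewrite /gamma_mix powR_mulrn; last by rewrite divr_ge0 ?addr_ge0 ?sumr_ge0 ?(ltW (a0 i)).
by congr (_ * _); apply: eq_bigr => m _; rewrite indicE mem_set ?mulr1//.
Qed.

Lemma levy_density_sum :
  (\esum_(v in [set v : {ffun 'I_q -> nat} | (exists i, v i != 0%N) /\ box A (lattice_pt v)])
     (lambda%:E * ((simple_jumps v)%:E + common_jumps v)) =
   (lambda%:E *
     (\sum_(i < q) \sum_(1 <= n <oo)
        (\sum_(m in Omega (k i) n)
           Gamma (etan m)%:R
           * (\1_(A i) n%:R * \prod_(l < q | l != i) \1_(A l) 0)
           * \prod_(j < k i) ((lam i j / (a i + Lam i)) ^+ m j / (m j)`!%:R))%:E)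
   + lambda%:E *
     \esum_(n in [set n : {ffun 'I_q -> nat} | exists i, n i != 0%N])
       \sum_(1 <= r <oo)
         (theta ^+ r / r%:R *
          \prod_(i < q)
            ((a i / (a i + Lam i)) ^+ r *
             \sum_(m in Omega (k i) (n i))
               pochhammer r%:R (etan m) * \1_(A i) (n i)%:R
               * \prod_(j < k i)
                   ((lam i j / (a i + Lam i)) ^+ m j / (m j)`!%:R)))%:E))%E.
Proof.
have -> : [set v : {ffun 'I_q -> nat} | (exists i, v i != 0%N) /\ box A (lattice_pt v)] = V `&` D.
  by apply/seteqP; split => v [Vv Dv]; split=> // i; have := Dv i; rewrite /= mxE.
rewrite esumZl ?(ltW lambda0)//; last by move=> v; rewrite adde_ge0// lee_fin.
rewrite esumD//; last by move=> v _; rewrite lee_fin.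
rewrite muleDr//; last first.
  by apply: ge0_adde_def; rewrite inE esum_ge0// => v _; rewrite lee_fin.
by rewrite esum_simple esum_common.
Qed.

End levy_density.

(** By [gamma_process_gcp_pmf] at time s / lambda it is the mean of point probabilities, and every
    shape s > 0 is attained at such a time. *)
Lemma gamma_mix_le1 (R : realType) (d : measure_display) (T : measurableType d) (P : probability T R)
    (lambda a : R) (Z : R -> T -> R) (k : nat) (lam : 'I_k -> R) s n :
  0 < lambda -> 0 < a -> gamma_process P lambda a Z -> (forall j, 0 <= lam j) -> 0 < s ->
  gamma_mix lam a s n <= 1.
Proof.
move=> lambda0 a0 Zg lam0 s0.
have t0 : 0 < s / lambda by rewrite divr_gt0.
have := gamma_process_gcp_pmf lambda0 a0 Zg n lam0 t0.
rewrite mulrCA divff ?gt_eqF// mulr1 -lee_fin => <-.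
have mZ : measurable_fun setT (Z (s / lambda)).
  by have [[mZ _ _ _ _] _] := Zg; apply: mZ; exact: ltW.
apply: (@le_trans _ _ (\int[P]_w 1)%E); last first.
  rewrite integral_cst// mul1e; exact: probability_le1.
apply: ge0_le_integral => //.
- by move=> w _; rewrite lee_fin gcp_pmf_ge0.
- apply/measurable_EFinP; apply: (@measurableT_comp _ _ _ _ _ _ (fun y : R => gcp_pmf lam y n)).
    by apply: continuous_measurable_fun; exact: continuous_gcp_pmf.
  exact: measurableT_comp.
- by move=> w _; rewrite lee_fin gcp_pmf_le1.
Qed.

(** * The law of one short increment *)

Section small_time_increments.
Context {R : realType} (q : nat) (k : 'I_q -> nat) (lam : forall i : 'I_q, 'I_(k i) -> R).
Arguments lam : clear implicits.
Variables (lambda theta : R) (a : 'I_q -> R).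
Hypotheses (lam0 : forall i j, 0 <= lam i j) (a0 : forall i, 0 < a i).
Hypotheses (lambda0 : 0 < lambda) (theta01 : 0 < theta < 1).
Hypothesis mix_le1 : forall i s n, 0 < s -> gamma_mix (lam i) (a i) s n <= 1.

Definition increment_pmf (v : 'I_q -> nat) (h : R) : \bar R := (\sum_(0 <= c <oo)
  (nb_pmf theta (lambda * h) c *
   \prod_(i < q) gamma_mix (lam i) (a i) (lambda * h + c%:R) (v i))%:E)%E.

Let theta_gt0 : 0 < theta. Proof. by have /andP[] := theta01. Qed.
Let theta_lt1 : 0 < 1 - theta. Proof. by rewrite subr_gt0; have /andP[] := theta01. Qed.

Lemma increment_pmf_cvg (v : {ffun 'I_q -> nat}) : (exists i, v i != 0%N) ->
  ((2 ^ n)%N%:R%:E * increment_pmf v (2^-1 ^+ n) @[n --> \oo] -->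
   lambda%:E * ((simple_jumps lam a v)%:E + common_jumps lam theta a v))%E.
Proof.
move=> vn0.
have half0 : (2^-1 ^+ n : R) @[n --> \oo] --> (0 : R).
  by apply: cvg_expr; rewrite gtr0_norm; lra.
have x0 : lambda * 2^-1 ^+ n @[n --> \oo] --> (0 : R).
  by rewrite -[X in _ --> X](mulr0 lambda); apply: cvgM => //; exact: cvg_cst.
(* [small_time] asks for steps at most 1, which holds from rank N on; hence the shift. *)
have [N _ hN] : \forall n \near \oo, lambda * 2^-1 ^+ n <= 1.
  by apply: (cvgr_le _ x0); exact: ltr01.
pose x n := lambda * 2^-1 ^+ (n + N).
have x_gt0 n : 0 < x n by rewrite mulr_gt0// exprn_gt0.
have cx : x @ \oo --> (0 : R) by rewrite (cvg_shiftn N (fun n => lambda * 2^-1 ^+ n)).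
rewrite -(cvg_shiftn N (fun n => ((2 ^ n)%N%:R%:E * increment_pmf v (2^-1 ^+ n))%E)).
(* Here 2^(n+N) = lambda / x n, the origin of the factor lambda in the formula. *)
have e n : ((2 ^ (n + N))%N%:R%:E * increment_pmf v (2^-1 ^+ (n + N)) =
    lambda%:E * ((x n)^-1%:E * increment_pmf v (2^-1 ^+ (n + N))))%E.
  rewrite muleA -EFinM; congr (_%:E * _)%E.
  by rewrite /x invfM mulVKf ?gt_eqF// exprVn invrK natrX.
rewrite (funext e); apply: cvgeZl => //.
apply: (@small_time _ _ _ (fun i s => gamma_mix (lam i) (a i) s (v i)) (fun i => v i == 0%N)
  (fun i => axis_density lam a i (v i)) theta01 _ _ _ x) => //.
- by move=> i; exact: continuous_gamma_mix.
- by move=> i s s0; rewrite gamma_mix_ge0 ?(ltW s0)//= mix_le1.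
- by move=> i; exact: gamma_mix0.
- by move=> n; rewrite x_gt0 hN//= leq_addl.
- by move=> i vi; apply: gamma_mix_small_time => // n; rewrite gt_eqF.
Qed.

(** Chosen so that the term c = 0 at v = 0 is [expR (- move_rate * h)]. It bounds the true rate of
    moves from above, as it counts every clock jump as a move. *)
Definition move_rate : R :=
  - (lambda * (ln (1 - theta) + \sum_(i < q) ln (a i / (a i + \sum_(j < k i) lam i j)))).

Lemma increment_pmf0_ge h : 0 < h -> ((1 - move_rate * h)%:E <= increment_pmf (fun=> 0%N) h)%E.
Proof.
move=> h0; have lh : 0 < lambda * h by rewrite mulr_gt0.
have base0 i : 0 < a i / (a i + \sum_(j < k i) lam i j).
  by rewrite divr_gt0// ltr_wpDr// sumr_ge0.
have pos c : (0 <= (nb_pmf theta (lambda * h) c *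
   \prod_(i < q) gamma_mix (lam i) (a i) (lambda * h + c%:R) 0)%:E)%E.
  rewrite lee_fin mulr_ge0//; last first.
    by rewrite prodr_ge0// => i _; rewrite gamma_mix_ge0// addr_ge0// ltW.
  by rewrite !mulr_ge0 ?powR_ge0 ?pochhammer_ge0 ?invr_ge0 ?exprn_ge0 ?(ltW lh) ?(ltW theta_gt0).
rewrite /increment_pmf nneseries_recl//.
apply: le_trans (leeDl _ _); last by apply: nneseries_ge0 => c _ _; exact: pos.
rewrite lee_fin.
suff -> : nb_pmf theta (lambda * h) 0 * \prod_(i < q) gamma_mix (lam i) (a i) (lambda * h + 0%:R) 0 =
    expR (- move_rate * h) by rewrite -mulNr expR_ge1Dx.
under eq_bigr do rewrite gamma_mixn0// addr0 /powR gt_eqF//.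
rewrite -expR_sum /nb_pmf /pochhammer big_ord0 fact0 divr1 !mulr1 /powR gt_eqF// -expRD.
by rewrite -mulr_sumr -mulrDr /move_rate opprK mulrAC.
Qed.

End small_time_increments.

(** A jump in the first sum is n times the i-th unit vector; its other coordinates are 0, so
    membership in the box brings the factors [\1_(A l) 0]. *)
Theorem theorem4p1 (R : realType) (d : measure_display) (T : measurableType d)
    (P : probability T R)
    (q : nat) (k : 'I_q -> nat) (lam : forall i : 'I_q, 'I_(k i) -> R)
    (lambda theta : R) (a : 'I_q -> R)
    (M : 'I_q -> R -> T -> nat) (Z : 'I_q -> R -> T -> R) (B : R -> T -> nat)
    (q_gt0 : (0 < q)%N) (k_gt0 : forall i, (0 < k i)%N)
    (lam_gt0 : forall i j, 0 < lam i j)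
    (lambda_gt0 : 0 < lambda) (theta01 : 0 < theta < 1)
    (a_gt0 : forall i, 0 < a i)
    (M_gcp : forall i, gcp P (lam i) (M i))
    (M_indep : independent_processes P (fun i t w => (M i t w)%:R))
    (Z_gamma : forall i, gamma_process P lambda (a i) (Z i))
    (Z_indep : independent_processes P Z)
    (B_nb : negative_binomial_process P lambda theta B)
    (ZB_indep : sigma_independent P (process_sigma Z)
       (process_sigma (fun (_ : unit) t w => (B (lambda * t) w)%:R)))
    (MG_indep : sigma_independent P
       (process_sigma (fun i t w => (M i t w)%:R))
       (process_sigma (gamma_subordinator lambda Z B)))
    (A : 'I_q -> set R) (mA : forall i, measurable (A i)) :
  let Lam i := \sum_(j < k i) lam i j in
  levy_measure P (time_changed M (gamma_subordinator lambda Z B)) (box A) =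
  (lambda%:E *
     (\sum_(i < q) \sum_(1 <= n <oo)
        (\sum_(m in Omega (k i) n)
           Gamma (etan m)%:R
           * (\1_(A i) n%:R * \prod_(l < q | l != i) \1_(A l) 0)
           * \prod_(j < k i) ((lam i j / (a i + Lam i)) ^+ m j / (m j)`!%:R))%:E)
   + lambda%:E *
     \esum_(n in [set n : {ffun 'I_q -> nat} | exists i, n i != 0%N])
       \sum_(1 <= r <oo)
         (theta ^+ r / r%:R *
          \prod_(i < q)
            ((a i / (a i + Lam i)) ^+ r *
             \sum_(m in Omega (k i) (n i))
               pochhammer r%:R (etan m) * \1_(A i) (n i)%:R
               * \prod_(j < k i)
                   ((lam i j / (a i + Lam i)) ^+ m j / (m j)`!%:R)))%:E)%E.
Proof.
move=> Lam; have lam0 i j : 0 <= lam i j by exact/ltW.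
have [W fW hW] := time_changed_paths lambda_gt0 M_gcp Z_gamma B_nb.
set G := gamma_subordinator lambda Z B in MG_indep hW *.
pose x i t w := M i (G i t w) w.
have WG w : W w -> forall i s t, 0 <= s <= t -> 0 <= G i s w <= G i t w by move=> /hW[].
have WM w : W w -> forall i t, 0 <= t -> \forall s \near t^'+, M i s w = M i t w.
  by move=> /hW[].
have mono w : W w -> forall i s t, 0 <= s <= t -> (x i s w <= x i t w)%N by move=> /hW[].
have rcst w : W w -> forall i t, 0 <= t -> \forall s \near t^'+, x i s w = x i t w.
  by move=> /hW[].
pose X t w : 'rV[R]_q := lattice_pt (fun i => x i t w).
pose E (v : {ffun 'I_q -> nat}) t h := [set w | X (t + h) w - X t w = lattice_pt v].
have EE v t h :
    E v t h = [set w | forall i, (x i (t + h) w)%:R - (x i t w)%:R = (v i)%:R :> R].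
  apply/seteqP; split => w /=.
    by move=> /rowP e i; have := e i; rewrite !mxE.
  by move=> e; apply/rowP => i; rewrite !mxE.
pose v0 : {ffun 'I_q -> nat} := [ffun=> 0%N].
have mE v t h : 0 <= t -> 0 < h -> measurable (W `&` E v t h).
  by move=> t0 h0; rewrite EE; exact: (increment_measurable lambda_gt0 M_gcp Z_gamma B_nb v fW).
have PE v t h : 0 <= t -> 0 < h ->
    P (W `&` E v t h) = increment_pmf lam lambda theta a v h.
  move=> t0 h0; rewrite EE; exact: (increment_law lam0 lambda_gt0 a_gt0 M_gcp M_indep Z_gamma
    Z_indep B_nb ZB_indep MG_indep v fW).
have PC t h : 0 <= t -> 0 < h ->
    (P (W `\` E v0 t h) <= (move_rate lam lambda theta a * h)%:E)%E.
  (* Measurability is known for [W] intersected with [E v0 t h], so the difference is expressed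
     through this event. *)
  move=> t0 h0; rewrite (_ : W `\` _ = W `\` (W `&` E v0 t h)); last by rewrite setDIr setDv set0U.
  have mEv := mE v0 t h t0 h0.
  have -> : (P (W `\` (W `&` E v0 t h)) = 1 - P (W `&` E v0 t h))%E.
    apply: etrans (measureD fW.1 mEv _) _; first by rewrite ltey_eq fin_num_measure//; exact: fW.1.
    by rewrite setIA setIid; congr (_ - _)%E; exact: fW.2.
  rewrite leeBlDr; last exact: fin_num_measure.
  rewrite PE//.
  rewrite (_ : 1%E = (move_rate lam lambda theta a * h)%:E + (1 - move_rate lam lambda theta a * h)%:E)%E.
    rewrite leeD2l//; apply: le_trans (increment_pmf0_ge lam0 a_gt0 lambda_gt0 theta01 h0) _.
    by rewrite /increment_pmf; under [leRHS]eq_eseriesr do under eq_bigr do rewrite ffunE.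
  by rewrite -EFinD addrC subrK.
have mix_le1 i s n : 0 < s -> gamma_mix (lam i) (a i) s n <= 1.
  exact: (gamma_mix_le1 _ lambda_gt0 (a_gt0 i) (Z_gamma i) (lam0 i)).
rewrite -(levy_density_sum lam0 a_gt0 lambda_gt0 theta01).
exact: (expected_jump_count fW mono rcst mE PE PC
  (increment_pmf_cvg lam0 a_gt0 lambda_gt0 theta01 mix_le1)).
Qed.
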